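(* Let $(w_{s,t})_{(s,t)\in\Delta(I)}$ be an absolutely continuous evolution family in $\mathbb{H}$ contained in $\mathfrak{BF}$ and let $\phi$ be the associated Herglotz vector field. Suppose that for any $(s,t)\in\Delta(I)$, $w_{s,t}(x)\to0$ as $\mathbb{R}\ni x\to0^+$. Then for all $(s,t)\in\Delta(I)$, $$w''_{s,t}(0)=-\,w_{s,t}'(0)\int_s^t\phi''(0,\xi)\,w'_{s,\xi}(0)\,\mathrm{d}\xi,$$ where $w'_{s,\xi}(0)$, $w''_{s,t}(0)$, and $\phi''(0,\xi)$ are understood as the limits of $w'_{s,\xi}(x)$, $w''_{s,t}(x)$, and of $\phi''(x,\xi)$ as $\mathbb{R}\ni x\to0^+$, respectively. These limits, as well as the integral on the right-hand side (and the integral $\int_s^t\phi'(0,\xi)\,\mathrm{d}\xi$ appearing in the analogous first-order formula $w'_{s,t}(0)=\exp\big(-\int_s^t\phi'(0,\xi)\,\mathrm{d}\xi\big)$), are allowed to be infinite.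
   Context: $\mathbb{H}:=\{z\in\mathbb{C}\colon\operatorname{Re}z>0\}$; $\mathsf{Hol}(D,E)$ is the set of holomorphic functions $f$ in $D$ with $f(D)\subset E$, with the topology of locally uniform convergence. Primes denote derivatives with respect to the space variable: $\phi''(\cdot,\xi)$ is the second derivative of $\phi(\cdot,\xi)$. Under the integral sign the usual convention $0\cdot\infty=0$ is used. A Bernstein function is a non-negative $C^\infty$ function $f$ on $(0,+\infty)$ such that $(-1)^{n+1}f^{(n)}(x)\ge0$ for all $x>0$ and all $n\in\mathbb{N}=\{1,2,\dots\}$. $\mathfrak{BF}$ denotes the class of all $v\in\mathsf{Hol}(\mathbb{H},\mathbb{C})$ such that $v|_{(0,+\infty)}$ is a Bernstein function that is not identically zero; $\mathfrak{BF}\subset\mathsf{Hol}(\mathbb{H},\mathbb{H})$. A one-parameter semigroup in $\mathsf{Hol}(\mathbb{H},\mathbb{H})$ is a family $(v_t)_{t\ge0}$ of holomorphic self-maps of $\mathbb{H}$ with $v_0=\mathrm{id}_{\mathbb{H}}$, $v_s\circ v_t=v_{s+t}$ for $s,t\ge0$, and $v_t\to\mathrm{id}_{\mathbb{H}}$ locally uniformly as $t\to0^+$. Its infinitesimal generator is $\lim_{t\to0^+}(\mathrm{id}_{\mathbb{H}}-v_t)/t\in\mathsf{Hol}(\mathbb{H},\mathbb{C})$ (the limit always exists). $I\subset\mathbb{R}$ is an interval of the form $[0,T]$ with $T\in(0,+\infty)$ or $[0,T)$ with $T\in(0,+\infty]$; $\Delta(I):=\{(s,t)\colon s,t\in I,\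 s\le t\}$; $I_s:=I\cap[s,+\infty)$; $L^1_{\mathrm{loc}}(I)$ is the class of measurable functions on $I$ integrable on each compact subinterval of $I$. An absolutely continuous evolution family in $\mathbb{H}$ over $I$ is a family $(w_{s,t})_{(s,t)\in\Delta(I)}\subset\mathsf{Hol}(\mathbb{H},\mathbb{H})$ such that: EF1: $w_{s,s}=\mathrm{id}_{\mathbb{H}}$ for all $s\in I$; EF2: $w_{s,u}=w_{t,u}\circ w_{s,t}$ whenever $s\le t\le u$ in $I$; EF3: for each $z\in\mathbb{H}$ there is a non-negative $f_z\in L^1_{\mathrm{loc}}(I)$ with $|w_{s,u}(z)-w_{s,t}(z)|\le\int_t^u f_z(r)\,\mathrm{d}r$ whenever $s\le t\le u$ in $I$. A Herglotz vector field in $\mathbb{H}$ is a function $\phi\colon\mathbb{H}\times I\to\mathbb{C}$ such that: $\phi(\cdot,t)$ is the infinitesimal generator of a one-parameter semigroup in $\mathsf{Hol}(\mathbb{H},\mathbb{H})$ for any $t\in I$; $\phi(z,\cdot)$ is measurable on $I$ for any $z\in\mathbb{H}$; and for any compact $K\subset\mathbb{H}$ there is a non-negative $M_K\in L^1_{\mathrm{loc}}(I)$ with $\max_{z\in K}|\phi(z,t)|\le M_K(t)$ for a.e. $t\in I$. Two Herglotz vector fields are identified if they agree for a.e. $t\in I$. It is known that each absolutely continuous evolution family $(w_{s,t})$ has a unique associated Herglotz vector field $\phi$, characterized by: for any $z\in\mathbb{H}$ and any $s\in[0,T)$, $I_s\ni t\mapsto w(t)=w_{s,t}(z)$ is a (locally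 absolutely continuous) solution of $\frac{\mathrm{d}w}{\mathrm{d}t}+\phi(w,t)=0$ for a.e. $t\in I_s$, $w(s)=z$. *)

(* Defs.v *)
From HB Require Import structures.
From mathcomp Require Import all_boot all_order all_algebra.
From mathcomp Require Import complex.
From mathcomp Require Import all_classical all_reals all_analysis.
From mathcomp Require Import measurable_realfun.

Set Implicit Arguments.
Unset Strict Implicit.
Unset Printing Implicit Defensive.

Import Order.TTheory GRing.Theory Num.Theory.
Import numFieldNormedType.Exports.

Local Open Scope classical_set_scope.
Local Open Scope ring_scope.
Local Open Scope complex_scope.

(* [R[i]] is a numClosedFieldType in real-closed, but carries no topology;
   this gives it the usual one, and makes [derivable f z 1] and [derive1n]
   denote complex differentiation for [f : R[i] -> R[i]]. *)
#[warning="-redundant-canonical-projection"]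
HB.instance Definition _ (R : rcfType) := NormedModule.copy R[i] R[i]^o.

(* The real line with the Lebesgue (i.e. completed Borel) sigma-algebra, the
   domain of [completed_lebesgue_measure]. *)
Notation lebesgueType R :=
  (caratheodory_type (@wlength R idfun)^*%mu) (only parsing).

Section Defs.
Context {R : realType}.
Local Notation C := R[i].
Local Notation mu := (@completed_lebesgue_measure R).
Local Notation normc := (@Normc.normc R).

Definition rhp : set C := [set z | 0 < complex.Re z].

(* Only the values of [f] on the (open) set [D] matter. *)
Definition Hol (D E : set C) (f : C -> C) : Prop :=
  (forall z, D z -> derivable f z 1) /\ (forall z, D z -> E (f z)).

Definition bernstein (f : R -> R) : Prop :=
  [/\ forall x, 0 < x -> 0 <= f x,
      forall n x, 0 < x -> derivable (derive1n n f) x 1 &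
      forall n x, (0 < n)%N -> 0 < x -> 0 <= (-1) ^+ n.+1 * derive1n n f x].

Definition BF (v : C -> C) : Prop :=
  Hol rhp setT v /\
  exists f : R -> R,
    [/\ bernstein f, forall x, 0 < x -> v x%:C = (f x)%:C &
        exists2 x, 0 < x & f x <> 0].

Definition compact_in_rhp (K : set C) : Prop := compact K /\ K `<=` rhp.

Definition one_parameter_semigroup (v : R -> C -> C) : Prop :=
  [/\ forall t, 0 <= t -> Hol rhp rhp (v t),
      forall z, rhp z -> v 0 z = z,
      forall s t z, 0 <= s -> 0 <= t -> rhp z -> v s (v t z) = v (s + t) z &
      {family compact_in_rhp, v t @[t --> 0^'+] --> id}].

Definition infinitesimal_generator (g : C -> C) : Prop :=
  Hol rhp setT g /\
  exists2 v : R -> C -> C, one_parameter_semigroup v &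
    {family compact_in_rhp,
      (fun z => (z - v t z) / t%:C) @[t --> 0^'+] --> g}.

Definition time_interval (T : \bar R) (I : set R) : Prop :=
  (0 < T)%E /\
  ((T \is a fin_num /\ I = [set x | 0 <= x /\ (x%:E <= T)%E]) \/
   I = [set x | 0 <= x /\ (x%:E < T)%E]).

Definition lebesgue_measurable d (U : sigmaRingType d) (D : set R)
    (f : R -> U) : Prop :=
  @measurable_fun _ _ (lebesgueType R) U D f.

Definition L1loc (I : set R) (f : R -> R) : Prop :=
  lebesgue_measurable I f /\
  forall a b, `[a, b] `<=` I -> mu.-integrable `[a, b] (EFin \o f).

Definition ac_evolution_family (I : set R) (w : R -> R -> C -> C) : Prop :=
  [/\ forall s t, I s -> I t -> s <= t -> Hol rhp rhp (w s t),
      forall s z, I s -> rhp z -> w s s z = z,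
      forall s t u z, I s -> I t -> I u -> s <= t -> t <= u -> rhp z ->
        w s u z = w t u (w s t z) &
      forall z, rhp z -> exists f : R -> R,
        [/\ forall r, I r -> 0 <= f r, L1loc I f &
            forall s t u, I s -> I t -> I u -> s <= t -> t <= u ->
              ((normc (w s u z - w s t z))%:E <=
                \int[mu]_(r in `[t, u]) (f r)%:E)%E]].

Definition herglotz_vector_field (I : set R) (phi : C -> R -> C) : Prop :=
  [/\ forall t, I t -> infinitesimal_generator (phi^~ t),
      forall z, rhp z ->
        lebesgue_measurable I (fun t => complex.Re (phi z t)) /\
        lebesgue_measurable I (fun t => complex.Im (phi z t)) &
      forall K, compact_in_rhp K -> exists M : R -> R,
        [/\ forall t, I t -> 0 <= M t, L1loc I M &
            {ae mu, forall t, I t ->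
              forall z, K z -> normc (phi z t) <= M t}]].

(* Derivative of a curve in the complex plane with respect to real time;
   [derivable] does not apply since [R[i]] is normed over itself, not over
   [R]. *)
Definition has_time_derivative (g : R -> C) (t : R) (l : C) : Prop :=
  (g (t + h) - g t) / h%:C @[h --> 0^'] --> l.

Definition absolutely_continuous (a b : R) (g : R -> C) : Prop :=
  forall e, 0 < e -> exists2 d, 0 < d &
    forall n (x y : 'I_n -> R),
      (forall i, [/\ a <= x i, x i <= y i & y i <= b]) ->
      (forall i j, i != j -> y i <= x j \/ y j <= x i) ->
      \sum_(i < n) (y i - x i) < d ->
      \sum_(i < n) normc (g (y i) - g (x i)) < e.

Definition associated_vector_field (T : \bar R) (I : set R)
    (w : R -> R -> C -> C) (phi : C -> R -> C) : Prop :=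
  herglotz_vector_field I phi /\
  forall z s, rhp z -> 0 <= s -> (s%:E < T)%E ->
    [/\ forall a b, `[a, b] `<=` I `&` [set t | s <= t] ->
          absolutely_continuous a b (fun t => w s t z),
        {ae mu, forall t, I t -> s <= t ->
          exists2 dw, has_time_derivative (fun r => w s r z) t dw &
            dw + phi (w s t z) t = 0} &
        w s s z = z].

(* The limit at [0+] along the positive axis, in the extended reals, of a
   function that is real-valued there. *)
Definition lim0 (f : C -> C) : \bar R :=
  lim ((complex.Re (f x%:C))%:E @[x --> 0^'+]).

Definition has_lim0 (f : C -> C) : Prop :=
  (forall x : R, 0 < x -> complex.Im (f x%:C) = 0) /\
  cvg ((complex.Re (f x%:C))%:E @[x --> 0^'+]).

(* The Lebesgue integral of [f] over [D] is meaningful, possibly infinite. *)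
Definition integral_exists (D : set R) (f : R -> \bar R) : Prop :=
  lebesgue_measurable D f /\
  ((\int[mu]_(x in D) f^\+ x < +oo)%E \/ (\int[mu]_(x in D) f^\- x < +oo)%E).

End Defs.

(* Main.v *)
(* On the real axis the maps [w s t] are increasing and concave with nonnegative
   third derivative.  By the chain rule, the quantity [- w'' / w'] is additive
   along the flow; it is dominated by the primitive of an integrable function
   (by concavity, second derivatives are controlled by finitely many
   displacements [w t u x - x]), and for almost every [t] its right derivative is
   [phi''(w s t x, t) w'(s, t, x)], because [(w t (t + h) x - x) / h] converges to
   [- phi(x, t)] on a dense set of [x > 0] and convexity upgrades this to the first
   two derivatives.  Integrating in time gives the formula at every [x > 0], with a
   nonnegative integrand that increases as [x] decreases to [0], so monotone
   convergence yields the claim, infinite values included.  The a.e. derivative is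
   integrated by two applications of Fatou's lemma, to the function and to its
   difference with the dominating primitive.

   That complex derivatives exist to the required order (so that the complex
   second derivatives restrict to the real ones) rests on Goursat's lemma for
   rectangles and the Cauchy formula [f z * oint du / (u - z) = oint f u / (u - z) du],
   where the left-hand integral only has to be nonzero near the centre. *)

Require Import Defs.
From HB Require Import structures.
From mathcomp Require Import all_boot all_order all_algebra.
From mathcomp Require Import complex.
From mathcomp Require Import all_classical all_reals all_analysis.
From mathcomp Require Import measurable_realfun.
From mathcomp Require Import ring lra.

Set Implicit Arguments.
Unset Strict Implicit.
Unset Printing Implicit Defensive.

Import Order.TTheory GRing.Theory Num.Theory.
Import numFieldNormedType.Exports.

Local Open Scope classical_set_scope.
Local Open Scope ring_scope.
Local Open Scope complex_scope.

(** The differential equation holds only for almost every time, and the exceptional null set depends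
    on the starting time and the starting point. So nothing can be read off at a prescribed point:
    at one time only countably many trajectories are usable. Concavity must do the rest, and each of
    the two upgrades, to the first and to the second derivative, spends one further sign condition
    on the maps. The quotient [- w'' / w'] needs [w' > 0], which the Bernstein property alone does
    not give, constants being Bernstein functions; strict monotonicity is propagated through short
    time steps instead. At 0 the product of limits may take the form [0 * +oo]. Each factor is
    non-negative and lies below its limit, so a limit equal to 0 forces that factor to vanish
    identically and the convention [0 * +oo = 0] gives the correct limit. The analysis is done for
    Borel functions and transferred to the completed measure of the statement, whose completeness
    makes functions known only almost everywhere measurable. *)

Section ComplexTopology.
Context {R : realType}.
Local Notation C := R[i].
Local Notation N := (@Normc.normc R).

Lemma normc_ge0 (z : C) : 0 <= N z.
Proof. by case: z => a b; exact: sqrtr_ge0. Qed.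

Lemma normC_normc (z : C) : `|z| = (N z)%:C.
Proof. by []. Qed.

Lemma normcB (x y : C) : N (x - y) = N (y - x).
Proof. by rewrite -opprB; exact: (@normcN R). Qed.

Lemma ler_normcD (x y : C) : N (x + y) <= N x + N y.
Proof. exact: (@le_normcD R). Qed.

Lemma normc_gt0 (z : C) : z != 0 -> 0 < N z.
Proof.
move=> z0; rewrite lt_neqAle normc_ge0 andbT eq_sym.
by apply: contra_neq z0; exact: Normc.eq0_normc.
Qed.

Lemma normc_real (x : R) : N x%:C = `|x|.
Proof. by rewrite /= expr0n/= addr0 sqrtr_sqr. Qed.

Lemma ler_Re_normc (z : C) : `|complex.Re z| <= N z.
Proof.
by case: z => a b /=; rewrite -sqrtr_sqr ler_wsqrtr// lerDl sqr_ge0.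
Qed.

Lemma ler_Im_normc (z : C) : `|complex.Im z| <= N z.
Proof.
by case: z => a b /=; rewrite -sqrtr_sqr ler_wsqrtr// lerDr sqr_ge0.
Qed.

Lemma ler_normc_ReIm (z : C) : N z <= `|complex.Re z| + `|complex.Im z|.
Proof.
case: z => a b; have -> : a +i* b = a%:C + 'i%C * b%:C by rewrite {1}(complexE (a +i* b)).
rewrite (le_trans (ler_normcD _ _))// Normc.normcM !normc_real /=.
by rewrite expr0n add0r expr1n sqrtr1 mul1r !(mul0r,subr0,addr0,mul1r,mulr0,add0r).
Qed.

(** The norm of [R[i]] is itself complex-valued; since [0 < e] in [R[i]] forces [e] to be real,
    complex radii can be traded for real ones. *)
Lemma cvgCP T (F : set_system T) (f : T -> C) (l : C) : Filter F ->
  f x @[x --> F] --> l <->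
  forall e : R, 0 < e -> \forall x \near F, N (f x - l) < e.
Proof.
move=> FF; split.
  move/cvgrPdist_lt => H e e0.
  have e0' : (0 : C) < e%:C by rewrite ltcR.
  have := H _ e0'; apply: filterS => x.
  by rewrite normC_normc ltcR normcB.
move=> H; apply/cvgrPdist_lt => -[e ei]; rewrite ltcE => /andP[/eqP/= eiE e0].
have := H _ e0; apply: filterS => x.
by rewrite normC_normc ltcE/= eiE eqxx/= normcB.
Qed.

Lemma nbhsCP (p : C) (P : set C) :
  nbhs p P <-> exists2 d : R, 0 < d & forall z, N (z - p) < d -> P z.
Proof.
rewrite -nbhs_ballE; split.
  move=> [[d di]/=]; rewrite ltcE => /andP[/eqP/= -> d0] H; exists d => // z zd.
  by apply: H; rewrite /ball/= normC_normc ltcR normcB.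
move=> [d d0 H]; exists d%:C; first by rewrite /= ltcR.
by move=> z; rewrite /ball/= normC_normc ltcR normcB; exact: H.
Qed.

End ComplexTopology.

(** * Complex differentiability and continuity with real tolerances *)

Section cdiff.
Context {R : realType}.
Local Notation C := R[i].
Local Notation N := (@Normc.normc R).

(** Increment form: no division, [h = 0] allowed and a real tolerance, so that estimates under an
    integral apply directly. *)
Definition cdiff (f : C -> C) (z l : C) := forall e : R, 0 < e ->
  exists2 d : R, 0 < d & forall h, N h < d ->
    N (f (z + h) - f z - l * h) <= e * N h.

Lemma cdiffP (f : C -> C) (z l : C) : cdiff f z l <-> is_derive z 1 f l.
Proof.
have key : h^-1 *: ((f \o shift z) (h *: 1) - f z) @[h --> 0^'] --> l <->
    cdiff f z l.
  rewrite cvgCP; split => H e e0.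
  - have := H _ e0; rewrite near_withinE => /nbhsCP[d d0 dP]; exists d => // h hd.
    have [->|h0] := eqVneq h 0.
      by rewrite addr0 subrr mulr0 subrr !Normc.normc0 mulr0.
    have := dP h; rewrite subr0 => /(_ hd h0) /ltW.
    rewrite /= /shift/= [h *: 1]mulr1 (addrC h).
    have -> : h^-1 *: (f (z + h) - f z) - l = (f (z + h) - f z - l * h) / h.
      by rewrite mulrBl mulfK// mulrC.
    by rewrite Normc.normcM Normc.normcV ler_pdivrMr// normc_gt0.
  (* The tolerance is halved because [cdiff] bounds non-strictly while the limit asks for a strict
     inequality. *)
  - have [d d0 dP] := H _ (divr_gt0 e0 (ltr0Sn _ 1)).
    rewrite near_withinE; apply/nbhsCP; exists d => // h; rewrite subr0 => hd h0.
    rewrite /= /shift/= [h *: 1]mulr1 (addrC h).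
    have -> : h^-1 *: (f (z + h) - f z) - l = (f (z + h) - f z - l * h) / h.
      by rewrite mulrBl mulfK// mulrC.
    rewrite Normc.normcM Normc.normcV ltr_pdivrMr ?normc_gt0//.
    apply: le_lt_trans (dP _ hd) _; rewrite ltr_pM2r ?normc_gt0//.
    by rewrite ltr_pdivrMr// ltr_pMr// ltr1n.
rewrite -key; split.
  move=> H; split; first by apply/cvg_ex; exists l.
  by apply/cvg_lim.
by move=> [H <-].
Qed.

End cdiff.

Section ComplexContinuity.
Context {R : realType} {T : topologicalType}.
Local Notation C := R[i].
Implicit Types f g : T -> C.

Lemma continuousC_cst (a : C) : continuous (fun _ : T => a).
Proof. by move=> x; exact: (@cvg_cst C a). Qed.

Lemma continuousC_D f g : continuous f -> continuous g ->
  continuous (fun x => f x + g x).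
Proof. by move=> cf cg x; exact: (cvgD (cf x) (cg x)). Qed.

Lemma continuousC_B f g : continuous f -> continuous g ->
  continuous (fun x => f x - g x).
Proof. by move=> cf cg x; exact: (cvgB (cf x) (cg x)). Qed.

Lemma continuousC_M f g : continuous f -> continuous g ->
  continuous (fun x => f x * g x).
Proof. by move=> cf cg x; exact: (cvgM (cf x) (cg x)). Qed.

Lemma continuousC_V f : continuous f -> (forall x, f x != 0) ->
  continuous (fun x => (f x)^-1).
Proof. by move=> cf f0 x; exact: (cvgV (f0 x) (cf x)). Qed.

End ComplexContinuity.
Lemma continuousC_affine {R : realType} (a b : R[i]) : continuous (fun z : R[i] => a + b * z).
Proof.
apply: continuousC_D; first exact: continuousC_cst.
apply: continuousC_M; first exact: continuousC_cst.
by move=> z; exact: cvg_id.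
Qed.

(** * Integrals over segments, real and complex *)

Section ContinuousIntegral.
Context {R : realType}.
Local Notation mu := (@lebesgue_measure R).

Lemma continuous_segment_integrable (g : R -> R) a b : continuous g ->
  mu.-integrable `[a, b] (EFin \o g).
Proof.
move=> cg; apply: continuous_compact_integrable; first exact: segment_compact.
exact/continuous_subspaceT.
Qed.

Lemma Rintegral_split (g : R -> R) a m b : continuous g -> a <= m -> m <= b ->
  \int[mu]_(x in `[a, b]) g x =
  \int[mu]_(x in `[a, m]) g x + \int[mu]_(x in `[m, b]) g x.
Proof.
move=> cg am mb; apply/eqP; rewrite addrC -subr_eq; apply/eqP.
rewrite (Rintegral_itvB (continuous_segment_integrable _ _ cg))//.
apply: Rintegral_itv_obnd_cbnd; apply: integrableS (continuous_segment_integrable m b cg) => //.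
exact: subset_itv_oc_cc.
Qed.

Lemma Rintegral_norm_le (g : R -> R) a b K : continuous g -> a <= b ->
  (forall x, x \in `[a, b] -> `|g x| <= K) ->
  `|\int[mu]_(x in `[a, b]) g x| <= K * (b - a).
Proof.
move=> cg ab gK; apply: le_trans (le_normr_Rintegral _ _) _ => //.
  exact: continuous_segment_integrable.
have cn : continuous (fun x => `|g x|).
  by move=> x; apply: cvg_norm; exact: cg.
have -> : K * (b - a) = \int[mu]_(x in `[a, b]) K.
  rewrite Rintegral_cst//= lebesgue_measure_itv/= lte_fin.
  by have [//|ba] := ltP a b; rewrite (@le_anti _ _ a b) ?ab// subrr.
apply: le_Rintegral => //.
- exact: continuous_segment_integrable.
- by apply: continuous_segment_integrable => x; exact: cvg_cst.
Qed.

Lemma Rintegral_affine (al be : R) a b : a <= b ->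
  \int[mu]_(x in `[a, b]) (al + be * x) = (b - a) * (al + be * (a + b) / 2).
Proof.
rewrite le_eqVlt => /predU1P[->|ab].
  by rewrite set_itv1 Rintegral_set1 subrr mul0r.
pose F (x : R) := al * x + be * x ^+ 2 / 2.
have dF (x : R) : is_derive x 1 F (al + be * x).
  rewrite /F; apply: is_derive_eq; rewrite /GRing.scale/=.
  by field.
rewrite /Rintegral (@continuous_FTC2 _ _ F)//=.
- by rewrite /F; field.
- apply: continuous_subspaceT => x; apply: cvgD; first exact: cvg_cst.
  by apply: cvgM; [exact: cvg_cst|exact: cvg_id].
- have cF (x : R) : F z @[z --> x] --> F x.
    by apply: differentiable_continuous; apply/derivable1_diffP; exact: ex_derive.
  split => [x _| |]; first exact: ex_derive.
  + exact: cvg_at_right_filter.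
  + exact: cvg_at_left_filter.
- by move=> x _; rewrite derive1E; exact: derive_val.
Qed.

End ContinuousIntegral.

Section ComplexIntegral.
Context {R : realType}.
Local Notation C := R[i].
Local Notation N := (@Normc.normc R).
Local Notation mu := (@lebesgue_measure R).
Implicit Types (g h : R -> C).

Definition cint (a b : R) (g : R -> C) : C :=
  (\int[mu]_(x in `[a, b]) complex.Re (g x)) +i*
  (\int[mu]_(x in `[a, b]) complex.Im (g x)).

Lemma continuous_Re g : continuous g -> continuous (fun x => complex.Re (g x)).
Proof.
move=> cg x; apply/cvgrPdist_lt => e e0.
have /cvgCP/(_ _ e0) := cg x; apply: filterS => y.
by apply: le_lt_trans; rewrite distrC -raddfB; exact: ler_Re_normc.
Qed.

Lemma continuous_Im g : continuous g -> continuous (fun x => complex.Im (g x)).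
Proof.
move=> cg x; apply/cvgrPdist_lt => e e0.
have /cvgCP/(_ _ e0) := cg x; apply: filterS => y.
by apply: le_lt_trans; rewrite distrC -raddfB; exact: ler_Im_normc.
Qed.

Lemma continuous_complex (u v : R -> R) : continuous u -> continuous v ->
  continuous (fun x => u x +i* v x : C).
Proof.
move=> cu cv x; apply/cvgCP => e e0.
have /cvgrPdist_lt/(_ _ (divr_gt0 e0 (ltr0Sn _ 1))) := cu x.
have /cvgrPdist_lt/(_ _ (divr_gt0 e0 (ltr0Sn _ 1))) := cv x.
apply: filterS2 => y H1 H2; rewrite (le_lt_trans (ler_normc_ReIm _))//=.
by rewrite (distrC (u y)) (distrC (v y)) (splitr e) ltrD.
Qed.

Lemma cintD a b g h : continuous g -> continuous h ->
  cint a b (fun x => g x + h x) = cint a b g + cint a b h.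
Proof.
move=> cg ch; rewrite /cint.
under eq_Rintegral do rewrite raddfD/=.
rewrite RintegralD//; try exact/continuous_segment_integrable/continuous_Re.
under [X in _ +i* X]eq_Rintegral do rewrite raddfD/=.
by rewrite RintegralD//; exact/continuous_segment_integrable/continuous_Im.
Qed.

Lemma cintZ a b (c : C) g : continuous g ->
  cint a b (fun x => c * g x) = c * cint a b g.
Proof.
move=> cg; rewrite /cint; case: c => c d.
have iRe := continuous_segment_integrable _ _ (continuous_Re cg).
have iIm := continuous_segment_integrable _ _ (continuous_Im cg).
have cZ (r : R) (f : R -> R) : continuous f -> continuous (fun x => r * f x).
  by move=> cf x; apply: cvgM; [exact: cvg_cst|exact: cf].
have -> : \int[mu]_(x in `[a, b]) complex.Re ((c +i* d) * g x) =
   \int[mu]_(x in `[a, b]) (c * complex.Re (g x) - d * complex.Im (g x)).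
  by apply: eq_Rintegral => x _; case: (g x).
have -> : \int[mu]_(x in `[a, b]) complex.Im ((c +i* d) * g x) =
   \int[mu]_(x in `[a, b]) (c * complex.Im (g x) + d * complex.Re (g x)).
  by apply: eq_Rintegral => x _; case: (g x).
rewrite RintegralB//; [|exact/continuous_segment_integrable/cZ/continuous_Re
  |exact/continuous_segment_integrable/cZ/continuous_Im].
rewrite RintegralD//; [|exact/continuous_segment_integrable/cZ/continuous_Im
  |exact/continuous_segment_integrable/cZ/continuous_Re].
by rewrite !RintegralZl//; simpc.
Qed.

Lemma cintB a b g h : continuous g -> continuous h ->
  cint a b (fun x => g x - h x) = cint a b g - cint a b h.
Proof.
move=> cg ch.
have ch' : continuous (fun x => -1 * h x).
  by move=> x; apply: cvgM; [exact: cvg_cst|exact: ch].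
transitivity (cint a b (fun x => g x + -1 * h x)).
  by congr cint; apply/funext => x; rewrite mulN1r.
by rewrite cintD// cintZ// mulN1r.
Qed.

Lemma cint_split a m b g : continuous g -> a <= m -> m <= b ->
  cint a b g = cint a m g + cint m b g.
Proof.
move=> cg am mb; rewrite /cint.
rewrite (Rintegral_split (continuous_Re cg) am mb).
by rewrite (Rintegral_split (continuous_Im cg) am mb); simpc.
Qed.

(** The factor 2 comes from bounding real and imaginary parts separately. *)
Lemma cint_norm_le a b g K : continuous g -> a <= b ->
  (forall x, x \in `[a, b] -> N (g x) <= K) ->
  N (cint a b g) <= 2 * K * (b - a).
Proof.
move=> cg ab gK; rewrite (le_trans (ler_normc_ReIm _))//=.
rewrite -mulrA mulr_natl mulr2n lerD//; apply: Rintegral_norm_le => //.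
- exact: continuous_Re.
- by move=> x /gK; apply: le_trans; exact: ler_Re_normc.
- exact: continuous_Im.
- by move=> x /gK; apply: le_trans; exact: ler_Im_normc.
Qed.

Lemma cint_affine a b (al be : C) : a <= b ->
  cint a b (fun x => al + be * x%:C) = (b - a)%:C * (al + be * ((a + b) / 2)%:C).
Proof.
move=> ab; rewrite /cint; case: al => a1 a2; case: be => b1 b2.
have -> : \int[mu]_(x in `[a, b]) complex.Re ((a1 +i* a2) + (b1 +i* b2) * x%:C) =
   \int[mu]_(x in `[a, b]) (a1 + b1 * x).
  by apply: eq_Rintegral => x _ /=; rewrite mulr0 subr0.
have -> : \int[mu]_(x in `[a, b]) complex.Im ((a1 +i* a2) + (b1 +i* b2) * x%:C) =
   \int[mu]_(x in `[a, b]) (a2 + b2 * x).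
  by apply: eq_Rintegral => x _ /=; rewrite mulr0 add0r.
by rewrite !Rintegral_affine//; simpc; congr (_ +i* _); ring.
Qed.

End ComplexIntegral.

(** * Goursat's lemma by bisection *)

Section Bisection.
Context {R : realType}.

(** Compactness through nested rectangles: a failing rectangle has a failing quarter, and the point
    common to the resulting sequence contradicts the local hypothesis once the sides, halved at each
    step, are below [e]. *)
Lemma bisection_rectangle (P : R -> R -> R -> R -> Prop) (a b c d : R) :
  a <= b -> c <= d ->
  (forall a b c d, let m := (a + b) / 2 in let n := (c + d) / 2 in
     P a m c n -> P m b c n -> P a m n d -> P m b n d -> P a b c d) ->
  (forall x y, a <= x <= b -> c <= y <= d ->
     exists2 e, 0 < e & forall a' b' c' d',
       a' <= x <= b' -> c' <= y <= d' -> b' - a' < e -> d' - c' < e ->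
       P a' b' c' d') ->
  P a b c d.
Proof.
move=> ab cd Psplit Ploc; apply: contrapT => nP.
pose Q (q : R * R * R * R) := let: (a, b, c, d) := q in ~ P a b c d.
pose quarter (q q' : R * R * R * R) :=
  let: (a, b, c, d) := q in let: (a', b', c', d') := q' in
  [/\ (a' = a /\ b' = (a + b) / 2) \/ (a' = (a + b) / 2 /\ b' = b) &
      (c' = c /\ d' = (c + d) / 2) \/ (c' = (c + d) / 2 /\ d' = d)].
have [T TP] : {T : R * R * R * R -> R * R * R * R &
    forall q, Q q -> quarter q (T q) /\ Q (T q)}.
  apply: (choice (P := fun q q' => Q q -> quarter q q' /\ Q q')) => -[[[u v] w] x].
  apply: contrapT => /forallNP H.
  have {}H q' : Q (u, v, w, x) /\ (quarter (u, v, w, x) q' -> ~ Q q').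
    have := H q'; move=> /not_implyP[Qq nq]; split=> // qq Qq'; exact: nq.
  have [Qq _] := H (u, v, w, x); apply: Qq; apply: Psplit; apply: contrapT.
  - by apply: (H (_, _, _, _)).2; split; left.
  - by apply: (H (_, _, _, _)).2; split; [right|left].
  - by apply: (H (_, _, _, _)).2; split; [left|right].
  - by apply: (H (_, _, _, _)).2; split; right.
pose q n := iter n T (a, b, c, d).
have Qq n : Q (q n) by elim: n => [//|n IH]; exact: (TP _ IH).2.
pose A n := (q n).1.1.1; pose B n := (q n).1.1.2.
pose C n := (q n).1.2; pose D n := (q n).2.
(* The escape clauses [B n < A n] and [D n < C n] are provisional: the length identities yield the
   ordering through [lenB] and [lenD], which then rules them out. *)
have step n : [/\ A n <= A n.+1 \/ B n < A n, B n.+1 <= B n \/ B n < A n,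
   B n.+1 - A n.+1 = (B n - A n) / 2 &
   [/\ C n <= C n.+1 \/ D n < C n, D n.+1 <= D n \/ D n < C n &
   D n.+1 - C n.+1 = (D n - C n) / 2]].
  have [+ _] := TP _ (Qq n); rewrite /A /B /C /D.
  have -> : q n.+1 = T (q n) by [].
  case: (q n) => -[[u v] w] x; case: (T _) => -[[u' v'] w'] x' /= [H1 H2].
  have halfP (p p' r r' : R) : (p' = p /\ r' = (p + r) / 2) \/ (p' = (p + r) / 2 /\ r' = r) ->
      [/\ p <= p' \/ r < p, r' <= r \/ r < p & r' - p' = (r - p) / 2].
    have [pr|rp] := leP p r => -[] [-> ->]; split; by [right|left; lra|lra].
  by have [? ? ?] := halfP _ _ _ _ H1; have [? ? ?] := halfP _ _ _ _ H2.
have lenB n : B n - A n = (b - a) / 2 ^+ n.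
  elim: n => [|n IH]; first by rewrite expr0 divr1.
  by have [_ _ -> _] := step n; rewrite IH exprS; field.
have lenD n : D n - C n = (d - c) / 2 ^+ n.
  elim: n => [|n IH]; first by rewrite expr0 divr1.
  by have [_ _ _ [_ _ ->]] := step n; rewrite IH exprS; field.
have AB n : A n <= B n by rewrite -subr_ge0 lenB divr_ge0// ?subr_ge0// exprn_ge0.
have CD n : C n <= D n by rewrite -subr_ge0 lenD divr_ge0// ?subr_ge0// exprn_ge0.
have nested (u v : nat -> R) : (forall n, u n <= v n) ->
    (forall n, u n <= u n.+1) -> (forall n, v n.+1 <= v n) ->
    exists x, forall n, u n <= x <= v n.
  move=> uv u1 v1.
  have um m n : (m <= n)%N -> u m <= u n by move/nondecreasing_seqP: u1; exact.
  have vm m n : (m <= n)%N -> v n <= v m by move/nonincreasing_seqP: v1; exact.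
  have uvmn m n : u m <= v n.
    have [mn|/ltnW nm] := leqP m n; first exact: le_trans (um _ _ mn) (uv _).
    exact: le_trans (uv _) (vm _ _ nm).
  exists (sup (range u)) => n; apply/andP; split.
    by apply: ub_le_sup; [exists (v 0%N) => _ [m _ <-]|exists n].
  by apply: ge_sup; [exists (u 0%N), 0%N|move=> _ [m _ <-]].
have [x xP] : exists x, forall n, A n <= x <= B n.
  apply: nested => // n; have [H1 H2 _ _] := step n.
    by case: H1 => //; rewrite ltNge AB.
  by case: H2 => //; rewrite ltNge AB.
have [y yP] : exists y, forall n, C n <= y <= D n.
  apply: nested => // n; have [_ _ _ [H1 H2 _]] := step n.
    by case: H1 => //; rewrite ltNge CD.
  by case: H2 => //; rewrite ltNge CD.
have [e e0 eP] := Ploc _ _ (xP 0%N) (yP 0%N).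
have small (l : R) : 0 <= l -> exists n0, forall n, (n0 <= n)%N -> l / 2 ^+ n < e.
  move=> l0; exists (Num.bound (l / e)) => n n0.
  rewrite ltr_pdivrMr ?exprn_gt0// mulrC -ltr_pdivrMr//.
  rewrite (lt_le_trans (archi_boundP _)) ?divr_ge0 ?(ltW e0)//.
  by rewrite -natrX ler_nat (leq_trans n0)// ltnW// ltn_expl.
have [n1 n1P] := small (b - a) (ltac:(by rewrite subr_ge0)).
have [n2 n2P] := small (d - c) (ltac:(by rewrite subr_ge0)).
pose n := maxn n1 n2.
have PABCD : P (A n) (B n) (C n) (D n).
  apply: eP => //; first by rewrite lenB n1P// leq_maxl.
  by rewrite lenD n2P// leq_maxr.
have := Qq n; rewrite /Q; move: PABCD; rewrite /A /B /C /D.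
by case: (q n) => -[[? ?] ?] ?.
Qed.

End Bisection.

Section Goursat.
Context {R : realType}.
Local Notation C := R[i].
Local Notation N := (@Normc.normc R).
Implicit Types (f g : C -> C).

(** The contour integral along the boundary, counterclockwise; ['i%C] is the velocity along the
    vertical edges. *)
Definition rect_int f (a b c d : R) : C :=
  cint a b (fun x => f (x +i* c)) - cint a b (fun x => f (x +i* d)) +
  'i%C * (cint c d (fun y => f (b +i* y)) - cint c d (fun y => f (a +i* y))).

Lemma continuous_hline f c : continuous f -> continuous (fun x : R => f (x +i* c)).
Proof.
move=> cf x; apply: (@continuous_comp _ _ _ (fun x : R => x +i* c) f); last exact: cf.
by apply: (@continuous_complex _ id (cst c)) => y; [exact: cvg_id|exact: cvg_cst].
Qed.

Lemma continuous_vline f c : continuous f -> continuous (fun y : R => f (c +i* y)).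
Proof.
move=> cf x; apply: (@continuous_comp _ _ _ (fun x : R => c +i* x) f); last exact: cf.
by apply: (@continuous_complex _ (cst c) id) => y; [exact: cvg_cst|exact: cvg_id].
Qed.

Lemma rect_int_splitx f a m b c d : continuous f -> a <= m -> m <= b ->
  rect_int f a b c d = rect_int f a m c d + rect_int f m b c d.
Proof.
move=> cf am mb; rewrite /rect_int.
rewrite (cint_split (continuous_hline cf) am mb).
rewrite (cint_split (continuous_hline cf) am mb).
ring.
Qed.

Lemma rect_int_splity f a b c m d : continuous f -> c <= m -> m <= d ->
  rect_int f a b c d = rect_int f a b c m + rect_int f a b m d.
Proof.
move=> cf am mb; rewrite /rect_int.
rewrite (cint_split (continuous_vline cf) am mb).
rewrite (cint_split (continuous_vline cf) am mb).
ring.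
Qed.

Lemma rect_int_norm_le f a b c d K : continuous f -> a <= b -> c <= d ->
  (forall x y, a <= x <= b -> c <= y <= d -> N (f (x +i* y)) <= K) ->
  N (rect_int f a b c d) <= 4 * K * ((b - a) + (d - c)).
Proof.
move=> cf ab cd fK.
have hb t : c <= t <= d -> N (cint a b (fun x => f (x +i* t))) <= 2 * K * (b - a).
  move=> td; apply: cint_norm_le => //; first exact: continuous_hline.
  by move=> x; rewrite in_itv/= => xab; exact: fK.
have vb t : a <= t <= b -> N (cint c d (fun y => f (t +i* y))) <= 2 * K * (d - c).
  move=> td; apply: cint_norm_le => //; first exact: continuous_vline.
  by move=> x; rewrite in_itv/= => xab; exact: fK.
rewrite /rect_int (le_trans (ler_normcD _ _))// Normc.normcM.
have -> : N ('i%C : C) = 1 by rewrite /= expr0n expr1n add0r sqrtr1.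
rewrite mul1r.
have BD (u v : C) : N (u - v) <= N u + N v.
  by rewrite (le_trans (ler_normcD _ _))// [N (- v)](@normcN R).
rewrite (le_trans (lerD (BD _ _) (BD _ _)))//.
have := hb c; have := hb d; have := vb a; have := vb b; rewrite !lexx ab cd.
do 4 move=> /(_ isT) ?; lra.
Qed.

Lemma rect_intD f g a b c d : continuous f -> continuous g ->
  rect_int (fun z => f z + g z) a b c d = rect_int f a b c d + rect_int g a b c d.
Proof.
move=> cf cg; rewrite /rect_int.
do 2 (rewrite cintD; [|exact: continuous_hline..]).
do 2 (rewrite cintD; [|exact: continuous_vline..]).
ring.
Qed.

(** On each edge the integral is the length times the value at the midpoint; the four contributions
    cancel by [i2]. *)
Lemma rect_int_affine (al be : C) a b c d : a <= b -> c <= d ->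
  rect_int (fun z => al + be * z) a b c d = 0.
Proof.
move=> ab cd; rewrite /rect_int.
have h t : cint a b (fun x => al + be * (x +i* t)) =
   (b - a)%:C * ((al + be * ('i%C * t%:C)) + be * ((a + b) / 2)%:C).
  rewrite -cint_affine//; congr cint; apply/funext => x.
  by rewrite (complexE (x +i* t))/=; ring.
have v t : cint c d (fun y => al + be * (t +i* y)) =
   (d - c)%:C * ((al + be * t%:C) + (be * 'i%C) * ((c + d) / 2)%:C).
  rewrite -cint_affine//; congr cint; apply/funext => x.
  by rewrite (complexE (t +i* x))/=; ring.
rewrite !h !v !(rmorphB, rmorphD, rmorphM, fmorphV, rmorph_nat)/=.
have i2 : 'i%C * 'i%C = -1 :> C by rewrite -expr2 sqr_i.
ring: i2.
Qed.

(** Subtracting an affine function leaves the contour integral unchanged, so only the deviation from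
    a tangent matters. *)
Lemma rect_int_remainder_le f (al be : C) a b c d K :
  continuous f -> a <= b -> c <= d ->
  (forall x y, a <= x <= b -> c <= y <= d ->
    N (f (x +i* y) - (al + be * (x +i* y))) <= K) ->
  N (rect_int f a b c d) <= 4 * K * ((b - a) + (d - c)).
Proof.
move=> cf ab cd fK.
have caff : continuous (fun z : C => al + be * z) := @continuousC_affine _ al be.
pose r z := f z - (al + be * z).
have cr : continuous r := continuousC_B cf caff.
have fr : f = fun z => (al + be * z) + r z.
  by apply/funext => z; rewrite /r addrC subrK.
have -> : rect_int f a b c d = rect_int r a b c d.
  rewrite [in LHS]fr; apply: etrans (rect_intD a b c d caff cr) _.
  by rewrite (rect_int_affine _ _ ab cd) add0r.
exact: (rect_int_norm_le cr ab cd fK).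
Qed.

(** The bound by [e] times the squared half-perimeter is compatible with quartering: each quarter
    has half the half-perimeter, hence a fourth of the bound. It remains to check it on small
    rectangles, where differentiability supplies one factor of the square and the length of the
    contour the other. *)
Lemma goursat f a b c d : continuous f -> a <= b -> c <= d ->
  (forall x y, a <= x <= b -> c <= y <= d -> exists l, cdiff f (x +i* y) l) ->
  rect_int f a b c d = 0.
Proof.
move=> cf ab cd df.
suff H e : 0 < e -> N (rect_int f a b c d) <= e * (b - a + (d - c)) ^+ 2.
  apply: Normc.eq0_normc; apply/eqP; rewrite eq_le normc_ge0 andbT.
  apply/ler_addgt0Pl => e e0; rewrite addr0.
  have [L0|L0] := eqVneq (b - a + (d - c)) 0.
    by rewrite (le_trans (H _ e0))// L0 expr0n/= mulr0 ltW.
  have L2 : 0 < (b - a + (d - c)) ^+ 2 by rewrite exprn_even_gt0.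
  by rewrite (le_trans (H _ (divr_gt0 e0 L2)))// divfK// gt_eqF.
move=> e0.
suff : a <= b -> c <= d -> N (rect_int f a b c d) <= e * (b - a + (d - c)) ^+ 2 by exact.
apply: (@bisection_rectangle _ (fun a b c d => a <= b -> c <= d ->
  N (rect_int f a b c d) <= e * (b - a + (d - c)) ^+ 2)) => //.
  move=> {ab cd df} {}a {}b {}c {}d m n H1 H2 H3 H4 ab cd.
  have [am mb] := midf_le ab; have [cn nd] := midf_le cd.
  have {H1} := H1 am cn; have {H2} := H2 mb cn; have {H3} := H3 am nd; have {H4} := H4 mb nd.
  have e1 : m - a = (b - a) / 2 by rewrite /m; field.
  have e2 : b - m = (b - a) / 2 by rewrite /m; field.
  have e3 : n - c = (d - c) / 2 by rewrite /n; field.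
  have e4 : d - n = (d - c) / 2 by rewrite /n; field.
  rewrite e1 e2 e3 e4 => H4 H3 H2 H1.
  rewrite (rect_int_splitx _ _ cf am mb).
  rewrite (rect_int_splity _ _ cf cn nd) (rect_int_splity _ _ cf cn nd).
  do ! (apply: (le_trans (ler_normcD _ _))).
  apply: (le_trans (lerD (ler_normcD _ _) (ler_normcD _ _))).
  have -> : e * (b - a + (d - c)) ^+ 2 = 4 * (e * ((b - a) / 2 + (d - c) / 2) ^+ 2).
    by field.
  apply: le_trans (lerD (lerD H1 H3) (lerD H2 H4)) _.
  by rewrite le_eqVlt; apply/orP; left; apply/eqP; ring.
move=> x y xab ycd; have [l lP] := df x y xab ycd.
(* This 4 is the constant of [rect_int_remainder_le]. *)
have e4 : 0 < e / 4 by rewrite divr_gt0.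
have [dl dl0 dlP] := lP _ e4.
(* Sides below [dl / 2] keep the rectangle within distance [dl] of [p], the norm being at most the
   sum of the absolute values of the two parts. *)
exists (dl / 2) => [|a' b' c' d' xab' ycd' ba' dc' ab' cd']; first by rewrite divr_gt0.
set p : C := x +i* y in lP dlP.
have -> : e * (b' - a' + (d' - c')) ^+ 2 =
    4 * (e / 4 * ((b' - a') + (d' - c'))) * ((b' - a') + (d' - c')) by field.
apply: (@rect_int_remainder_le f (f p - l * p) l) => // u v uab vcd.
  have := dlP (u +i* v - p).
  rewrite (addrC p) subrK => H.
  have -> : f (u +i* v) - (f p - l * p + l * (u +i* v)) =
    f (u +i* v) - f p - l * (u +i* v - p) by ring.
  have NL : N (u +i* v - p) <= b' - a' + (d' - c').
    move: uab vcd xab' ycd' => /andP[u1 u2] /andP[v1 v2] /andP[x1 x2] /andP[y1 y2].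
    by rewrite (le_trans (ler_normc_ReIm _))//= lerD// ler_norml lerBrDr
      lerBlDr; apply/andP; split; move: u1 u2 v1 v2 x1 x2 y1 y2; clear; lra.
  apply: (le_trans (H _)); last by rewrite ler_pM2l.
  by apply: (le_lt_trans NL); rewrite (splitr dl) ltrD.
Qed.

(** Goursat's lemma kills the four rectangles around a square of half-side [r] centred at the
    exceptional point; [f] is bounded near that point, so the square contributes at most
    [16 * K * r]. *)
Lemma goursat_punctured f a b c d x0 y0 : continuous f ->
  a < x0 < b -> c < y0 < d ->
  (forall x y, a <= x <= b -> c <= y <= d -> (x, y) != (x0, y0) ->
    exists l, cdiff f (x +i* y) l) ->
  rect_int f a b c d = 0.
Proof.
move=> cf /andP[ax xb] /andP[cy yd] df.
pose K := N (f (x0 +i* y0)) + 1.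
have K0 : 0 < K by rewrite ltr_wpDl ?normc_ge0.
have [dl dl0 dlP] : exists2 dl : R, 0 < dl &
    forall z, N (z - (x0 +i* y0)) < dl -> N (f z) <= K.
  have /cvgCP/(_ _ ltr01)/nbhsCP[dl dl0 H] := cf (x0 +i* y0).
  exists dl => // z /H fz; rewrite -[f z](subrK (f (x0 +i* y0))).
  by rewrite (le_trans (ler_normcD _ _))// /K addrC lerD2l ltW.
(* The entry [dl / 4] keeps the square inside the disc where [K] bounds [f]: its points are within
   [2 * r < dl] of the centre. *)
pose r0 := Num.min (Num.min (x0 - a) (b - x0)) (Num.min (Num.min (y0 - c) (d - y0)) (dl / 4)).
have r00 : 0 < r0 by rewrite !lt_min !subr_gt0 ax xb cy yd divr_gt0.
suff H r : 0 < r -> r < r0 -> N (rect_int f a b c d) <= 16 * K * r.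
  apply: Normc.eq0_normc; apply/eqP; rewrite eq_le normc_ge0 andbT.
  apply/ler_addgt0Pl => e e0; rewrite addr0.
  pose r := Num.min (r0 / 2) (e / (16 * K)).
  have K16 : 0 < 16 * K by rewrite mulr_gt0.
  have rp : 0 < r by rewrite lt_min !divr_gt0.
  have rr0 : r < r0 by rewrite /r gt_min ltr_pdivrMr// ltr_pMr// ltr1n.
  rewrite (le_trans (H _ rp rr0))// mulrC -ler_pdivlMr//.
  by rewrite /r ge_min lexx orbT.
rewrite !lt_min => rp /andP[/andP[r1 r2] /andP[/andP[r3 r4] r5]].
have {}r1 : a <= x0 - r by rewrite lerBrDr -lerBrDl ltW.
have {}r2 : x0 + r <= b by rewrite -lerBrDl ltW.
have {}r3 : c <= y0 - r by rewrite lerBrDr -lerBrDl ltW.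
have {}r4 : y0 + r <= d by rewrite -lerBrDl ltW.
have x1 : x0 - r < x0 by rewrite gtrBl.
have x2 : x0 < x0 + r by rewrite ltrDl.
have y1 : y0 - r < y0 by rewrite gtrBl.
have y2 : y0 < y0 + r by rewrite ltrDl.
have x12 := ltW (lt_trans x1 x2); have y12 := ltW (lt_trans y1 y2).
have ad : a <= x0 + r := le_trans r1 x12.
have cd : c <= y0 + r := le_trans r3 y12.
have z1 : rect_int f a (x0 - r) c d = 0.
  apply: goursat => //; first exact: le_trans cd r4.
  move=> x y /andP[xa xb'] yc; apply: df => //.
    by rewrite xa (le_trans xb' (le_trans x12 r2)).
  by apply/eqP => -[xx0 _]; move: (le_lt_trans xb' x1); rewrite xx0 ltxx.
have z2 : rect_int f (x0 + r) b c d = 0.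
  apply: goursat => //; first exact: le_trans cd r4.
  move=> x y /andP[xa xb'] yc; apply: df => //.
    by rewrite (le_trans ad xa).
  by apply/eqP => -[xx0 _]; move: (lt_le_trans x2 xa); rewrite xx0 ltxx.
have xm x : x0 - r <= x <= x0 + r -> a <= x <= b.
  by move=> /andP[xa xb']; rewrite (le_trans r1 xa) (le_trans xb' r2).
have z3 : rect_int f (x0 - r) (x0 + r) c (y0 - r) = 0.
  apply: goursat => // x y /xm xab /andP[ya yb]; apply: df => //.
    by rewrite ya (le_trans yb (le_trans y12 r4)).
  by apply/eqP => -[_ yy0]; move: (le_lt_trans yb y1); rewrite yy0 ltxx.
have z4 : rect_int f (x0 - r) (x0 + r) (y0 + r) d = 0.
  apply: goursat => // x y /xm xab /andP[ya yb]; apply: df => //.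
    by rewrite yb (le_trans cd ya).
  by apply/eqP => -[_ yy0]; move: (lt_le_trans y2 ya); rewrite yy0 ltxx.
rewrite (rect_int_splitx c d cf r1 (le_trans x12 r2)) (rect_int_splitx c d cf x12 r2).
rewrite (rect_int_splity (x0 - r) (x0 + r) cf r3 (le_trans y12 r4)).
rewrite (rect_int_splity (x0 - r) (x0 + r) cf y12 r4).
rewrite z1 z2 z3 z4 !add0r !addr0.
have -> : 16 * K * r = 4 * K * (x0 + r - (x0 - r) + (y0 + r - (y0 - r))) by ring.
apply: rect_int_norm_le => // x y xr yr; apply: dlP.
rewrite (le_lt_trans (ler_normc_ReIm _))//=.
have h1 : `|x - x0| <= r by rewrite distrC ler_distlC.
have h2 : `|y - y0| <= r by rewrite distrC ler_distlC.
move: h1 h2 r5; set u := `|x - x0|; set v := `|y - y0|; clear -rp dl0; lra.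
Qed.

End Goursat.

(** * Cauchy integrals and their derivatives *)

Section CauchyIntegral.
Context {R : realType}.
Local Notation C := R[i].
Local Notation N := (@Normc.normc R).
Implicit Types (f g : C -> C).

Lemma cdiff_near f g (z l : C) (d : R) : 0 < d ->
  (forall w, N (w - z) < d -> f w = g w) -> cdiff g z l -> cdiff f z l.
Proof.
move=> d0 fg gl e e0; have [d' d'0 H] := gl e e0.
exists (Num.min d d'); first by rewrite lt_min d0.
move=> h; rewrite lt_min => /andP[hd hd'].
rewrite !fg; first exact: H.
  by rewrite subrr Normc.normc0.
by rewrite addrC addKr.
Qed.

Lemma cdiffD f g (z l m : C) : cdiff f z l -> cdiff g z m ->
  cdiff (fun w => f w + g w) z (l + m).
Proof. by move=> /cdiffP fl /cdiffP gm; apply/cdiffP; exact: is_deriveD. Qed.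

Lemma cdiffM f g (z l m : C) : cdiff f z l -> cdiff g z m ->
  cdiff (fun w => f w * g w) z (f z * m + g z * l).
Proof. by move=> /cdiffP fl /cdiffP gm; apply/cdiffP; exact: is_deriveM. Qed.

Lemma cdiff_cst (c z : C) : cdiff (fun=> c) z 0.
Proof. by apply/cdiffP; exact: is_derive_cst. Qed.

Lemma cdiffZ f (c z l : C) : cdiff f z l -> cdiff (fun w => c * f w) z (c * l).
Proof.
by move=> fl; have := cdiffM (cdiff_cst c z) fl; rewrite mulr0 addr0.
Qed.

Lemma cdiffB f g (z l m : C) : cdiff f z l -> cdiff g z m ->
  cdiff (fun w => f w - g w) z (l - m).
Proof. by move=> /cdiffP fl /cdiffP gm; apply/cdiffP; exact: is_deriveB. Qed.

Lemma cdiff_id (z : C) : cdiff id z 1.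
Proof. by apply/cdiffP; exact: is_derive_id. Qed.

Lemma cdiffV f (z l : C) : f z != 0 -> cdiff f z l ->
  cdiff (fun w => (f w)^-1) z (- (f z)^-1 ^+ 2 * l).
Proof.
move=> fz /cdiffP fl; apply/cdiffP.
apply: DeriveDef; first by apply: derivableV => //; exact: ex_derive.
by rewrite deriveV ?derive_val ?exprVn//; exact: ex_derive.
Qed.

Lemma cdiff_continuous f (z l : C) : cdiff f z l -> {for z, continuous f}.
Proof.
move=> /cdiffP fl; apply: differentiable_continuous; apply/derivable1_diffP.
exact: ex_derive.
Qed.

Lemma continuous_normc_bound (c : R -> C) a b : continuous c -> a <= b ->
  exists2 K, 0 < K & forall t, t \in `[a, b] -> N (c t) <= K.
Proof.
move=> cc ab.
have cn (u : R -> R) : continuous u -> {within `[a, b], continuous (fun x => `|u x|)}.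
  by move=> cu; apply: continuous_subspaceT => x; apply: cvg_norm; exact: cu.
have [p _ pP] := EVT_max ab (cn _ (continuous_Re cc)).
have [q _ qP] := EVT_max ab (cn _ (continuous_Im cc)).
exists (`|complex.Re (c p)| + `|complex.Im (c q)| + 1).
  by rewrite ltr_wpDl// addr_ge0.
move=> t tab; rewrite (le_trans (ler_normc_ReIm _))// ler_wpDr// lerD//.
  exact: pP.
exact: qP.
Qed.

(** An error of second order in [h], uniform in [t], integrates to an error of second order. In [L],
    the 2 is that of [cint_norm_le] and the [+ 1] ensures positivity. *)
Lemma cdiff_cint a b (F : C -> R -> C) (F' : R -> C) (z : C) (d B : R) :
  a <= b -> 0 < d -> 0 <= B ->
  (forall h, N h < d -> continuous (F (z + h))) -> continuous F' ->
  (forall h t, N h < d -> t \in `[a, b] ->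
    N (F (z + h) t - F z t - h * F' t) <= B * N h ^+ 2) ->
  cdiff (fun z => cint a b (F z)) z (cint a b F').
Proof.
move=> ab d0 B0 cF cF' H e e0.
pose L := 2 * B * (b - a) + 1.
have L0 : 0 < L by rewrite ltr_wpDl// !mulr_ge0// subr_ge0.
exists (Num.min d (e / L)); first by rewrite lt_min d0 divr_gt0.
move=> h; rewrite lt_min => /andP[hd he].
have n0 : N 0 < d by rewrite Normc.normc0.
have cz : continuous (F z) by rewrite -[z]addr0; refine (cF 0 n0).
have chF : continuous (fun t => h * F' t) := continuousC_M (@continuousC_cst _ _ h) cF'.
have cB : continuous (fun t => F (z + h) t - F z t) := continuousC_B (cF h hd) cz.
have -> : cint a b (F (z + h)) - cint a b (F z) - cint a b F' * h =
  cint a b (fun t => F (z + h) t - F z t - h * F' t).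
  by rewrite (cintB a b cB chF) (cintB a b (cF h hd) cz) (cintZ a b h cF') [h * _]mulrC.
apply: le_trans (@cint_norm_le _ _ _ _ (B * N h ^+ 2) (continuousC_B cB chF) ab _) _.
  by move=> t tab; exact: H.
have -> : 2 * (B * N h ^+ 2) * (b - a) = (2 * B * (b - a)) * N h * N h by ring.
rewrite ler_wpM2r ?normc_ge0//.
apply: (@le_trans _ _ (L * N h)); first by rewrite ler_wpM2r ?normc_ge0// ler_wpDr.
by rewrite mulrC -ler_pdivlMr// ltW.
Qed.

Section Kernel.
Context (c gam : R -> C) (a b : R) (z : C) (d : R).
Context (cc : continuous c) (cg : continuous gam) (ab : a <= b) (d0 : 0 < d).
Context (gamz : forall t, d <= N (gam t - z)).

Let kern (k : nat) (w : C) (t : R) := c t * (gam t - w)^-1 ^+ k.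

Let Nh2 h t : N h < d / 2 -> d / 2 <= N (gam t - (z + h)).
Proof.
move=> hd; have := ler_normcD (gam t - (z + h)) h.
have -> : gam t - (z + h) + h = gam t - z by ring.
move=> /(le_trans (gamz t)); rewrite -lerBlDr; apply: le_trans.
by rewrite lerBrDr {2}(splitr d) lerD2l ltW.
Qed.

Let gam_neq0 h t : N h < d / 2 -> gam t - (z + h) != 0.
Proof.
move=> /Nh2 => /(_ t); apply: contraTneq => ->.
by rewrite Normc.normc0 -ltNge divr_gt0.
Qed.

Let hz h : N h < d / 2 -> N (0 : C) < d / 2.
Proof. by move=> _; rewrite Normc.normc0 divr_gt0. Qed.

Let continuous_kern k h : N h < d / 2 -> continuous (kern k (z + h)).
Proof.
move=> hd.
have ci : continuous (fun t => (gam t - (z + h))^-1).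
  apply: continuousC_V => [|t]; last exact: gam_neq0.
  exact: (continuousC_B cg (@continuousC_cst _ _ _)).
have cX : continuous (fun t => (gam t - (z + h))^-1 ^+ k).
  elim: k => [|k IH]; first exact: (@continuousC_cst _ _ 1).
  have -> : (fun t => (gam t - (z + h))^-1 ^+ k.+1) =
     (fun t => (gam t - (z + h))^-1 * (gam t - (z + h))^-1 ^+ k).
    by apply/funext => t; rewrite exprS.
  exact: (continuousC_M ci IH).
exact: (continuousC_M cc cX).
Qed.

(** The resolvent identity; the bounds hold because a shift by less than [d / 2] leaves a distance
    of at least [d / 2] to the curve. *)
Let invs h t : N h < d / 2 ->
  exists p q : C, [/\ p = (gam t - (z + h))^-1, q = (gam t - z)^-1,
     p - q = h * p * q, N p <= 2 / d & N q <= 2 / d].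
Proof.
move=> hd; exists (gam t - (z + h))^-1, (gam t - z)^-1; split => //.
- have u0 := gam_neq0 t hd.
  have v0 : gam t - z != 0 by have := gam_neq0 t (hz hd); rewrite addr0.
  set u := gam t - (z + h) in u0 *; set v := gam t - z in v0 *.
  have e : h = v - u by rewrite /u /v; ring.
  by rewrite {}e; clearbody u v; field; rewrite u0 v0.
- rewrite Normc.normcV -[2 / d]invf_div lef_pV2 ?posrE ?Nh2// ?divr_gt0//.
  by rewrite normc_gt0// gam_neq0.
- rewrite Normc.normcV -[2 / d]invf_div lef_pV2 ?posrE ?divr_gt0//.
    by rewrite (le_trans _ (gamz t))// ler_pdivrMr// ler_peMr ?(ltW d0)// ler1n.
  by rewrite (lt_le_trans d0).
Qed.

(** Two uses of the resolvent identity turn the error into [c t * (h ^+ 2 * (p * q * q))]. *)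
Lemma cdiff_kernel1 :
  cdiff (fun w => cint a b (fun t => c t * (gam t - w)^-1 ^+ 1)) z
    (cint a b (fun t => c t * (gam t - z)^-1 ^+ 2)).
Proof.
have [K K0 cK] := continuous_normc_bound cc ab.
have d2 : 0 < d / 2 by rewrite divr_gt0.
have n0 : N (0 : C) < d / 2 by rewrite Normc.normc0.
have B0 : 0 <= K * (2 / d) ^+ 3.
  by rewrite mulr_ge0 ?exprn_ge0 ?divr_ge0 ?(ltW K0) ?(ltW d0).
have ck := @continuous_kern 2 0 n0; rewrite addr0 in ck.
refine (@cdiff_cint a b (kern 1) (kern 2 z) z (d / 2) _ ab d2 B0
  (@continuous_kern 1) ck _).
move=> h t hd tab; have [p [q [pE qE pq Np Nq]]] := invs t hd.
rewrite /kern -pE -qE.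
have -> : c t * p ^+ 1 - c t * q ^+ 1 - h * (c t * q ^+ 2) =
   c t * (h ^+ 2 * (p * q * q)).
  have -> : c t * p ^+ 1 - c t * q ^+ 1 - h * (c t * q ^+ 2) =
    c t * (p - q - h * q ^+ 2) by ring.
  rewrite pq; have -> : h * p * q - h * q ^+ 2 = h * q * (p - q) by ring.
  by rewrite pq; ring.
rewrite Normc.normcM -[leRHS]mulrA ler_pM ?normc_ge0//; first exact: cK.
rewrite Normc.normcM mulrC.
have -> : N (h ^+ 2) = N h ^+ 2 by rewrite !expr2 Normc.normcM.
rewrite ler_wpM2r ?sqr_ge0// !Normc.normcM.
have -> : (2 / d) ^+ 3 = (2 / d) * (2 / d) * (2 / d) by ring.
by rewrite !ler_pM ?mulr_ge0 ?normc_ge0.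
Qed.

(** The error is now [c t * (h ^+ 2 * (p * q * q * (p + 2 * q)))]. Together with the first kernel
    this gives Cauchy integrals two derivatives, enough to differentiate [f'] once. *)
Lemma cdiff_kernel2 :
  cdiff (fun w => cint a b (fun t => c t * (gam t - w)^-1 ^+ 2)) z
    (cint a b (fun t => 2 * (c t * (gam t - z)^-1 ^+ 3))).
Proof.
have [K K0 cK] := continuous_normc_bound cc ab.
have d2 : 0 < d / 2 by rewrite divr_gt0.
have n0 : N (0 : C) < d / 2 by rewrite Normc.normc0.
have B0 : 0 <= K * (3 * (2 / d) ^+ 4).
  by rewrite mulr_ge0 ?(ltW K0)// mulr_ge0// exprn_ge0// divr_ge0// ltW.
have ck := @continuous_kern 3 0 n0; rewrite addr0 in ck.
refine (@cdiff_cint a b (kern 2) _ z (d / 2) _ ab d2 B0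
  (@continuous_kern 2) (continuousC_M (@continuousC_cst _ _ 2) ck) _).
move=> h t hd tab; have [p [q [pE qE pq Np Nq]]] := invs t hd.
rewrite /kern -pE -qE.
have -> : c t * p ^+ 2 - c t * q ^+ 2 - h * (2 * (c t * q ^+ 3)) =
   c t * (h ^+ 2 * (p * q * q * (p + 2 * q))).
  have -> : c t * p ^+ 2 - c t * q ^+ 2 - h * (2 * (c t * q ^+ 3)) =
    c t * ((p - q) * (p + q) - 2 * h * q ^+ 3) by ring.
  rewrite pq.
  have -> : h * p * q * (p + q) - 2 * h * q ^+ 3 = h * q * ((p - q) * (p + 2 * q)) by ring.
  by rewrite pq; ring.
rewrite Normc.normcM -[leRHS]mulrA ler_pM ?normc_ge0//; first exact: cK.
rewrite Normc.normcM mulrC.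
have -> : N (h ^+ 2) = N h ^+ 2 by rewrite !expr2 Normc.normcM.
rewrite ler_wpM2r ?sqr_ge0// !Normc.normcM.
have H : N (p + 2 * q) <= 3 * (2 / d).
  rewrite (le_trans (ler_normcD _ _))// Normc.normcM.
  have -> : N 2 = 2 by rewrite -[2]/(2%:R) -(rmorph_nat (real_complex R)) normc_real ger0_norm.
  have -> : 3 * (2 / d) = 2 / d + 2 * (2 / d) by ring.
  by rewrite lerD// ler_pM2l.
have -> : 3 * (2 / d) ^+ 4 = (2 / d) * (2 / d) * (2 / d) * (3 * (2 / d)) by ring.
by rewrite !ler_pM ?mulr_ge0 ?normc_ge0.
Qed.

End Kernel.

End CauchyIntegral.

Section DerivativeHolomorphic.
Context {R : realType}.
Local Notation C := R[i].
Local Notation N := (@Normc.normc R).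
Implicit Types (f g : C -> C).

(** All edges are at distance at least [e] from [z], as seen on the imaginary part for horizontal
    edges and on the real part for vertical ones; the kernel lemmas then apply edge by edge. *)
Lemma cdiff_rect_int_kernel1 f (a b c d : R) (z : C) : continuous f ->
  a < complex.Re z < b -> c < complex.Im z < d ->
  cdiff (fun w => rect_int (fun u => f u * (u - w)^-1 ^+ 1) a b c d) z
    (rect_int (fun u => f u * (u - z)^-1 ^+ 2) a b c d) /\
  exists l, cdiff (fun w => rect_int (fun u => f u * (u - w)^-1 ^+ 2) a b c d) z l.
Proof.
move=> cf /andP[az zb] /andP[cz zd].
have ab : a <= b := ltW (lt_trans az zb); have cd : c <= d := ltW (lt_trans cz zd).
pose e := Num.min (Num.min (complex.Re z - a) (b - complex.Re z))
  (Num.min (complex.Im z - c) (d - complex.Im z)).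
have e0 : 0 < e by rewrite !lt_min !subr_gt0 az zb cz zd.
have [e1 e2 e3 e4] : [/\ e <= complex.Re z - a, e <= b - complex.Re z,
    e <= complex.Im z - c & e <= d - complex.Im z].
  by split; rewrite /e !ge_min lexx ?orbT.
have Hc t : e <= N ((t +i* c) - z).
  apply: le_trans (ler_Im_normc _); rewrite raddfB/= -normrN opprB.
  exact: le_trans e3 (ler_norm _).
have Hd t : e <= N ((t +i* d) - z).
  apply: le_trans (ler_Im_normc _); rewrite raddfB/=.
  exact: le_trans e4 (ler_norm _).
have Va t : e <= N ((a +i* t) - z).
  apply: le_trans (ler_Re_normc _); rewrite raddfB/= -normrN opprB.
  exact: le_trans e1 (ler_norm _).
have Vb t : e <= N ((b +i* t) - z).
  apply: le_trans (ler_Re_normc _); rewrite raddfB/=.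
  exact: le_trans e2 (ler_norm _).
have cid : continuous (id : C -> C) by move=> x; exact: cvg_id.
have hl k := continuous_hline (c := k) cid.
have vl k := continuous_vline (c := k) cid.
have fh k := continuous_hline (c := k) cf.
have fv k := continuous_vline (c := k) cf.
split.
  exact: (cdiffD (cdiffB (cdiff_kernel1 (fh c) (hl c) ab e0 Hc)
                         (cdiff_kernel1 (fh d) (hl d) ab e0 Hd))
    (cdiffZ 'i%C (cdiffB (cdiff_kernel1 (fv b) (vl b) cd e0 Vb)
                         (cdiff_kernel1 (fv a) (vl a) cd e0 Va)))).
eexists.
exact: (cdiffD (cdiffB (cdiff_kernel2 (fh c) (hl c) ab e0 Hc)
                       (cdiff_kernel2 (fh d) (hl d) ab e0 Hd))
  (cdiffZ 'i%C (cdiffB (cdiff_kernel2 (fv b) (vl b) cd e0 Vb)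
                       (cdiff_kernel2 (fv a) (vl a) cd e0 Va)))).
Qed.

Lemma Rintegral_lower (g : R -> R) a b m : continuous g -> a <= b ->
  (forall x, x \in `[a, b] -> m <= g x) ->
  m * (b - a) <= \int[@lebesgue_measure R]_(x in `[a, b]) g x.
Proof.
move=> cg ab gm.
have -> : m * (b - a) = \int[@lebesgue_measure R]_(x in `[a, b]) m.
  rewrite Rintegral_cst//= lebesgue_measure_itv/= lte_fin.
  by have [//|ba] := ltP a b; rewrite (@le_anti _ _ a b) ?ab// subrr.
apply: le_Rintegral => //.
- by apply: continuous_segment_integrable => x; exact: cvg_cst.
- exact: continuous_segment_integrable.
Qed.

Lemma Im_rect_int f (a b c d : R) : complex.Im (rect_int f a b c d) =
  \int[@lebesgue_measure R]_(x in `[a, b]) complex.Im (f (x +i* c)) -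
  \int[@lebesgue_measure R]_(x in `[a, b]) complex.Im (f (x +i* d)) +
  (\int[@lebesgue_measure R]_(y in `[c, d]) complex.Re (f (b +i* y)) -
  \int[@lebesgue_measure R]_(y in `[c, d]) complex.Re (f (a +i* y))).
Proof. by rewrite /rect_int /cint /=; ring. Qed.

(** Replaces the exact value [2 * pi * i]: each edge adds to the imaginary part the integral of the
    positive function [q], which is at least [1 / (2 * r)] on an interval of length [2 * r]. *)
Lemma rect_int_inv_neq0 (z0 : C) (r : R) : 0 < r ->
  rect_int (fun u => 1 * (u - z0)^-1 ^+ 1)
    (complex.Re z0 - r) (complex.Re z0 + r)
    (complex.Im z0 - r) (complex.Im z0 + r) != 0.
Proof.
move=> r0; case: z0 => x0 y0 /=.
pose q (s t : R) := r / ((t - s) ^+ 2 + r ^+ 2).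
have den s t : 0 < (t - s) ^+ 2 + r ^+ 2.
  by rewrite ltr_wpDl ?sqr_ge0// exprn_gt0.
have cq s : continuous (q s).
  move=> t; apply: cvgM; first exact: cvg_cst.
  apply: cvgV; first by rewrite gt_eqF.
  apply: (@differentiable_continuous _ _ _ t (fun t => (t - s) ^+ 2 + r ^+ 2)).
  by apply/derivable1_diffP; exact: ex_derive.
have q1 s : 1 <= \int[@lebesgue_measure R]_(t in `[s - r, s + r]) q s t.
  have -> : 1 = (2 * r)^-1 * ((s + r) - (s - r)) :> R by field; rewrite gt_eqF.
  apply: Rintegral_lower => //; first by rewrite lerD2l ge0_cp// ltW.
  move=> t; rewrite in_itv/= -ler_distlC distrC => tr.
  rewrite /q ler_pdivlMr// mulrC ler_pdivrMr ?mulr_gt0//.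
  have -> : r * (2 * r) = r ^+ 2 + r ^+ 2 by ring.
  by rewrite lerD2r -[leLHS]real_normK ?num_real// lerXn2r// nnegrE ltW.
have NE s : \int[@lebesgue_measure R]_(t in `[s - r, s + r]) (- q s t) =
    - \int[@lebesgue_measure R]_(t in `[s - r, s + r]) q s t.
  rewrite -[RHS]mulN1r -RintegralZl//.
    by apply: eq_Rintegral => t _; rewrite mulN1r.
  exact/continuous_segment_integrable.
have Imh (s t : R) : complex.Im (1 * ((s +i* t) - (x0 +i* y0))^-1 ^+ 1) =
   - (t - y0) / ((s - x0) ^+ 2 + (t - y0) ^+ 2).
  by rewrite mul1r expr1 /= mulNr.
have Reh (s t : R) : complex.Re (1 * ((s +i* t) - (x0 +i* y0))^-1 ^+ 1) =
   (s - x0) / ((s - x0) ^+ 2 + (t - y0) ^+ 2).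
  by rewrite mul1r expr1.
apply/eqP => /(congr1 (@complex.Im R)).
rewrite Im_rect_int [complex.Im 0]/=.
under eq_Rintegral do rewrite Imh.
under [X in _ - X]eq_Rintegral do rewrite Imh.
under [X in _ + (X - _)]eq_Rintegral do rewrite Reh.
under [X in _ + (_ - X)]eq_Rintegral do rewrite Reh.
have -> : \int[@lebesgue_measure R]_(x in `[x0 - r, x0 + r])
    (- (y0 - r - y0) / ((x - x0) ^+ 2 + (y0 - r - y0) ^+ 2)) =
    \int[@lebesgue_measure R]_(x in `[x0 - r, x0 + r]) q x0 x.
  apply: eq_Rintegral => t _; rewrite /q.
  have -> : y0 - r - y0 = - r by ring.
  by rewrite opprK sqrrN.
have -> : \int[@lebesgue_measure R]_(x in `[x0 - r, x0 + r])
    (- (y0 + r - y0) / ((x - x0) ^+ 2 + (y0 + r - y0) ^+ 2)) =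
    \int[@lebesgue_measure R]_(x in `[x0 - r, x0 + r]) (- q x0 x).
  apply: eq_Rintegral => t _; rewrite /q.
  have -> : y0 + r - y0 = r by ring.
  by rewrite mulNr.
have -> : \int[@lebesgue_measure R]_(x in `[y0 - r, y0 + r])
    ((x0 + r - x0) / ((x0 + r - x0) ^+ 2 + (x - y0) ^+ 2)) =
    \int[@lebesgue_measure R]_(x in `[y0 - r, y0 + r]) q y0 x.
  apply: eq_Rintegral => t _; rewrite /q addrC.
  have -> : - x0 + (x0 + r) = r by ring.
  by rewrite addrC.
have -> : \int[@lebesgue_measure R]_(x in `[y0 - r, y0 + r])
    ((x0 - r - x0) / ((x0 - r - x0) ^+ 2 + (x - y0) ^+ 2)) =
    \int[@lebesgue_measure R]_(x in `[y0 - r, y0 + r]) (- q y0 x).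
  apply: eq_Rintegral => t _; rewrite /q.
  have -> : x0 - r - x0 = - r by ring.
  by rewrite mulNr sqrrN addrC.
rewrite !NE !opprK => /eqP; rewrite gt_eqF//.
by rewrite ltr_pwDl// ?addr_gt0// ?addr_ge0// ?(lt_le_trans ltr01 (q1 _))// ltW// (lt_le_trans ltr01 (q1 _)).
Qed.

End DerivativeHolomorphic.

(** * Cauchy's formula and differentiability of the derivative *)

Section CauchyFormula.
Context {R : realType}.
Local Notation C := R[i].
Local Notation N := (@Normc.normc R).
Implicit Types (f g : C -> C).

Lemma continuousC_eps f :
  (forall u e, 0 < e -> exists2 d, 0 < d & forall v, N (v - u) < d -> N (f v - f u) < e) ->
  continuous f.
Proof.
move=> H u.
have K : forall e : R, 0 < e -> \forall v \near nbhs u, N (f v - f u) < e.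
  by move=> e /(H u)[d d0 dP]; apply/nbhsCP; exists d.
exact: (proj2 (cvgCP f (f u) _) K).
Qed.

Let rearrange (k i A1 A2 A3 A4 B1 B2 B3 B4 : C) :
  A1 - A2 + i * (A3 - A4) - k * (B1 - B2 + i * (B3 - B4)) =
  A1 - k * B1 - (A2 - k * B2) + i * (A3 - k * B3 - (A4 - k * B4)).
Proof. ring. Qed.

(** The difference quotient [g], completed by [l] at [z], is continuous and differentiable off [z],
    so [goursat_punctured] kills its integral. No edge meets [z], so the quotient can be split edge
    by edge. *)
Lemma cauchy_formula f (a b c d : R) (z : C) : continuous f ->
  a < complex.Re z < b -> c < complex.Im z < d ->
  (forall x y, a <= x <= b -> c <= y <= d -> exists l, cdiff f (x +i* y) l) ->
  f z * rect_int (fun u => 1 * (u - z)^-1 ^+ 1) a b c d =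
  rect_int (fun u => f u * (u - z)^-1 ^+ 1) a b c d.
Proof.
move=> cf azb czd df.
have [l fl] : exists l, cdiff f z l.
  move: azb czd df; case: z => x y /= /andP[ax xb] /andP[cy yd]; apply.
    by rewrite !ltW.
  by rewrite !ltW.
pose g u := if u == z then l else (f u - f z) / (u - z).
have gE u : u != z -> g u = (f u - f z) / (u - z) by rewrite /g => /negPf ->.
have uz (u : C) : u != z -> u - z != 0 by rewrite subr_eq0.
have cg : continuous g.
  apply: continuousC_eps => u e e0; have [->|uneq] := eqVneq u z.
    have [dl dl0 dlP] := fl _ (divr_gt0 e0 (ltr0Sn _ 1)).
    exists dl => // v vd; rewrite {2}/g eqxx.
    have [->|vz] := eqVneq v z; first by rewrite /g eqxx subrr Normc.normc0.
    have := dlP _ vd; rewrite (addrC z) subrK gE// => H.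
    have -> : (f v - f z) / (v - z) - l = (f v - f z - l * (v - z)) / (v - z).
      by rewrite [RHS]mulrBl mulfK ?uz.
    rewrite Normc.normcM Normc.normcV (@le_lt_trans _ _ (e / 2))//.
      by rewrite ler_pdivrMr ?normc_gt0 ?uz.
    by rewrite ltr_pdivrMr// ltr_pMr// ltr1n.
  have cq : (f v - f z) / (v - z) @[v --> u] --> (f u - f z) / (u - z).
    have c1 : f v - f z @[v --> u] --> f u - f z.
      exact: (continuousC_B cf (@continuousC_cst _ _ (f z))).
    have cid : continuous (id : C -> C) by move=> x; exact: cvg_id.
    have c2 : v - z @[v --> u] --> u - z.
      exact: (continuousC_B cid (@continuousC_cst _ _ z)).
    exact: (cvgM c1 (cvgV (uz _ uneq) c2)).
  have /cvgCP/(_ _ e0)/nbhsCP[dl dl0 dlP] := cq.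
  exists (Num.min dl (N (u - z))); first by rewrite lt_min dl0 normc_gt0 ?uz.
  move=> v; rewrite lt_min => /andP[vd vu]; rewrite !gE//; first exact: dlP.
  by apply: contraTneq vu => ->; rewrite normcB ltxx.
have dg x y : a <= x <= b -> c <= y <= d ->
    (x, y) != (complex.Re z, complex.Im z) -> exists l, cdiff g (x +i* y) l.
  move=> xab ycd xyz.
  have uneq : x +i* y != z.
    by apply: contra xyz => /eqP <-.
  have [m fm] := df _ _ xab ycd.
  have dn : cdiff (fun u => u - z) (x +i* y) (1 - 0) :=
    cdiffB (cdiff_id _) (cdiff_cst z _).
  have dq := cdiffM (cdiffB fm (cdiff_cst (f z) _)) (cdiffV (f := fun u => u - z) (uz _ uneq) dn).
  eexists; apply: cdiff_near dq.
    by apply: (_ : 0 < N (x +i* y - z)); rewrite normc_gt0 ?uz.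
  move=> v vu; rewrite gE//; apply: contraTneq vu => ->.
  by rewrite normcB ltxx.
have g0 := goursat_punctured cg azb czd dg.
have NIm (u : C) : complex.Im u <> complex.Im z -> u != z.
  by move=> H; apply/eqP => uE; apply: H; rewrite uE.
have NRe (u : C) : complex.Re u <> complex.Re z -> u != z.
  by move=> H; apply/eqP => uE; apply: H; rewrite uE.
have [/andP[az zb] /andP[cz zd]] := (azb, czd).
have cid : continuous (id : C -> C) by move=> x; exact: cvg_id.
have line (gam : R -> C) s t : continuous gam -> (forall x, gam x != z) ->
    cint s t (fun x => g (gam x)) =
    cint s t (fun x => f (gam x) * (gam x - z)^-1 ^+ 1) -
    f z * cint s t (fun x => 1 * (gam x - z)^-1 ^+ 1).
  move=> cgam gamz.
  have ci : continuous (fun x => (gam x - z)^-1).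
    apply: continuousC_V => [|x]; last exact: uz.
    exact: (continuousC_B cgam (@continuousC_cst _ _ _)).
  have c1 : continuous (fun x => 1 * (gam x - z)^-1 ^+ 1).
    exact: (continuousC_M (@continuousC_cst _ _ 1) ci).
  have cfg : continuous (fun x => f (gam x)).
    by move=> x; apply: (@continuous_comp _ _ _ gam f); [exact: cgam|exact: cf].
  have c2 : continuous (fun x => f (gam x) * (gam x - z)^-1 ^+ 1).
    exact: (continuousC_M cfg ci).
  have c3 : continuous (fun x => f z * (1 * (gam x - z)^-1 ^+ 1)).
    exact: (continuousC_M (@continuousC_cst _ _ (f z)) c1).
  rewrite -(cintZ s t (f z) c1) -(cintB s t c2 c3); congr cint.
  by apply/funext => x; rewrite gE// mul1r expr1 mulrBl.
have hl k := continuous_hline (c := k) cid.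
have vl k := continuous_vline (c := k) cid.
move: g0; rewrite /rect_int.
rewrite (line _ _ _ (hl c)); last by move=> x; apply: NIm => /= E; move: cz; rewrite E ltxx.
rewrite (line _ _ _ (hl d)); last by move=> x; apply: NIm => /= E; move: zd; rewrite E ltxx.
rewrite (line _ _ _ (vl a)); last by move=> x; apply: NRe => /= E; move: az; rewrite E ltxx.
rewrite (line _ _ _ (vl b)); last by move=> x; apply: NRe => /= E; move: zb; rewrite E ltxx.
move=> g0; apply/eqP; rewrite eq_sym -subr_eq0 -g0; apply/eqP.
exact: rearrange.
Qed.

(** Near [z0] Cauchy's formula reads [f = G / W] with [W] nonzero, and [G], [W] are twice
    differentiable at [z0]; the quotient rule then writes [f'] as the differentiable [D]. *)
Lemma derivable_derive_rhp f : (forall z, rhp z -> derivable f z 1) ->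
  forall z, rhp z -> derivable (derive1 f) z 1.
Proof.
move=> df z0 z0P.
have cdf z : rhp z -> cdiff f z (derive1 f z).
  by move=> zP; apply/cdiffP; exact: (DeriveDef (df z zP) (esym (derive1E f z))).
pose x0 := complex.Re z0; pose y0 := complex.Im z0.
have x00 : 0 < x0 by [].
(* This retraction makes [F] continuous on the whole plane, as the contour lemmas ask, and does not
   affect [f] near the square of half-side [x0 / 2] about [z0]. *)
pose rho (z : C) : C := Num.max (complex.Re z) (x0 / 4) +i* complex.Im z.
have x04 : 0 < x0 / 4 by rewrite divr_gt0.
have crho : continuous rho.
  apply: continuousC_eps => u e e0; exists (e / 2); first by rewrite divr_gt0.
  move=> v vu; rewrite (le_lt_trans (ler_normc_ReIm _))// (splitr e) ltrD//=.
    apply: le_lt_trans vu; apply: le_trans (ler_Re_normc _); rewrite raddfB/=.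
    set s := complex.Re v; set t := complex.Re u; set m := x0 / 4.
    rewrite ler_distl; have := ler_norm (s - t); have := ler_norm (t - s).
    rewrite (distrC t s) => H1 H2.
    by case: (leP s m) => sm; case: (leP t m) => tm; apply/andP; split; lra.
  by apply: le_lt_trans vu; apply: le_trans (ler_Im_normc _); rewrite raddfB.
pose F z := f (rho z).
have rhoE z : x0 / 4 <= complex.Re z -> rho z = z.
  by rewrite /rho; case: z => u v /= uv; rewrite max_l.
have cF : continuous F.
  move=> u; apply: (@continuous_comp _ _ _ rho f); first exact: crho.
  apply: (@cdiff_continuous _ _ _ (derive1 f (rho u))); apply: cdf.
  by rewrite /rhp/= /rho/= lt_max x04 orbT.
have dF z : x0 / 4 < complex.Re z -> cdiff F z (derive1 f z).
  move=> zx; apply: cdiff_near (cdf _ (lt_trans x04 zx)).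
    by apply: (_ : 0 < complex.Re z - x0 / 4); rewrite subr_gt0.
  move=> w wz; rewrite /F rhoE//.
  have := ler_Re_normc (w - z); rewrite raddfB/= => /le_lt_trans/(_ wz).
  rewrite ltr_distl => /andP[+ _]; rewrite opprB addrC subrK.
  by move=> /ltW.
pose r := x0 / 2.
have r0 : 0 < r by rewrite divr_gt0.
have inside z : N (z - z0) < r -> [/\ x0 - r < complex.Re z < x0 + r,
    y0 - r < complex.Im z < y0 + r & x0 / 4 < complex.Re z].
  move=> zr; have := ler_Re_normc (z - z0); have := ler_Im_normc (z - z0).
  rewrite !raddfB/= -/x0 -/y0 => /le_lt_trans/(_ zr) + /le_lt_trans/(_ zr).
  rewrite !ltr_distl => iz /[dup] rz /andP[rz1 _]; split => //.
  apply: lt_trans rz1; have -> : x0 - r = x0 / 2 by rewrite /r; field.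
  by rewrite ltr_pM2l// ltf_pV2 ?posrE// ltr_nat.
pose G z := rect_int (fun u => F u * (u - z)^-1 ^+ 1) (x0 - r) (x0 + r) (y0 - r) (y0 + r).
pose G2 z := rect_int (fun u => F u * (u - z)^-1 ^+ 2) (x0 - r) (x0 + r) (y0 - r) (y0 + r).
pose W z := rect_int (fun u => 1 * (u - z)^-1 ^+ 1) (x0 - r) (x0 + r) (y0 - r) (y0 + r).
pose W2 z := rect_int (fun u => 1 * (u - z)^-1 ^+ 2) (x0 - r) (x0 + r) (y0 - r) (y0 + r).
have c1 : continuous (fun _ : C => 1 : C) by exact: continuousC_cst.
have GP z : N (z - z0) < r -> cdiff G z (G2 z) /\ exists l, cdiff G2 z l.
  by move=> /inside[rz iz _]; exact: cdiff_rect_int_kernel1.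
have WP z : N (z - z0) < r -> cdiff W z (W2 z) /\ exists l, cdiff W2 z l.
  by move=> /inside[rz iz _]; exact: (cdiff_rect_int_kernel1 c1 rz iz).
have FGW z : N (z - z0) < r -> F z * W z = G z.
  move=> /inside[rz iz _]; apply: cauchy_formula => // x y /andP[x1 _] _.
  exists (derive1 f (x +i* y)); apply: dF => /=; apply: lt_le_trans x1.
  have -> : x0 - r = x0 / 2 by rewrite /r; field.
  by rewrite ltr_pM2l// ltf_pV2 ?posrE// ltr_nat.
have zz0 : N (z0 - z0) < r by rewrite subrr Normc.normc0.
have W0 : W z0 != 0 by exact: rect_int_inv_neq0.
have [e e0 eP] : exists2 e, 0 < e & forall z, N (z - z0) < e -> W z != 0.
  have /cvgCP/(_ _ (normc_gt0 W0))/nbhsCP[e e0 eP] := cdiff_continuous (WP _ zz0).1.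
  exists e => // z ze; apply/eqP => E.
  have : N (W z - W z0) < N (W z0) := eP z ze.
  by rewrite E sub0r [N (- _)](@normcN R) ltxx.
pose er := Num.min e r.
have er0 : 0 < er by rewrite lt_min e0.
pose D z := G z * (- (W z)^-1 ^+ 2 * W2 z) + (W z)^-1 * G2 z.
have FD z : N (z - z0) < er -> cdiff F z (D z).
  rewrite lt_min => /andP[ze zr].
  apply: cdiff_near (cdiffM (GP z zr).1 (cdiffV (eP z ze) (WP z zr).1)).
    by apply: (_ : 0 < er - N (z - z0)); rewrite subr_gt0 lt_min ze.
  move=> w wz; have {wz}: N (w - z0) < er.
    have -> : w - z0 = (w - z) + (z - z0) by ring.
    by rewrite (le_lt_trans (ler_normcD _ _))// -ltrBrDr.
  by rewrite lt_min => /andP[we wr]; rewrite -FGW// mulfK ?eP.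
have fD z : N (z - z0) < er -> derive1 f z = D z.
  move=> /[dup] /FD FDz; rewrite lt_min => /andP[_ /inside[_ _ /dF Fz]].
  by move: Fz FDz => /cdiffP Fz /cdiffP FDz; rewrite -(@derive_val _ _ _ _ _ _ _ Fz) derive_val.
have [g2 G2P] := (GP _ zz0).2; have [w2 W2P] := (WP _ zz0).2.
(* The negated square in [D] is spelled out as a product with [-1] so that the product rule
   applies. *)
have dD := cdiffD (cdiffM (GP _ zz0).1 (cdiffM (cdiffZ (-1) (cdiffM
    (cdiffV W0 (WP _ zz0).1) (cdiffV W0 (WP _ zz0).1))) W2P))
  (cdiffM (cdiffV W0 (WP _ zz0).1) G2P).
have /cdiffP H := cdiff_near (f := derive1 f) er0 (fun z zr => etrans (fD z zr)
  (ltac:(by rewrite mulN1r -expr2) : D z = G z * (-1 * ((W z)^-1 * (W z)^-1) * W2 z) + (W z)^-1 * G2 z)) dD.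
exact: ex_derive.
Qed.

End CauchyFormula.

(** * Restriction of complex derivatives to the positive axis *)

Section RealTrace.
Context {R : realType}.
Local Notation C := R[i].
Local Notation N := (@Normc.normc R).

Lemma is_derive_eps (p : R -> R) (x l : R) :
  (forall e, 0 < e -> exists2 d, 0 < d & forall h, `|h| < d ->
     `|p (x + h) - p x - l * h| <= e * `|h|) -> is_derive x 1 p l.
Proof.
move=> H.
have K : h^-1 *: ((p \o shift x) (h *: 1) - p x) @[h --> 0^'] --> l.
  apply/cvgrPdist_lt => e e0.
  have [d d0 dP] := H _ (divr_gt0 e0 (ltr0Sn _ 1)).
  rewrite near_withinE; apply/nbhs_ballP; exists d => //= h.
  rewrite /ball/= sub0r normrN => hd h0.
  rewrite /= /shift/= [h *: 1]mulr1 (addrC h).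
  have -> : l - h^-1 *: (p (x + h) - p x) = - ((p (x + h) - p x - l * h) / h).
    by rewrite mulrBl mulfK// opprB mulrC.
  rewrite normrN normrM normfV ltr_pdivrMr ?normr_gt0//.
  apply: le_lt_trans (dP _ hd) _; rewrite ltr_pM2r ?normr_gt0//.
  by rewrite ltr_pdivrMr// ltr_pMr// ltr1n.
have dp : derivable p x 1 by apply/cvg_ex; exists l.
exact: (DeriveDef dp (cvg_lim (@Rhausdorff R) K)).
Qed.

(** Real increments already determine the complex derivative, and along them the quotients are
    real. *)
Lemma derive_real_trace (f : C -> C) (p : R -> R) (x : R) : 0 < x ->
  (forall y : R, 0 < y -> f y%:C = (p y)%:C) -> derivable f x%:C 1 ->
  is_derive x 1 p (derive1 p x) /\ derive1 f x%:C = (derive1 p x)%:C.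
Proof.
move=> x0 fp df.
have cd : cdiff f x%:C (derive1 f x%:C).
  by apply/cdiffP; exact: (DeriveDef df (esym (derive1E f x%:C))).
set l := derive1 f x%:C in cd *.
have key e : 0 < e -> exists2 d, 0 < d & forall h : R, `|h| < d ->
    N ((p (x + h) - p x)%:C - l * h%:C) <= e * `|h|.
  move=> /cd[d d0 dP]; exists (Num.min d x); first by rewrite lt_min d0.
  move=> h; rewrite lt_min => /andP[hd hx].
  have xh : 0 < x + h.
    by rewrite -ltrBlDl sub0r; move: hx; rewrite ltr_norml => /andP[].
  have := dP h%:C; rewrite normc_real => /(_ hd).
  by rewrite -rmorphD fp// fp// -rmorphB.
have dp : is_derive x 1 p (complex.Re l).
  apply: is_derive_eps => e /key[d d0 dP]; exists d => // h /dP.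
  apply: le_trans; apply: le_trans (ler_Re_normc _).
  by case: l {cd key dP} => l1 l2 /=; rewrite mulr0 subr0.
have pl : derive1 p x = complex.Re l by rewrite derive1E; exact: derive_val.
split; first by rewrite pl.
rewrite pl; have Iml : complex.Im l = 0.
  apply/eqP; rewrite -normr_eq0 eq_le normr_ge0 andbT.
  apply/ler_addgt0Pl => e e0; rewrite addr0.
  have [d d0 dP] := key _ e0.
  have d20 : 0 < d / 2 by rewrite divr_gt0.
  have d2d : `|d / 2| < d by rewrite gtr0_norm// ltr_pdivrMr// ltr_pMr// ltr1n.
  have := le_trans (ler_Im_normc _) (dP _ d2d).
  rewrite -[X in X <= _ -> _]normrN.
  have -> : - complex.Im ((p (x + d / 2) - p x)%:C - l * (d / 2)%:C) =
      complex.Im l * (d / 2).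
    by case: l {cd key dp pl dP} => l1 l2 /=; ring.
  by rewrite normrM ler_pM2r// gtr0_norm.
by case: l Iml {cd key dp pl} => l1 l2 /= ->.
Qed.

(** The trace is taken of [f], [f'] and [f''] in turn; the last one serves for the continuity of the
    real second derivative. *)
Lemma derive2_real_trace (f : C -> C) (p : R -> R) :
  (forall z, rhp z -> derivable f z 1) ->
  (forall y : R, 0 < y -> f y%:C = (p y)%:C) ->
  [/\ forall x : R, 0 < x -> is_derive x 1 p (derive1 p x),
      forall x : R, 0 < x -> is_derive x 1 (derive1 p) (derive1 (derive1 p) x),
      forall x : R, 0 < x -> {for x, continuous (derive1 (derive1 p))},
      forall x : R, 0 < x -> derive1n 1 f x%:C = (derive1 p x)%:C &
      forall x : R, 0 < x -> derive1n 2 f x%:C = (derive1 (derive1 p) x)%:C].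
Proof.
move=> df fp.
have d1f := derivable_derive_rhp df.
have d2f := derivable_derive_rhp d1f.
have rx (x : R) : 0 < x -> rhp x%:C by [].
have t1 x (x0 : 0 < x) := derive_real_trace x0 fp (df _ (rx x x0)).
have e1 y (y0 : 0 < y) := (t1 y y0).2.
have t2 x (x0 : 0 < x) := derive_real_trace x0 e1 (d1f _ (rx x x0)).
have e2 y (y0 : 0 < y) := (t2 y y0).2.
have t3 x (x0 : 0 < x) := derive_real_trace x0 e2 (d2f _ (rx x x0)).
split; [by move=> x x0; exact: (t1 x x0).1|by move=> x x0; exact: (t2 x x0).1| |exact: e1|exact: e2].
move=> x x0; have d3 := (t3 x x0).1.
by apply: differentiable_continuous; apply/derivable1_diffP; exact: ex_derive.
Qed.

End RealTrace.

(** * Transfer between Borel and completed Lebesgue measure *)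

Section CompletedLebesgue.
Context {R : realType}.
Local Notation mu := (@lebesgue_measure R).
Local Notation cmu := (@completed_lebesgue_measure R).

(** A completed measurable set is a Borel set [X] together with part of a Borel null set [M]; when
    it is null, the union of [X] and [M] is a Borel null cover. *)
Lemma completed_negligibleP (A : set R) :
  cmu.-negligible A <-> mu.-negligible A.
Proof.
split=> [[B [mB B0 AB]]|[B [mB B0 AB]]]; last first.
  by exists B; split => //; exact: sub_caratheodory.
have : (completed_algebra_gen mu).-sigma.-measurable B.
  by rewrite completed_caratheodory_measurable.
rewrite g_sigma_completed_algebra_genE => -[X mX [N [M [mM M0 NM]] XNB]].
exists (X `|` M); split.
- exact: measurableU.
- apply/eqP; rewrite eq_le measure_ge0 andbT.
  apply: (le_trans (measureU2 _ mX mM)).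
  have X0 : (mu X <= 0)%E.
    by rewrite -B0; apply: le_outer_measure; rewrite -XNB; exact: subsetUl.
  have M0' : (mu M <= 0)%E by move: M0 => /eqP; rewrite eq_le => /andP[].
  by apply: le_trans (leeD X0 M0') _; rewrite adde0.
- move=> x /AB; rewrite -XNB => -[Xx|Nx]; [by left|right; exact: NM].
Qed.

Lemma ae_completedP (P : R -> Prop) :
  {ae cmu, forall x, P x} <-> {ae mu, forall x, P x}.
Proof. exact: completed_negligibleP. Qed.

Lemma measurable_completed d (T : measurableType d) (D : set R) (f : R -> T) :
  measurable_fun (D : set (measurableTypeR R)) (f : measurableTypeR R -> T) ->
  measurable D -> lebesgue_measurable D f.
Proof.
move=> mf mD _ B mB; apply: sub_caratheodory; exact: mf.
Qed.

(** The identity from the completed to the Borel sigma-algebra is measurable and carries one measure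
    to the other, so this is a change of variables. *)
Lemma integral_completed (D : set R) (f : R -> \bar R) :
  measurable (D : set (measurableTypeR R)) ->
  measurable_fun (D : set (measurableTypeR R)) (f : measurableTypeR R -> \bar R) ->
  (forall x, D x -> (0 <= f x)%E) ->
  (\int[cmu]_(x in D) f x = \int[mu]_(x in D) f x)%E.
Proof.
move=> mD mf f0.
have mid : measurable_fun [set: lebesgueType R]
   (id : lebesgueType R -> measurableTypeR R).
  by move=> _ B mB; rewrite setTI; exact: sub_caratheodory.
have := @ge0_integral_pushforward _ _ (lebesgueType R) (measurableTypeR R) R id mid cmu D f mD mf.
move=> <-; last by move=> y; rewrite inE; exact: f0.
by apply: eq_measure_integral => A mA AD.
Qed.

(** Superlevel sets at rational heights are Borel off null sets; setting [f] to 0 on the union [Z]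
    of these countably many null sets makes them all Borel. *)
Lemma completed_measurable_ae_eq (f : R -> R) :
  (forall x, 0 <= f x) -> lebesgue_measurable setT f ->
  exists g : R -> R, [/\ measurable_fun [set: measurableTypeR R] g,
    forall x, 0 <= g x & {ae mu, forall x, f x = g x}].
Proof.
move=> f0 mf.
have E q : exists XZ : set R * set R, let: (X, Z) := XZ in
    [/\ measurable (X : set (measurableTypeR R)),
        measurable (Z : set (measurableTypeR R)), mu Z = 0%E &
        forall x, ~ Z x -> (ratr q < f x <-> X x)].
  have mE : (completed_algebra_gen mu).-sigma.-measurable (f @^-1` `]ratr q, +oo[).
    rewrite completed_caratheodory_measurable.
    rewrite -[X in _ X]setTI; apply: (mf (@measurableT _ (lebesgueType R))).
    exact: measurable_itv.
  move: mE; rewrite g_sigma_completed_algebra_genE => -[X mX [N [M [mM M0 NM]] XNE]].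
  exists (X, M); split => // x Mx.
  have -> : ratr q < f x <-> (X `|` N) x by rewrite XNE /= in_itv/= andbT.
  by split => [[//|/NM]//|Xx]; left.
have [XZ XZP] := choice E.
pose r n : rat := odflt 0 (unpickle n).
pose Z := \bigcup_n (XZ (r n)).2.
have mXq q : measurable ((XZ q).1 : set (measurableTypeR R)).
  by have := XZP q; case: (XZ q) => ? ? [].
have mZq q : measurable ((XZ q).2 : set (measurableTypeR R)).
  by have := XZP q; case: (XZ q) => ? ? [].
have Zq0 q : mu.-negligible (XZ q).2.
  exists (XZ q).2; split => //.
  by have := XZP q; case: (XZ q) => ? ? [].
have mZ : measurable (Z : set (measurableTypeR R)).
  by apply: bigcupT_measurable => n; exact: mZq.
have Z0 : mu.-negligible Z by apply: negligible_bigcup => n; exact: Zq0.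
have fX q x : ~ Z x -> (ratr q < f x <-> (XZ q).1 x).
  move=> Zx; have := XZP q; case XZE: (XZ q) => [X' Z'] [_ _ _]; apply => Z'x.
  by apply: Zx; exists (pickle q) => //; rewrite /r pickleK /= XZE.
pose g x := if `[< Z x >] then 0 else f x.
exists g; split; last 2 first.
- by move=> x; rewrite /g; case: ifP.
- apply: negligibleS Z0 => x /=; apply: contra_notP => Zx.
  by rewrite /g asboolF.
have mq q : measurable ((g @^-1` `]ratr q, +oo[) : set (measurableTypeR R)).
  (* On [Z] the value of [g] is 0, so [Z] belongs to the superlevel set exactly when [q < 0]. *)
  have [q0|q0] := ltP q 0.
    rewrite (_ : _ @^-1` _ = Z `|` ((XZ q).1 `\` Z)).
      by apply: measurableU => //; exact: measurableD.
    apply/seteqP; split => x; rewrite /= in_itv/= andbT /g.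
      by case: asboolP => Zx; [left|right; split => //; exact/fX].
    by case: asboolP => Zx [//|[Xx _]]; rewrite ?ltrq0//; exact/fX.
  rewrite (_ : _ @^-1` _ = (XZ q).1 `\` Z); first exact: measurableD.
  apply/seteqP; split => x; rewrite /= in_itv/= andbT /g.
    case: asboolP => Zx; last by split => //; exact/fX.
    by rewrite ltNge ler0q q0.
  by move=> [Xx Zx]; rewrite asboolF//; exact/fX.
apply: (measurability _ (RGenOInfty.measurableE R)) => // _ [_ [x ->] <-].
rewrite setTI (_ : _ @^-1` _ =
  \bigcup_(q in [set: rat]) (if x < ratr q then g @^-1` `]ratr q, +oo[ else set0)).
  by apply: bigcupT_measurable_rat => q; case: ifP.
apply/seteqP; split => y /=; rewrite in_itv/= andbT.
  move=> xy; have [q] := rat_in_itvoo xy; rewrite in_itv/= => /andP[xq qy].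
  by exists q => //; rewrite xq/= in_itv/= andbT.
move=> [q _]; case: ifP => //= xq; rewrite in_itv/= andbT; exact: lt_trans.
Qed.

Lemma integral_completed_ae_eq (D : set R) (f : R -> \bar R) (g : R -> \bar R) :
  measurable (D : set (measurableTypeR R)) ->
  measurable_fun (D : set (measurableTypeR R)) (g : measurableTypeR R -> \bar R) ->
  (forall x, D x -> (0 <= g x)%E) ->
  {ae mu, forall x, D x -> g x = f x} ->
  lebesgue_measurable D f /\
  (\int[cmu]_(x in D) f x = \int[mu]_(x in D) g x)%E.
Proof.
move=> mD mg g0 /ae_completedP gf.
have mgc := measurable_completed mg mD.
have mf : lebesgue_measurable D f.
  exact: (ae_measurable_fun (@completed_lebesgue_measure_is_complete R) gf mgc).
split=> //; rewrite -integral_completed//.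
apply: esym; apply: ae_eq_integral => //.
exact: sub_caratheodory.
Qed.

End CompletedLebesgue.

(** * Primitives, difference quotients and Fatou's lemma *)

Section AbsolutelyContinuousFTC.
Context {R : realType}.
Local Notation mu := (@lebesgue_measure R).
Local Notation cmu := (@completed_lebesgue_measure R).
Implicit Types (f g F G : R -> R).

Definition ge0_integrable g :=
  (forall x, 0 <= g x) /\ mu.-integrable [set: R] (EFin \o g).

(** Integrating from minus infinity avoids a base point; only differences of primitives matter. *)
Definition primitive g (t : R) : R := \int[mu]_(x in `]-oo, t]) g x.

Lemma ge0_integrableD g1 g2 : ge0_integrable g1 -> ge0_integrable g2 ->
  ge0_integrable (fun x => g1 x + g2 x) /\
  forall t, primitive (fun x => g1 x + g2 x) t = primitive g1 t + primitive g2 t.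
Proof.
move=> [g10 ig1] [g20 ig2]; split.
  split; first by move=> x; rewrite addr_ge0.
  have := integrableD measurableT ig1 ig2.
  by apply: eq_integrable => // x _; rewrite /= EFinD.
move=> t; rewrite /primitive RintegralD//.
  exact: integrableS ig1.
exact: integrableS ig2.
Qed.

Lemma ge0_integrableZ g c : 0 <= c -> ge0_integrable g ->
  ge0_integrable (fun x => c * g x) /\
  forall t, primitive (fun x => c * g x) t = c * primitive g t.
Proof.
move=> c0 [g0 ig]; split.
  split; first by move=> x; rewrite mulr_ge0.
  have := integrableZl measurableT c ig.
  by apply: eq_integrable => // x _; rewrite /= EFinM.
move=> t; rewrite /primitive RintegralZl//.
exact: integrableS ig.
Qed.

Lemma primitiveB g t u : ge0_integrable g -> t <= u ->
  (\int[mu]_(x in `[t, u]) (g x)%:E = (primitive g u - primitive g t)%:E)%E.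
Proof.
move=> [g0 ig] tu.
have iu : mu.-integrable `]-oo, u] (EFin \o g) by exact: integrableS ig.
rewrite /primitive (Rintegral_itvB iu)//.
rewrite Rintegral_itv_obnd_cbnd; last exact: integrableS ig.
by rewrite fineK//; apply: integrable_fin_num => //; exact: integrableS ig.
Qed.

Lemma primitive_uniform_continuous g : ge0_integrable g ->
  forall e, 0 < e -> exists2 d, 0 < d &
    forall t u, t <= u -> u - t < d -> primitive g u - primitive g t < e.
Proof.
move=> gi e e0.
have [d [d0 dP]] := integral_normr_continuous gi.2 e0.
exists d => // t u tu utd.
have m : (mu `[t, u] < d%:E)%E.
  rewrite lebesgue_measure_itv/=; case: ifP => _; last by rewrite lte_fin.
  by rewrite -EFinB lte_fin.
have := dP _ (measurable_itv `[t, u]) m.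
rewrite /Rintegral; under eq_integral do rewrite (ger0_norm (gi.1 _)).
by rewrite (primitiveB gi tu).
Qed.

Lemma primitive_derivative_ae g : ge0_integrable g ->
  {ae mu, forall t : R, is_derive t 1 (primitive g) (g t)}.
Proof.
move=> [g0 ig].
have locg : locally_integrable [set: R] g.
  by apply: open_integrable_locally => //; exact: openT.
have igy y : mu.-integrable `]-oo, y] (EFin \o g) by exact: integrableS ig.
have := FTC1Ny igy locg.
apply: filterS; first exact: (ae_filter_ringOfSetsType mu).
by move=> t [dt dtE]; exact: (DeriveDef dt (etrans (esym (derive1E _ _)) dtE)).
Qed.

(** Extension by zero and passage to a Borel version let one primitive on the whole line represent
    the integrals over all subintervals. *)
Lemma completed_integral_primitive f (a b : R) :
  (forall r, a <= r <= b -> 0 <= f r) -> cmu.-integrable `[a, b] (EFin \o f) ->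
  exists g, ge0_integrable g /\ forall t u, a <= t -> t <= u -> u <= b ->
    (\int[cmu]_(r in `[t, u]) (f r)%:E = (primitive g u - primitive g t)%:E)%E.
Proof.
move=> f0 fi.
pose h := f \_ `[a, b].
have h0 x : 0 <= h x.
  rewrite /h patchE; case: ifPn => //; rewrite inE/= in_itv/=; exact: f0.
have mcab : measurable (`[a, b]%classic : set (lebesgueType R)).
  exact: sub_caratheodory.
have mf : lebesgue_measurable `[a, b] f.
  by apply/measurable_EFinP; exact: (measurable_int cmu fi).
have mh : lebesgue_measurable setT h.
  apply/(measurable_restrictT _ _).1 => //.
have [g [mg g0 /= hg]] := completed_measurable_ae_eq h0 mh.
have intE t u : a <= t -> u <= b ->
   (\int[cmu]_(r in `[t, u]) (f r)%:E = \int[mu]_(r in `[t, u]) (g r)%:E)%E.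
  move=> at_ ub; apply: (integral_completed_ae_eq _ _ _ _).2 => //.
  - by apply/measurable_EFinP; exact: measurable_funTS.
  - by move=> x _; rewrite lee_fin.
  - move: hg; apply: filterS; first exact: (ae_filter_ringOfSetsType mu).
    move=> x <-; rewrite /= in_itv/= => /andP[tx xu]; rewrite /h patchE.
    by rewrite mem_set//= in_itv/= (le_trans at_ tx) (le_trans xu ub).
exists g.
have gi : ge0_integrable g.
  split=> //; apply/integrableP; split; first exact/measurable_EFinP.
  under eq_integral do rewrite /= ger0_norm//.
  have -> : (\int[mu]_x (g x)%:E = \int[cmu]_x (h x)%:E)%E.
    apply: esym; apply: (integral_completed_ae_eq _ _ _ _).2 => //.
    - exact/measurable_EFinP.
    - by move=> x _; rewrite lee_fin.
    - move: hg; apply: filterS; first exact: (ae_filter_ringOfSetsType mu).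
      by move=> x ->.
  have := fi => /integrableP[_]; apply: le_lt_trans.
  have -> : (\int[cmu]_x (h x)%:E = \int[cmu]_(x in `[a, b]) (f x)%:E)%E.
    rewrite [RHS]integral_mkcond; apply: eq_integral => x _.
    by rewrite /h !patchE; case: ifP.
  rewrite le_eqVlt; apply/orP; left; apply/eqP; apply: eq_integral => x.
  by rewrite inE/= in_itv/= => xab; rewrite ger0_norm ?f0.
split=> // t u at_ tu ub; by rewrite intE// (primitiveB gi tu).
Qed.

(** The integral telescopes to the mean of [G] over [[b, b + h]] minus its mean over [[a, a + h]].
    The former is [G b], as [G] is constant beyond [b]; the latter is at least [G a]. *)
Lemma integral_diff_quotient_le G (a b : R) (h : R) : continuous G ->
  (forall x y, x <= y -> G x <= G y) -> (forall x, b <= x -> G x = G b) ->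
  a <= b -> 0 < h ->
  (\int[mu]_(t in `[a, b]) (h^-1 * (G (t + h) - G t))%:E <= (G b - G a)%:E)%E.
Proof.
move=> cG ndG Gb; rewrite le_eqVlt => /predU1P[<-|ab] h0.
  by rewrite set_itv1 integral_set1 subrr.
(* A base point strictly left of [a] gives [P] a two-sided derivative at [a] too. *)
pose c := a - 1.
pose P x := \int[mu]_(t in `[c, x]) G t.
have dP (t : R) : c < t -> is_derive t 1 P (G t).
  move=> ct; have tt : t < t + 1 by rewrite ltrDl.
  have [d1 d2] := continuous_FTC1_closed tt (continuous_segment_integrable c (t + 1) cG) ct (cG t).
  exact: (DeriveDef d1 (etrans (esym (derive1E _ _)) d2)).
pose K t := h^-1 * (P (t + h) - P t).
have dK (t : R) : c < t -> is_derive t 1 K (h^-1 * (G (t + h) - G t)).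
  move=> ct; have cth : c < t + h by rewrite (lt_trans ct)// ltrDl.
  have dPt := dP t ct; have dPth := dP _ cth.
  pose sh (t : R) := t + h.
  have ds : is_derive t 1 sh 1 by apply: is_derive_eq; rewrite addr0.
  have dc : is_derive t 1 (P \o sh) (G (t + h) * 1) := @is_derive1_comp _ P sh t _ _ dPth ds.
  have dB := is_deriveB dc dPt.
  have -> : K = (h^-1) *: ((P \o sh) - P).
    by apply/funext => x; rewrite /K.
  by have := is_deriveZ h^-1 dB; rewrite [G _ * 1]mulr1.
have ca t : a <= t -> c < t by apply: lt_le_trans; rewrite /c ltrBlDr ltrDl.
have cK t : a <= t -> {for t, continuous K}.
  move=> ta; have dKt := dK t (ca t ta).
  by apply: differentiable_continuous; apply/derivable1_diffP; exact: ex_derive.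
rewrite (@continuous_FTC2 _ _ K)//; last 3 first.
- apply: continuous_subspaceT => x; apply: cvgM; first exact: cvg_cst.
  apply: cvgB; last exact: cG.
  apply: (@continuous_comp _ _ _ (fun t => t + h) G); last exact: cG.
  apply: (@differentiable_continuous _ _ _ x (fun t => t + h)).
  by apply/derivable1_diffP; exact: ex_derive.
- split.
  + move=> x; rewrite in_itv/= => /andP[ax _].
    by have dKx := dK x (ca x (ltW ax)); exact: ex_derive.
  + by apply: cvg_at_right_filter; exact: cK.
  + by apply: cvg_at_left_filter; apply: cK; exact: ltW.
- move=> x; rewrite in_itv/= => /andP[ax _]; rewrite derive1E.
  by have dKx := dK x (ca x (ltW ax)); rewrite derive_val.
rewrite -EFinB lee_fin.
have MV x : a <= x -> exists2 y, x <= y & P (x + h) - P x = G y * h.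
  move=> ax; have xh : x < x + h by rewrite ltrDl.
  have M1 (y : R) : y \in `]x, x + h[ -> is_derive y 1 P (G y).
    rewrite in_itv/= => /andP[xy _]; apply: dP; apply: ca.
    exact: le_trans ax (ltW xy).
  have M2 : {within `[x, x + h], continuous P}.
    apply: derivable_within_continuous => y; rewrite in_itv/= => /andP[xy _].
    by have dPy := dP y (ca y (le_trans ax xy)); exact: ex_derive.
  have [y + E] := MVT xh M1 M2.
  rewrite in_itv/= => /andP[xy _]; exists y; first exact: ltW.
  by rewrite E; congr (_ * _); ring.
have [y1 by1 E1] := MV b (ltW ab); have [y2 ay2 E2] := MV a (lexx a).
rewrite /K E1 E2 Gb// -mulrBr -mulrBl mulrC mulfK ?gt_eqF//.
by rewrite lerB// ndG.
Qed.

End AbsolutelyContinuousFTC.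

Section DominatedFTC.
Context {R : realType}.
Local Notation mu := (@lebesgue_measure R).
Local Notation cmu := (@completed_lebesgue_measure R).
Implicit Types (f g F G : R -> R).

Lemma harmonic_dnbhs0 : (n.+1%:R^-1 : R) @[n --> \oo] --> 0^'.
Proof.
move=> A; rewrite /dnbhs /within/= => /nbhs_ballP[e /= e0 H].
have : \forall n \near \oo, (n.+1%:R^-1 : R) < e by exact: near_infty_natSinv_lt (PosNum e0).
apply: filterS => n ne; apply: H; last by rewrite invr_eq0 pnatr_eq0.
by rewrite /ball/= sub0r normrN ger0_norm// invr_ge0.
Qed.

Lemma is_derive_harmonic f (t l : R) : is_derive t 1 f l ->
  (n.+1%:R * (f (t + n.+1%:R^-1) - f t)) @[n --> \oo] --> l.
Proof.
move=> fl.
have : h^-1 *: ((f \o shift t) (h *: 1) - f t) @[h --> 0^'] --> l.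
  by have <- := @derive_val _ _ _ _ _ _ _ fl; exact: ex_derive.
move=> /(cvg_comp _ _ harmonic_dnbhs0); apply: cvg_trans; apply: near_eq_cvg.
apply: nearW => n; rewrite /= invrK /shift/=.
by rewrite [n.+1%:R^-1 *: 1]mulr1 (addrC t).
Qed.

(** [k] comes without measurability; the lower limit [K] of the quotients is Borel and agrees with
    [k] almost everywhere. The bound is Fatou's lemma applied on top of
    [integral_diff_quotient_le]. *)
Lemma fatou_right_derivative G k (a b : R) : continuous G ->
  (forall x y, x <= y -> G x <= G y) -> (forall x, b <= x -> G x = G b) ->
  a <= b ->
  {ae mu, forall t, a < t < b ->
    (n.+1%:R * (G (t + n.+1%:R^-1) - G t)) @[n --> \oo] --> k t} ->
  exists K : R -> \bar R, [/\
    measurable_fun (`[a, b] : set (measurableTypeR R)) (K : measurableTypeR R -> \bar R),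
    forall t, (0 <= K t)%E,
    {ae mu, forall t, `[a, b]%classic t -> K t = (k t)%:E} &
    (\int[mu]_(t in `[a, b]) K t <= (G b - G a)%:E)%E].
Proof.
move=> cG ndG Gb ab Gk.
pose q n (t : R) := (n.+1%:R * (G (t + n.+1%:R^-1) - G t))%:E.
have q0 n t : (0 <= q n t)%E.
  by rewrite lee_fin mulr_ge0// subr_ge0 ndG// lerDl invr_ge0.
have mq n : measurable_fun (`[a, b] : set (measurableTypeR R)) (q n).
  suff cq : continuous (fun t : R => n.+1%:R * (G (t + n.+1%:R^-1) - G t)).
    by apply/measurable_EFinP; apply: measurable_funTS; exact: continuous_measurable_fun.
  have cs : continuous (fun t : R => G (t + n.+1%:R^-1)).
    move=> x; apply: (@continuous_comp _ _ _ (fun t : R => t + n.+1%:R^-1) G); last exact: cG.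
    apply: (@differentiable_continuous _ _ _ x (fun t : R => t + n.+1%:R^-1)).
    by apply/derivable1_diffP; exact: ex_derive.
  move=> x; apply: cvgM; first exact: cvg_cst.
  by apply: cvgB; [exact: cs|exact: cG].
exists (fun t => limn_einf (q^~ t)); split.
- rewrite /limn_einf; apply: measurableT_comp => //.
  apply: (measurable_fun_limn_esup (f := fun n t => (- q n t)%E)) => n.
  by apply: measurableT_comp => //; exact: mq.
- move=> t; rewrite limn_einf_lim; apply: lime_ge; first exact: is_cvg_einfs.
  by apply: nearW => n; apply: le_ereal_inf_tmp => _ [m _ <-].
- have na : {ae mu, forall t : R, t != a} .
    by exists [set a]; split => //=; [exact: lebesgue_measure_set1|move=> x /= /negP/negPn/eqP].
  have nb : {ae mu, forall t : R, t != b} .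
    by exists [set b]; split => //=; [exact: lebesgue_measure_set1|move=> x /= /negP/negPn/eqP].
  have FF := ae_filter_ringOfSetsType mu.
  move: Gk na nb; apply: filterS3 => t Gk ta tb.
  rewrite /= in_itv/= !le_eqVlt (eq_sym a) (negPf ta) (negPf tb)/= => tab.
  have qk : q n t @[n --> \oo] --> (k t)%:E by apply/fine_cvgP; split; [exact: nearW|exact: Gk].
  by rewrite (cvg_limn_einf_sup qk).1.
- apply: (le_trans (fatou mu (measurable_itv `[a, b]) mq (fun n t _ => q0 n t))).
  rewrite limn_einf_lim; apply: lime_le; first exact: is_cvg_einfs.
  apply: nearW => n; apply: (@le_trans _ _ (\int[mu]_(t in `[a, b]) q n t)%E).
    by apply: ereal_inf_lbound; exists n => /=.
  have n0 : (0 : R) < n.+1%:R^-1 by rewrite invr_gt0.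
  have := integral_diff_quotient_le cG ndG Gb ab n0.
  by rewrite invrK.
Qed.

(** Freezes time outside [[a, b]], turning a function on the interval into one on the line that is
    constant beyond [b]. *)
Definition clamp (a b t : R) := Num.max a (Num.min t b).

Lemma clamp_id a b t : a <= t -> t <= b -> clamp a b t = t.
Proof. by move=> at_ tb; rewrite /clamp min_l// max_r. Qed.

Lemma clamp_gt a b t : a <= b -> b <= t -> clamp a b t = b.
Proof. by move=> ab bt; rewrite /clamp min_r// max_r. Qed.

Lemma clamp_bounds a b t u : a <= b -> t <= u ->
  [/\ a <= clamp a b t, clamp a b t <= clamp a b u, clamp a b u <= b &
      clamp a b u - clamp a b t <= u - t].
Proof.
move=> ab tu; rewrite /clamp.
by case: (leP t b) => tb; case: (leP u b) => ub; rewrite ?(max_r ab);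
  try (case: (leP a t) => at_); try (case: (leP a u) => au); split; lra.
Qed.

Lemma dominated_continuous G g (a b : R) : ge0_integrable g -> a <= b ->
  (forall t u, t <= u -> `|G u - G t| <=
     primitive g (clamp a b u) - primitive g (clamp a b t)) ->
  continuous G.
Proof.
move=> gi ab GA t; apply/cvgrPdist_lt => e e0.
have [d d0 dP] := primitive_uniform_continuous gi e0.
have key u v : u <= v -> v - u < d -> `|G v - G u| < e.
  move=> uv vud; have [_ c1 _ c2] := clamp_bounds ab uv.
  by rewrite (le_lt_trans (GA _ _ uv))// dP// (le_lt_trans c2).
near=> u; have [tu|ut] := leP t u.
  rewrite distrC; apply: key => //.
  by rewrite (le_lt_trans (ler_norm _))// distrC; near: u; exact: cvgr_dist_lt.
apply: key; first exact: ltW.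
by rewrite (le_lt_trans (ler_norm _))//; near: u; exact: cvgr_dist_lt.
Unshelve. all: by end_near. Qed.

(** Fatou bounds the integral of [k] by [F b - F a] and that of [g - k] by the increment of [A - F].
    The two integrals add up to that of [g], which is the finite number [A b - A a], so both bounds
    are equalities. *)
Lemma dominated_ftc F g k (a b : R) : a <= b -> ge0_integrable g ->
  (forall t u, a <= t -> t <= u -> u <= b ->
     0 <= F u - F t <= primitive g u - primitive g t) ->
  {ae mu, forall t, a < t < b ->
    (n.+1%:R * (F (t + n.+1%:R^-1) - F t)) @[n --> \oo] --> k t} ->
  lebesgue_measurable `[a, b] (EFin \o k) /\
  (\int[cmu]_(t in `[a, b]) (k t)%:E = (F b - F a)%:E)%E.
Proof.
move=> ab gi FA Fk.
have FF := ae_filter_ringOfSetsType mu.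
pose A := primitive g.
pose F1 t := F (clamp a b t).
pose F2 t := A (clamp a b t) - F (clamp a b t).
have F1A t u : t <= u -> 0 <= F1 u - F1 t <= A (clamp a b u) - A (clamp a b t).
  by move=> tu; have [c1 c2 c3 _] := clamp_bounds ab tu; exact: FA.
have F2A t u : t <= u -> 0 <= F2 u - F2 t <= A (clamp a b u) - A (clamp a b t).
  move=> tu; have := F1A t u tu; rewrite /F2 -/(F1 t) -/(F1 u).
  by move=> /andP[h1 h2]; apply/andP; split; lra.
have normE (G : R -> R) (t u : R) d : 0 <= G u - G t <= d -> `|G u - G t| <= d.
  by move=> /andP[h0 h1]; rewrite ger0_norm.
have cF1 := dominated_continuous gi ab (fun t u tu => normE F1 _ _ _ (F1A t u tu)).
have cF2 := dominated_continuous gi ab (fun t u tu => normE F2 _ _ _ (F2A t u tu)).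
have ndF1 x y : x <= y -> F1 x <= F1 y by move=> /F1A/andP[+ _]; rewrite subr_ge0.
have ndF2 x y : x <= y -> F2 x <= F2 y by move=> /F2A/andP[+ _]; rewrite subr_ge0.
have F1b x : b <= x -> F1 x = F1 b by move=> bx; rewrite /F1 !clamp_gt.
have F2b x : b <= x -> F2 x = F2 b by move=> bx; rewrite /F2 !clamp_gt.
have near_clamp t (G : R -> R) (l : R) : a < t < b ->
    (n.+1%:R * (G (t + n.+1%:R^-1) - G t)) @[n --> \oo] --> l ->
    (n.+1%:R * (G (clamp a b (t + n.+1%:R^-1)) - G (clamp a b t))) @[n --> \oo] --> l.
  move=> /andP[at_ tb]; apply: cvg_trans; apply: near_eq_cvg.
  have bt0 : 0 < b - t by rewrite subr_gt0.
  have : \forall n \near \oo, (n.+1%:R^-1 : R) < b - t.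
    exact: near_infty_natSinv_lt (PosNum bt0).
  apply: filterS => n nbt; rewrite !clamp_id ?(ltW at_) ?(ltW tb)//.
    by rewrite (le_trans (ltW at_))// lerDl invr_ge0.
  by rewrite addrC -lerBrDr ltW.
have F1k : {ae mu, forall t, a < t < b ->
    (n.+1%:R * (F1 (t + n.+1%:R^-1) - F1 t)) @[n --> \oo] --> k t}.
  by move: Fk; apply: filterS => t H tab; exact: near_clamp (H tab).
have F2k : {ae mu, forall t, a < t < b ->
    (n.+1%:R * (F2 (t + n.+1%:R^-1) - F2 t)) @[n --> \oo] --> g t - k t}.
  move: Fk (primitive_derivative_ae gi); apply: filterS2 => t H /is_derive_harmonic At tab.
  apply: (near_clamp t (fun t => A t - F t)) => //.
  have -> : (fun n => n.+1%:R * (A (t + n.+1%:R^-1) - F (t + n.+1%:R^-1) - (A t - F t))) =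
      (fun n => n.+1%:R * (A (t + n.+1%:R^-1) - A t) -
                n.+1%:R * (F (t + n.+1%:R^-1) - F t)).
    by apply/funext => n; rewrite -mulrBr; congr (_ * _); ring.
  exact: (cvgB At (H tab)).
have [K1 [mK1 K10 K1k IK1]] := fatou_right_derivative cF1 ndF1 F1b ab F1k.
have [K2 [mK2 K20 K2k IK2]] := fatou_right_derivative cF2 ndF2 F2b ab F2k.
have mab := measurable_itv `[a, b].
have K12 : (\int[mu]_(t in `[a, b]) K1 t + \int[mu]_(t in `[a, b]) K2 t =
    (A b - A a)%:E)%E.
  rewrite -ge0_integralD// -(primitiveB gi ab).
  have mg : measurable_fun [set: measurableTypeR R] (EFin \o g) := measurable_int mu gi.2.
  have mgab := measurable_funS measurableT (@subsetT _ `[a, b]%classic) mg.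
  have mK12 := emeasurable_funD mK1 mK2.
  apply: ae_eq_integral; [exact: mab|exact: mK12|exact: mgab|].
  move: K1k K2k; apply: filterS2 => t H1 H2 tab.
  by rewrite H1// H2// -EFinD; congr (_%:E); ring.
have E1 : (\int[mu]_(t in `[a, b]) K1 t = (F b - F a)%:E)%E.
  move: IK1 IK2 K12.
  rewrite /F1 /F2 !(clamp_id ab) ?clamp_id//.
  have : (0 <= \int[mu]_(t in `[a, b]) K1 t)%E by exact: integral_ge0.
  have : (0 <= \int[mu]_(t in `[a, b]) K2 t)%E by exact: integral_ge0.
  case: (\int[mu]_(t in `[a, b]) K1 t)%E => [r1| |]//.
  case: (\int[mu]_(t in `[a, b]) K2 t)%E => [r2| |]//.
  rewrite !lee_fin -EFinD => _ _ h1 h2 [h3]; congr (_%:E); lra.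
rewrite -E1; apply: integral_completed_ae_eq => //.
Qed.

End DominatedFTC.

(** * Concave functions on the half-axis *)

Section RealLemmas.
Context {R : realType}.

Lemma MVT_pos (p p1 : R -> R) (a b : R) : (forall x : R, 0 < x -> is_derive x 1 p (p1 x)) ->
  0 < a -> a < b -> exists c, [/\ a < c, c < b & p b - p a = p1 c * (b - a)].
Proof.
move=> dp a0 ab.
have M1 (y : R) : y \in `]a, b[ -> is_derive y 1 p (p1 y).
  by rewrite in_itv/= => /andP[ay _]; apply: dp; exact: lt_trans ay.
have M2 : {within `[a, b], continuous p}.
  apply: derivable_within_continuous => y; rewrite in_itv/= => /andP[ay _].
  by have dpy := dp y (lt_le_trans a0 ay); exact: ex_derive.
have [c + E] := MVT ab M1 M2.
by rewrite in_itv/= => /andP[ac cb]; exists c.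
Qed.

Lemma nondecreasing_pos (p p1 : R -> R) : (forall x : R, 0 < x -> is_derive x 1 p (p1 x)) ->
  (forall x, 0 < x -> 0 <= p1 x) -> forall x y, 0 < x -> x <= y -> p x <= p y.
Proof.
move=> dp p10 x y x0; rewrite le_eqVlt => /predU1P[->//|xy].
have [c [xc cy E]] := MVT_pos dp x0 xy.
by rewrite -subr_ge0 E mulr_ge0 ?subr_ge0 ?(ltW xy)// p10// (lt_trans x0).
Qed.

Lemma nonincreasing_pos (p p1 : R -> R) : (forall x : R, 0 < x -> is_derive x 1 p (p1 x)) ->
  (forall x, 0 < x -> p1 x <= 0) -> forall x y, 0 < x -> x <= y -> p y <= p x.
Proof.
move=> dp p10 x y x0; rewrite le_eqVlt => /predU1P[->//|xy].
have [c [xc cy E]] := MVT_pos dp x0 xy.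
by rewrite -subr_le0 E mulr_le0_ge0 ?subr_ge0 ?(ltW xy)// p10// (lt_trans x0).
Qed.

(** The sign pattern of a Bernstein function at orders two and three, the latter expressed by
    monotonicity of [p2]. *)
Definition concave3 (p p1 p2 : R -> R) :=
  [/\ forall x : R, 0 < x -> is_derive x 1 p (p1 x),
      forall x : R, 0 < x -> is_derive x 1 p1 (p2 x),
      forall x, 0 < x -> p2 x <= 0 &
      forall x y, 0 < x -> x <= y -> p2 x <= p2 y].

Lemma bernstein_concave3 (p : R -> R) : bernstein p ->
  concave3 p (derive1 p) (derive1 (derive1 p)) /\
  (forall x, 0 < x -> 0 <= derive1 p x).
Proof.
move=> [_ dp sp].
have d (n : nat) (x : R) : 0 < x -> is_derive x 1 (derive1n n p) (derive1n n.+1 p x).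
  by move=> x0; exact: (DeriveDef (dp n x x0) (esym (derive1E _ _))).
have p1 x : 0 < x -> 0 <= derive1 p x.
  by move=> x0; have := sp 1%N x isT x0; rewrite expr2 mulrNN !mul1r.
have p2 x : 0 < x -> derive1 (derive1 p) x <= 0.
  move=> x0; have := sp 2%N x isT x0.
  by rewrite exprS expr2 mulrNN !mulr1 mulN1r oppr_ge0.
have p3 x : 0 < x -> 0 <= derive1n 3 p x.
  by move=> x0; have := sp 3%N x isT x0; rewrite -signr_odd mul1r.
split; last exact: p1.
split; [exact: (d 0%N)|exact: (d 1%N)|exact: p2|].
exact: (nondecreasing_pos (d 2%N) p3).
Qed.

(** Chord slopes decrease to the right, so a lower bound on the one unit chord from [b] serves every
    [[u, v]] before it. *)
Lemma concave3_slope_ge (p p1 p2 : R -> R) (u v b : R) : concave3 p p1 p2 ->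
  0 < u -> u <= v -> v <= b -> (v - u) * (p (b + 1) - p b) <= p v - p u.
Proof.
move=> [dp dp1 p20 _] u0; rewrite le_eqVlt => /predU1P[->|uv] vb.
  by rewrite !subrr mul0r.
have b0 : 0 < b by rewrite (lt_le_trans _ vb)// (lt_trans u0).
have [c [uc cv E]] := MVT_pos dp u0 uv.
have bb1 : b < b + 1 by rewrite ltrDl.
have [d [bd _ E']] := MVT_pos dp b0 bb1.
have -> : p (b + 1) - p b = p1 d by rewrite E'; ring.
rewrite E mulrC ler_wpM2r ?subr_ge0 ?(ltW uv)//.
apply: (nonincreasing_pos dp1 p20); first exact: lt_trans uc.
by rewrite (le_trans (ltW cv))// (le_trans vb)// ltW.
Qed.

Lemma concave3_deriv_ge (p p1 p2 : R -> R) (x : R) : concave3 p p1 p2 -> 0 < x ->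
  p (x + 1) - p x <= p1 x.
Proof.
move=> [dp dp1 p20 _] x0; have xx1 : x < x + 1 by rewrite ltrDl.
have [d [bd _ E']] := MVT_pos dp x0 xx1.
have -> : p (x + 1) - p x = p1 d by rewrite E'; ring.
by apply: (nonincreasing_pos dp1 p20) => //; exact: ltW.
Qed.

(** The chord over [[x / 2, x]] is at least as steep as the tangent at [x], and it involves values
    of [p] only. *)
Lemma concave3_deriv_le (p p1 p2 : R -> R) (x : R) : concave3 p p1 p2 -> 0 < x ->
  x * p1 x <= 2 * (p x - p (x / 2)).
Proof.
move=> [dp dp1 p20 _] x0; have x20 : 0 < x / 2 by rewrite divr_gt0.
have x2x : x / 2 < x by rewrite ltr_pdivrMr// ltr_pMr// ltr1n.
have [d [bd dx E]] := MVT_pos dp x20 x2x.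
have -> : 2 * (p x - p (x / 2)) = x * p1 d by rewrite E; field.
rewrite ler_pM2l//.
by apply: (nonincreasing_pos dp1 p20) => //; [exact: lt_trans bd|exact: ltW].
Qed.

(** Monotonicity of [p2] moves [y] back to a point [c] between [2 * d] and [3 * d], where
    [- p2 c * d] is a difference of first derivatives; the chords over [[d, 2 * d]] and
    [[3 * d, 4 * d]] bound these. The four sample points do not depend on [y]. *)
Lemma concave3_second_bound (p p1 p2 : R -> R) (d y : R) : concave3 p p1 p2 -> 0 < d ->
  3 * d <= y ->
  - p2 y * d ^+ 2 <= p (2 * d) - p d - (p (4 * d) - p (3 * d)).
Proof.
move=> [dp dp1 p20 p2n] d0 dy.
have d20 : 0 < 2 * d by rewrite mulr_gt0.
have d30 : 0 < 3 * d by rewrite mulr_gt0.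
have d12 : d < 2 * d by rewrite ltr_pMl// ltr1n.
have d23 : 2 * d < 3 * d by rewrite ltr_pM2r// ltr_nat.
have d34 : 3 * d < 4 * d by rewrite ltr_pM2r// ltr_nat.
have [c1 [dc1 c1d ->]] := MVT_pos dp d0 d12.
have [c2 [c2d _ ->]] := MVT_pos dp d30 d34.
have [c [c2' c3' E]] := MVT_pos dp1 d20 d23.
have c0 : 0 < c by rewrite (lt_trans d20).
have h1 : p1 (2 * d) <= p1 c1.
  by apply: (nonincreasing_pos dp1 p20); [exact: lt_trans dc1|exact: ltW].
have h2 : p1 c2 <= p1 (3 * d).
  by apply: (nonincreasing_pos dp1 p20) => //; exact: ltW.
have h3 : p2 c <= p2 y by apply: p2n => //; rewrite (le_trans (ltW c3')).
apply: (@le_trans _ _ (- p2 c * d ^+ 2)).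
  by rewrite ler_wpM2r ?sqr_ge0// lerN2.
have -> : - p2 c * d ^+ 2 = (p1 (2 * d) - p1 (3 * d)) * d.
  by rewrite -[p1 (2 * d) - _]opprB E; ring.
have -> : p1 c1 * (2 * d - d) - p1 c2 * (4 * d - 3 * d) = (p1 c1 - p1 c2) * d by ring.
by rewrite ler_pM2r// lerB.
Qed.

(* Derivatives of concave functions inherit pointwise convergence, because
   secant slopes on either side of a point trap the derivative there. *)
Lemma derivative_cvg (g g1 : nat -> R -> R) (G G1 : R -> R) (D : set R) (n0 : nat) :
  (forall n (x : R), (n0 <= n)%N -> 0 < x -> is_derive x 1 (g n) (g1 n x)) ->
  (forall n x y, (n0 <= n)%N -> 0 < x -> x <= y -> g1 n y <= g1 n x) ->
  (forall x : R, 0 < x -> is_derive x 1 G (G1 x)) ->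
  (forall x : R, 0 < x -> {for x, continuous G1}) ->
  (forall a b, 0 < a -> a < b -> exists d, [/\ D d, a < d & d < b]) ->
  (forall d, D d -> 0 < d -> g n d @[n --> \oo] --> G d) ->
  forall x, 0 < x -> g1 n x @[n --> \oo] --> G1 x.
Proof.
move=> dg g1n dG cG1 dD gG x x0; apply/cvgrPdist_lt => e e0.
have e20 : 0 < e / 2 by rewrite divr_gt0.
have /cvgrPdist_lt/(_ _ e20)/nbhs_ballP[r /= r0 rP] := cG1 x x0.
have G1near y : `|x - y| < r -> `|G1 x - G1 y| < e / 2 by exact: rP.
have slope a b : 0 < a -> a < b -> D a -> D b ->
    \forall n \near \oo, exists c, [/\ a < c, c < b &
      exists d, [/\ a < d, d < b & `|G1 c - g1 n d| < e / 2]].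
  move=> a0 ab Da Db; have b0 := lt_trans a0 ab.
  have ba0 : 0 < b - a by rewrite subr_gt0.
  have [c [ac cb Ec]] := MVT_pos dG a0 ab.
  have H : (g n b - g n a) / (b - a) @[n --> \oo] --> (G b - G a) / (b - a).
    apply: cvgM; last exact: cvg_cst.
    exact: (cvgB (gG b Db b0) (gG a Da a0)).
  have n0P : \forall n \near \oo, (n0 <= n)%N by exists n0.
  have /cvgrPdist_lt/(_ _ e20) := H; move: n0P; apply: filterS2 => n nn0.
  have [d [ad db Ed]] := MVT_pos (fun x => dg n x nn0) a0 ab.
  rewrite Ec Ed !mulfK ?gt_eqF// => Hn.
  by exists c; split => //; exists d.
(* The left chord lies beyond [l], hence in the half-axis and where [G1] is within [e / 2] of
   [G1 x]. *)
pose l := Num.max (x / 2) (x - r).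
have l0 : 0 < l by rewrite lt_max divr_gt0.
have lx : l < x by rewrite gt_max gtrBl r0 ltr_pdivrMr// ltr_pMr// ltr1n.
have lr : x - r <= l by rewrite le_max lexx orbT.
have [a1 [Da1 la1 a1x]] := dD l x l0 lx.
have a10 := lt_trans l0 la1.
have [b1 [Db1 ab1 b1x]] := dD a1 x a10 a1x.
have xr : x < x + r by rewrite ltrDl.
have [b2 [Db2 xb2 b2r]] := dD x (x + r) x0 xr.
have [a2 [Da2 xa2 ab2]] := dD x b2 x0 xb2.
have n0P : \forall n \near \oo, (n0 <= n)%N by exists n0.
move: (slope a1 b1 a10 ab1 Da1 Db1) (slope a2 b2 (lt_trans x0 xa2) ab2 Da2 Db2) n0P.
apply: filterS3 => n [c [ac cb [d [ad db H1]]]] [c' [ac' cb' [d' [ad' db' H2]]]] nn0.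
(* As [g1 n] decreases, its value at [x] lies between those at [d'] and [d], each within [e] of
   [G1 x] by way of [c'] and [c]. *)
have m1 : g1 n x <= g1 n d.
  by apply: g1n => //; [exact: lt_trans ad|exact: ltW (lt_trans db b1x)].
have m2 : g1 n d' <= g1 n x.
  by apply: g1n => //; exact: ltW (lt_trans xa2 ad').
have n1 : `|G1 x - G1 c| < e / 2.
  apply: G1near; rewrite ger0_norm ?subr_ge0 ?(ltW (lt_trans cb b1x))//.
  rewrite ltrBlDr -ltrBlDl (le_lt_trans lr)//.
  exact: lt_trans ac.
have n2 : `|G1 x - G1 c'| < e / 2.
  apply: G1near; rewrite distrC ger0_norm ?subr_ge0 ?(ltW (lt_trans xa2 ac'))//.
  by rewrite ltrBlDl; exact: lt_trans b2r.
move: H1 H2 n1 n2; rewrite !ltr_norml => /andP[h1 h2] /andP[h3 h4] /andP[h5 h6] /andP[h7 h8].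
apply/andP; split.
  move: m1 h2 h6 h1 h5; clear; lra.
move: m2 h3 h7 h4 h8; clear; lra.
Qed.

End RealLemmas.

(** * Limits at 0 from the right in the extended reals *)

Section LimitAtZero.
Context {R : realType}.
Local Notation C := R[i].

Lemma cvg_at_right0 (u : nat -> R) : (forall n, 0 < u n) ->
  u n @[n --> \oo] --> 0 -> u n @[n --> \oo] --> 0^'+.
Proof.
move=> u0 ul A; rewrite /at_right /within/= => /ul.
by rewrite /nbhs/=; apply: filterS => n /=; apply; exact: u0.
Qed.

(** Monotonicity makes the limit a supremum, hence an upper bound. General null sequences are
    allowed because the images of a sequence under the flow will be needed. *)
Lemma lim0_nonincreasing (f : C -> C) (a : R -> R) :
  (forall x, 0 < x -> f x%:C = (a x)%:C) ->
  (forall x y, 0 < x -> x <= y -> a y <= a x) ->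
  [/\ has_lim0 f, forall x, 0 < x -> ((a x)%:E <= lim0 f)%E &
    forall u : nat -> R, (forall n, 0 < u n) -> u n @[n --> \oo] --> 0 ->
      (a (u n))%:E @[n --> \oo] --> lim0 f].
Proof.
move=> fa mona.
pose g x : \bar R := (complex.Re (f x%:C))%:E.
have gE x : 0 < x -> g x = (a x)%:E by move=> x0; rewrite /g fa.
have cg : g x @[x --> 0^'+] --> ereal_sup (g @` `]0, +oo[).
  apply: (@nonincreasing_at_right_cvge _ g 0 +oo%O) => // x y.
  rewrite !in_itv/= !andbT => x0 y0 xy.
  by rewrite !gE// lee_fin mona.
have limE : lim0 f = ereal_sup (g @` `]0, +oo[) by exact: (cvg_lim _ cg).
split.
- split; first by move=> x x0; rewrite fa.
  by apply/cvg_ex; eexists; exact: cg.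
- move=> x x0; rewrite limE -gE//; apply: ereal_sup_ubound.
  by exists x => //=; rewrite in_itv/= x0.
- move=> u u0 ul; rewrite limE.
  have -> : (fun n => (a (u n))%:E) = g \o u.
    by apply/funext => n; rewrite /= gE.
  exact: (cvg_comp _ _ (cvg_at_right0 u0 ul) cg).
Qed.

Lemma lim0_nondecreasing (f : C -> C) (a : R -> R) :
  (forall x, 0 < x -> f x%:C = (a x)%:C) ->
  (forall x y, 0 < x -> x <= y -> a x <= a y) ->
  has_lim0 f /\
  forall u : nat -> R, (forall n, 0 < u n) -> u n @[n --> \oo] --> 0 ->
    (a (u n))%:E @[n --> \oo] --> lim0 f.
Proof.
move=> fa mona.
pose g x : \bar R := (complex.Re (f x%:C))%:E.
have gE x : 0 < x -> g x = (a x)%:E by move=> x0; rewrite /g fa.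
have cg : g x @[x --> 0^'+] --> ereal_inf (g @` `]0, +oo[).
  apply: (@nondecreasing_at_right_cvge _ g 0 +oo%O) => // x y.
  rewrite !in_itv/= !andbT => x0 y0 xy.
  by rewrite !gE// lee_fin mona.
have limE : lim0 f = ereal_inf (g @` `]0, +oo[) by exact: (cvg_lim _ cg).
split.
- split; first by move=> x x0; rewrite fa.
  by apply/cvg_ex; eexists; exact: cg.
- move=> u u0 ul; rewrite limE.
  have -> : (fun n => (a (u n))%:E) = g \o u.
    by apply/funext => n; rewrite /= gE.
  exact: (cvg_comp _ _ (cvg_at_right0 u0 ul) cg).
Qed.

(* The bounds [a n <= A], [b n <= B] make this hold in the cases [0 * +oo] too. *)
Lemma cvge_mul_bounded (a b : nat -> R) (A B : \bar R) :
  (forall n, 0 <= a n) -> (forall n, 0 <= b n) ->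
  (forall n, ((a n)%:E <= A)%E) -> (forall n, ((b n)%:E <= B)%E) ->
  (a n)%:E @[n --> \oo] --> A -> (b n)%:E @[n --> \oo] --> B ->
  (a n * b n)%:E @[n --> \oo] --> (A * B)%E.
Proof.
move=> a0 b0 aA bB ca cb.
have A0 : (0 <= A)%E by apply: le_trans (aA 0%N); rewrite lee_fin.
have B0 : (0 <= B)%E by apply: le_trans (bB 0%N); rewrite lee_fin.
have [AE|An0] := eqVneq A 0%E.
  have aE n : a n = 0.
    by apply/le_anti; rewrite a0 andbT -lee_fin; move: (aA n); rewrite AE.
  rewrite AE mul0e; under eq_fun do rewrite aE mul0r.
  exact: cvg_cst.
have [BE|Bn0] := eqVneq B 0%E.
  have bE n : b n = 0.
    by apply/le_anti; rewrite b0 andbT -lee_fin; move: (bB n); rewrite BE.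
  rewrite BE mule0; under eq_fun do rewrite bE mulr0.
  exact: cvg_cst.
under eq_fun do rewrite EFinM.
apply: cvgeM => //.
by rewrite mule_defE (negPf An0) (negPf Bn0).
Qed.

End LimitAtZero.

(** * The evolution family on the positive axis *)

Section Flow.
Context {R : realType}.
Local Notation C := R[i].
Local Notation N := (@Normc.normc R).
Local Notation mu := (@lebesgue_measure R).
Local Notation cmu := (@completed_lebesgue_measure R).
Context (T : \bar R) (I : set R) (w : R -> R -> C -> C) (p : R -> R -> R -> R).
Context (hI : time_interval T I) (hw : ac_evolution_family I w).
Context (hp : forall s t, I s -> I t -> s <= t ->
  bernstein (p s t) /\ forall x, 0 < x -> w s t x%:C = (p s t x)%:C).

Local Notation p1 s t := (derive1 (p s t)).
Local Notation p2 s t := (derive1 (derive1 (p s t))).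

Lemma time_interval_ge0 s : I s -> 0 <= s.
Proof. by move: hI => [_ [[_ ->]|->]] []. Qed.

Lemma time_interval_between s t : I t -> 0 <= s -> s <= t -> I s.
Proof.
by move: hI => [_ [[_ ->]|->]] [t0 tT] s0 st; split => //;
  [apply: le_trans tT|apply: le_lt_trans tT]; rewrite lee_fin.
Qed.

Lemma flow_gt0 s t x : I s -> I t -> s <= t -> 0 < x -> 0 < p s t x.
Proof.
move=> Is It st x0; have [hol _ _ _] := hw.
have := (hol s t Is It st).2 x%:C x0.
by rewrite (hp Is It st).2.
Qed.

Lemma flow_id s x : I s -> 0 < x -> p s s x = x.
Proof.
move=> Is x0; have [_ h _ _] := hw.
by have := h s x%:C Is x0; rewrite (hp Is Is (lexx s)).2// => -[].
Qed.

Lemma flow_comp s t u x : I s -> I t -> I u -> s <= t -> t <= u -> 0 < x ->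
  p s u x = p t u (p s t x).
Proof.
move=> Is It Iu st tu x0; have [_ _ h _] := hw.
have := h s t u x%:C Is It Iu st tu x0.
rewrite (hp Is Iu (le_trans st tu)).2// (hp Is It st).2//.
by rewrite (hp It Iu tu).2 ?flow_gt0// => -[].
Qed.

Lemma flow_concave3 s t : I s -> I t -> s <= t ->
  concave3 (p s t) (p1 s t) (p2 s t).
Proof. by move=> Is It st; have [] := bernstein_concave3 (hp Is It st).1. Qed.

Lemma flow_deriv_ge0 s t x : I s -> I t -> s <= t -> 0 < x -> 0 <= p1 s t x.
Proof. by move=> Is It st x0; have [_] := bernstein_concave3 (hp Is It st).1; exact. Qed.

(** The integrable bound of the evolution family at [x] does not depend on the starting time [s],
    hence neither does [g]. *)
Lemma flow_majorant t0 x : I t0 -> 0 < x -> exists2 g : R -> R, ge0_integrable g &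
  forall s t u, 0 <= s -> s <= t -> t <= u -> u <= t0 ->
    `|p s u x - p s t x| <= primitive g u - primitive g t.
Proof.
move=> It0 x0; have [_ _ _ /(_ x%:C x0)[f [f0 [mf fi] fP]]] := hw.
have Ib r : 0 <= r -> r <= t0 -> I r by move=> *; exact: time_interval_between It0 _ _.
have sub : `[0, t0] `<=` I.
  by move=> r; rewrite /= in_itv/= => /andP[r0 rt]; exact: Ib.
have [g [gi gP]] := completed_integral_primitive
  (fun r (rP : 0 <= r <= t0) => f0 r (Ib r (andP rP).1 (andP rP).2)) (fi _ _ sub).
exists g => // s t u s0 st tu ut0.
have t0' := le_trans s0 st; have u0 := le_trans t0' tu.
have Is := Ib s s0 (le_trans st (le_trans tu ut0)).
have It := Ib t t0' (le_trans tu ut0); have Iu := Ib u u0 ut0.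
have := fP s t u Is It Iu st tu.
rewrite (hp Is Iu (le_trans st tu)).2// (hp Is It st).2// -rmorphB normc_real.
by rewrite gP// lee_fin.
Qed.

(** At a fixed point one primitive controls all the maps [p t u], uniformly in [t]; the later
    estimates are reduced to finitely many such points. *)
Lemma flow_displacement t0 x : I t0 -> 0 < x -> exists2 g : R -> R, ge0_integrable g &
  forall t u, 0 <= t -> t <= u -> u <= t0 ->
    `|p t u x - x| <= primitive g u - primitive g t.
Proof.
move=> It0 x0; have [g gi gP] := flow_majorant It0 x0; exists g => // t u t_ge0 tu ut0.
have It : I t by exact: time_interval_between It0 _ (le_trans tu ut0).
by have := gP t t u t_ge0 (lexx t) tu ut0; rewrite flow_id.
Qed.

Lemma is_derive_pos (f g : R -> R) (x l : R) : 0 < x ->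
  (forall y, 0 < y -> f y = g y) -> is_derive x 1 f l -> is_derive x 1 g l.
Proof.
move=> x0 fg; apply: near_eq_is_derive; near=> y; apply: fg.
by near: y; exact: lt_nbhsr.
Unshelve. all: by end_near. Qed.

Lemma is_derive_derive1 (f : R -> R) (x l : R) : is_derive x 1 f l -> derive1 f x = l.
Proof. by move=> [_ <-]; rewrite derive1E. Qed.

Lemma flow_chain1 s t u x : I s -> I t -> I u -> s <= t -> t <= u -> 0 < x ->
  p1 s u x = p1 t u (p s t x) * p1 s t x.
Proof.
move=> Is It Iu st tu x0.
have [d1 _ _ _] := flow_concave3 Is It st; have [d2 _ _ _] := flow_concave3 It Iu tu.
have dc := @is_derive1_comp _ (p t u) (p s t) x _ _ (d2 _ (flow_gt0 Is It st x0)) (d1 x x0).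
exact: (is_derive_derive1
  (is_derive_pos x0 (fun y y0 => esym (flow_comp Is It Iu st tu y0)) dc)).
Qed.

Lemma flow_chain2 s t u x : I s -> I t -> I u -> s <= t -> t <= u -> 0 < x ->
  p2 s u x = p2 t u (p s t x) * p1 s t x ^+ 2 + p1 t u (p s t x) * p2 s t x.
Proof.
move=> Is It Iu st tu x0.
have [d1 d1' _ _] := flow_concave3 Is It st; have [d2 d2' _ _] := flow_concave3 It Iu tu.
have dc := @is_derive1_comp _ (p1 t u) (p s t) x _ _ (d2' _ (flow_gt0 Is It st x0)) (d1 x x0).
have dm := is_deriveM dc (d1' x x0).
rewrite (is_derive_derive1
  (is_derive_pos x0 (fun y y0 => esym (flow_chain1 Is It Iu st tu y0)) dm)).
by rewrite /GRing.scale/= addrC mulrCA -expr2.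
Qed.

Lemma flow_continuous s t0 x : I s -> I t0 -> s <= t0 -> 0 < x ->
  continuous (fun t => p s (clamp s t0 t) x).
Proof.
move=> Is It0 st0 x0; have [g gi gP] := flow_majorant It0 x0.
apply: (dominated_continuous gi st0) => t u tu.
have [c1 c2 c3 _] := clamp_bounds st0 tu.
by apply: gP => //; exact: time_interval_ge0.
Qed.

Lemma flow_bounds s t0 x : I s -> I t0 -> s <= t0 -> 0 < x ->
  exists m M, 0 < m /\ forall t, s <= t <= t0 -> m <= p s t x <= M.
Proof.
move=> Is It0 st0 x0; have cf := flow_continuous Is It0 st0 x0.
have [a a_ aP] := EVT_min st0 (continuous_subspaceT cf).
have [b b_ bP] := EVT_max st0 (continuous_subspaceT cf).
exists (p s (clamp s t0 a) x), (p s (clamp s t0 b) x); split.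
  move: a_; rewrite in_itv/= => /andP[sa at0]; rewrite clamp_id//.
  apply: flow_gt0 => //.
  exact: time_interval_between It0 (le_trans (time_interval_ge0 Is) sa) at0.
move=> t /andP[st tt0].
have := aP t; have := bP t; rewrite in_itv/= st tt0 (clamp_id st tt0).
by move=> /(_ isT) -> /(_ isT) ->.
Qed.

(** Let [M] bound the trajectory of [x2]. Over a short step [M] and [M + 1] each move by less than
    [1 / 4], so the unit chord from [M] keeps a slope above [1 / 2], and by concavity chords to its
    left are at least as steep. Finitely many steps of length at most [r] reach [t0]. *)
Lemma flow_lt s t0 x1 x2 : I s -> I t0 -> s <= t0 -> 0 < x1 -> x1 < x2 ->
  p s t0 x1 < p s t0 x2.
Proof.
move=> Is It0 st0 x10 x12; have x20 := lt_trans x10 x12.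
have s0 := time_interval_ge0 Is.
have Ib r : s <= r -> r <= t0 -> I r.
  by move=> sr rt0; exact: time_interval_between It0 (le_trans s0 sr) rt0.
have [m [M [m0 mM]]] := flow_bounds Is It0 st0 x20.
have M0 : 0 < M.
  have /andP[h1 h2] := mM s (ltac:(by rewrite lexx)); exact: lt_le_trans m0 (le_trans h1 h2).
have M10 : 0 < M + 1 by rewrite addr_gt0.
have [g gi gP] := flow_displacement It0 M0; have [h hi hP] := flow_displacement It0 M10.
have [d d0 dP] := primitive_uniform_continuous gi (ltac:(by rewrite divr_gt0) : 0 < 1 / 4 :> R).
have [e e0 eP] := primitive_uniform_continuous hi (ltac:(by rewrite divr_gt0) : 0 < 1 / 4 :> R).
pose D t := p s t x2 - p s t x1.
pose r := Num.min d e / 2.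
have r0 : 0 < r by rewrite divr_gt0// lt_min d0.
have rm : r < Num.min d e.
  by rewrite ltr_pdivrMr// ltr_pMr ?ltr1n// lt_min d0.
have /andP[rd re] : (r < d) && (r < e) by rewrite -lt_min.
have step t u : s <= t -> t <= u -> u <= t0 -> u - t <= r -> 0 < D t -> 0 < D u.
  move=> st tu ut0 utr Dt.
  have It := Ib t st (le_trans tu ut0); have Iu := Ib u (le_trans st tu) ut0.
  have t_ge0 := le_trans s0 st.
  rewrite /D (flow_comp Is It Iu st tu x20) (flow_comp Is It Iu st tu x10).
  have /andP[_ yM] := mM t (ltac:(by rewrite st (le_trans tu))).
  have y12 : p s t x1 <= p s t x2 by rewrite -subr_ge0 ltW.
  have := concave3_slope_ge (flow_concave3 It Iu tu) (flow_gt0 Is It st x10) y12 yM.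
  apply: lt_le_trans; rewrite mulr_gt0//.
  have h1 := le_lt_trans (gP t u t_ge0 tu ut0) (dP t u tu (le_lt_trans utr rd)).
  have h2 := le_lt_trans (hP t u t_ge0 tu ut0) (eP t u tu (le_lt_trans utr re)).
  move: h1 h2; rewrite !ltr_norml => /andP[h1 h2] /andP[h3 h4].
  by move: h2 h3; set a := p t u M; set b := p t u (M + 1); clear; lra.
have all n : forall u, s <= u -> u <= t0 -> u - s <= n%:R * r -> 0 < D u.
  elim: n => [|n IH] u su ut0.
    rewrite mul0r subr_le0 => us; have -> : u = s by apply/le_anti; rewrite us su.
    by rewrite /D !flow_id// subr_gt0.
  move=> usn; have [usr|rus] := leP (u - s) r.
    apply: (step s u) => //.
    by rewrite /D !flow_id// subr_gt0.
  have st : s <= u - r by rewrite lerBrDr -lerBrDl ltW.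
  have tu : u - r <= u by rewrite gerBl ltW.
  apply: (step (u - r) u) => //; first by rewrite opprB addrC subrK.
  apply: IH => //; first exact: le_trans tu ut0.
  by move: usn; rewrite -natr1 mulrDl mul1r => usn; rewrite addrAC lerBlDr.
rewrite -subr_gt0; apply: (all (Num.bound ((t0 - s) / r))) => //.
rewrite -ler_pdivrMr// ltW// archi_boundP// divr_ge0 ?subr_ge0// ltW//.
Qed.

Lemma flow_deriv_gt0 s t x : I s -> I t -> s <= t -> 0 < x -> 0 < p1 s t x.
Proof.
move=> Is It st x0; apply: lt_le_trans (concave3_deriv_ge (flow_concave3 Is It st) x0).
by rewrite subr_gt0 flow_lt// ltrDl.
Qed.

(** The increment over [[x, x + 1]] bounds the derivative from below, is positive by [flow_lt] and
    is continuous in [t], so its minimum over [[s, t0]] works. *)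
Lemma flow_deriv_lower s t0 x : I s -> I t0 -> s <= t0 -> 0 < x ->
  exists2 c, 0 < c & forall t, s <= t <= t0 -> c <= p1 s t x.
Proof.
move=> Is It0 st0 x0; have x10 : 0 < x + 1 by rewrite addr_gt0.
have Ib r : s <= r -> r <= t0 -> I r.
  by move=> sr rt0; exact: time_interval_between It0 (le_trans (time_interval_ge0 Is) sr) rt0.
have cD : continuous (fun t => p s (clamp s t0 t) (x + 1) - p s (clamp s t0 t) x).
  move=> t; apply: cvgB.
    exact: (flow_continuous Is It0 st0 x10).
  exact: (flow_continuous Is It0 st0 x0).
have [a a_ aP] := EVT_min st0 (continuous_subspaceT cD).
move: a_; rewrite in_itv/= => /andP[sa at0].
exists (p s (clamp s t0 a) (x + 1) - p s (clamp s t0 a) x).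
  by rewrite clamp_id// subr_gt0 flow_lt ?ltrDl//; exact: Ib.
move=> t /andP[st tt0].
apply: le_trans (concave3_deriv_ge (flow_concave3 Is (Ib t st tt0) st) x0).
by have := aP t; rewrite in_itv/= st tt0 (clamp_id st tt0); apply.
Qed.

Lemma flow_second_id s x : I s -> 0 < x -> p1 s s x = 1 /\ p2 s s x = 0.
Proof.
move=> Is x0.
have d1 y : 0 < y -> p1 s s y = 1.
  move=> y0; apply: is_derive_derive1.
  exact: (is_derive_pos y0 (fun z z0 => esym (flow_id Is z0)) (is_derive_id y 1)).
split; first exact: d1.
apply: is_derive_derive1.
exact: (is_derive_pos (f := cst 1) x0 (fun z z0 => esym (d1 z z0)) (is_derive_cst _ _ _)).
Qed.

(* By the chain rule this quantity is additive along the flow: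
   [curvature s x u - curvature s x t] only involves [p t u] at [p s t x]. *)
Definition curvature s x t := - p2 s t x / p1 s t x.

Lemma curvatureB s t u x : I s -> I t -> I u -> s <= t -> t <= u -> 0 < x ->
  curvature s x u - curvature s x t =
  - p2 t u (p s t x) / p1 t u (p s t x) * p1 s t x.
Proof.
move=> Is It Iu st tu x0; rewrite /curvature.
have a0 := flow_deriv_gt0 Is It st x0.
have b0 := flow_deriv_gt0 It Iu tu (flow_gt0 Is It st x0).
rewrite (flow_chain2 Is It Iu st tu x0) (flow_chain1 Is It Iu st tu x0).
move: a0 b0; move: (p1 s t x) (p2 s t x) (p1 t u _) (p2 t u _) => a a' b b' a0 b0.
by field; rewrite !gt_eqF.
Qed.

(** With [y = p s t x] the increment equals [- p2 t u y * p1 s t x ^+ 2 / p1 s u x]. The first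
    derivatives are bounded above and away from 0 along the trajectory, and [concave3_second_bound]
    reduces [- p2 t u y] to displacements of four fixed points. *)
Lemma curvature_dominated s t0 x : I s -> I t0 -> s <= t0 -> 0 < x ->
  exists2 g : R -> R, ge0_integrable g & forall t u, s <= t -> t <= u -> u <= t0 ->
    0 <= curvature s x u - curvature s x t <= primitive g u - primitive g t.
Proof.
move=> Is It0 st0 x0; have s0 := time_interval_ge0 Is.
have Ib r : s <= r -> r <= t0 -> I r.
  by move=> sr rt0; exact: time_interval_between It0 (le_trans s0 sr) rt0.
have [m [M [m0 mM]]] := flow_bounds Is It0 st0 x0.
have [c c0 cP] := flow_deriv_lower Is It0 st0 x0.
have M0 : 0 < M.
  have /andP[h1 h2] := mM s (ltac:(by rewrite lexx)); exact: lt_le_trans m0 (le_trans h1 h2).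
(* Then [3 * d = m] lies below the whole trajectory, as [concave3_second_bound] requires. *)
pose d := m / 3.
have d0 : 0 < d by rewrite divr_gt0.
have dm : 3 * d = m by rewrite /d; field.
have pos k : (0 < k)%N -> 0 < k%:R * d by move=> k0; rewrite mulr_gt0// ltr0n.
have [g1 g1i g1P] := flow_displacement It0 (pos 1%N isT).
have [g2 g2i g2P] := flow_displacement It0 (pos 2%N isT).
have [g3 g3i g3P] := flow_displacement It0 (pos 3%N isT).
have [g4 g4i g4P] := flow_displacement It0 (pos 4%N isT).
have [g12i g12E] := ge0_integrableD g1i g2i.
have [g34i g34E] := ge0_integrableD g3i g4i.
have [gi gE] := ge0_integrableD g12i g34i.
(* [2 * M / x] bounds [p1 s t x] from above, [c] bounds [p1 s u x] from below, and [d ^+ 2] comes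
   from the bound on the second derivative. *)
pose K := (2 * M / x) ^+ 2 / c / d ^+ 2.
have K0 : 0 <= K by rewrite !divr_ge0 ?sqr_ge0// ltW.
have [hi hE] := ge0_integrableZ K0 gi.
eexists; first exact: hi.
move=> t u st tu ut0; have t_ge0 := le_trans s0 st.
have It := Ib t st (le_trans tu ut0); have Iu := Ib u (le_trans st tu) ut0.
have y0 := flow_gt0 Is It st x0.
set y := p s t x in y0 *.
have cc := flow_concave3 It Iu tu; have [_ _ p2n _] := cc.
have a0 := flow_deriv_gt0 Is It st x0.
have b0 := flow_deriv_gt0 It Iu tu y0.
have /andP[ym yM] := mM t (ltac:(by rewrite st (le_trans tu))).
rewrite curvatureB// -/y; apply/andP; split.
  by rewrite mulr_ge0 ?(ltW a0)// divr_ge0 ?(ltW b0)// oppr_ge0; exact: p2n.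
have aM : p1 s t x <= 2 * M / x.
  rewrite ler_pdivlMr// mulrC.
  apply: le_trans (concave3_deriv_le (flow_concave3 Is It st) x0) _.
  rewrite ler_pM2l// lerBlDr (le_trans yM)// lerDl ltW//.
  by apply: flow_gt0 => //; rewrite divr_gt0.
have ab : c <= p1 t u y * p1 s t x.
  by rewrite /y -flow_chain1// cP// (le_trans st tu).
have -> : - p2 t u y / p1 t u y * p1 s t x =
    - p2 t u y * (p1 s t x ^+ 2 / (p1 t u y * p1 s t x)).
  by move: a0 b0; move: (p1 s t x) (p1 t u y) (p2 t u y) => a b b' a0 b0; field; rewrite !gt_eqF.
have q0 : 0 <= - p2 t u y by rewrite oppr_ge0; exact: p2n.
have fac : p1 s t x ^+ 2 / (p1 t u y * p1 s t x) <= (2 * M / x) ^+ 2 / c.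
  apply: ler_pM; rewrite ?sqr_ge0 ?invr_ge0 ?mulr_ge0 ?(ltW a0) ?(ltW b0)//.
    by rewrite lerXn2r// nnegrE ?(ltW a0)// (le_trans (ltW a0)).
  by rewrite lef_pV2// posrE// mulr_gt0.
apply: le_trans (ler_wpM2l q0 fac) _.
have sb := concave3_second_bound cc d0 (ltac:(by rewrite dm) : 3 * d <= y).
rewrite !hE !gE !g12E !g34E -mulrBr.
have -> : - p2 t u y * ((2 * M / x) ^+ 2 / c) = K * (- p2 t u y * d ^+ 2).
  by rewrite /K; move: (p2 t u y) => b'; field; rewrite !gt_eqF.
rewrite ler_wpM2l//; apply: le_trans sb _.
have := g1P t u t_ge0 tu ut0; have := g2P t u t_ge0 tu ut0.
have := g3P t u t_ge0 tu ut0; have := g4P t u t_ge0 tu ut0; rewrite mul1r.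
(* The two chords have equal length, so the identity cancels and only displacements remain. *)
have -> : p t u (2 * d) - p t u d - (p t u (4 * d) - p t u (3 * d)) =
  (p t u (2 * d) - 2 * d) - (p t u d - d) - (p t u (4 * d) - 4 * d) + (p t u (3 * d) - 3 * d).
  by ring.
rewrite !ler_norml => /andP[h1 h1'] /andP[h2 h2'] /andP[h3 h3'] /andP[h4 h4'].
have -> (a b c' e a' b' c'' e' : R) : a + b + (c' + e) - (a' + b' + (c'' + e')) =
   (b - b') + (a - a') + (e - e') + (c' - c'') by ring.
have lN (v r : R) : - r <= v -> - v <= r by rewrite lerNl.
exact: (lerD (lerD (lerD h3' (lN _ _ h4)) (lN _ _ h1)) h2').
Qed.
Lemma time_derivative_real (g : R -> C) (q : nat -> R) (q0 t : R) (l : C) (n0 : nat) :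
  (forall n, (n0 <= n)%N -> g (t + n.+1%:R^-1) = (q n)%:C) -> g t = q0%:C ->
  has_time_derivative g t l ->
  (n.+1%:R * (q n - q0) @[n --> \oo] --> complex.Re l) /\ complex.Im l = 0.
Proof.
move=> gq gq0 /cvgCP gl.
have key e : 0 < e -> \forall n \near \oo, N ((n.+1%:R * (q n - q0))%:C - l) < e.
  move=> e0; have := harmonic_dnbhs0 (gl e e0).
  have n0P : \forall n \near \oo, (n0 <= n)%N by exists n0.
  rewrite /nbhs/=; move: n0P; apply: filterS2 => n n0n /=.
  rewrite gq// gq0 -rmorphB -fmorphV -rmorphM/= invrK mulrC.
  by rewrite mulrC.
split.
  apply/cvgrPdist_lt => e /key; apply: filterS => n; apply: le_lt_trans.
  by rewrite distrC; apply: le_trans (ler_Re_normc _); rewrite raddfB.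
apply/eqP; rewrite -normr_eq0 eq_le normr_ge0 andbT.
apply/ler_addgt0Pl => e /key [n _ /(_ n (leqnn n))]; rewrite addr0.
move=> /(le_lt_trans (ler_Im_normc _)); rewrite raddfB/= sub0r normrN.
exact: ltW.
Qed.

Lemma harmonic_time t : 0 <= t -> (t%:E < T)%E ->
  exists n0, forall n, (n0 <= n)%N -> I (t + n.+1%:R^-1).
Proof.
move=> t0 tT.
have [e e0 eP] : exists2 e : R, 0 < e & forall h, 0 < h -> h < e -> I (t + h).
  case: T tT hI => [r| |]// tT HI.
    rewrite lte_fin in tT; exists (r - t); first by rewrite subr_gt0.
    move=> h h0 hrt; move: HI => [_ [[_ ->]|->]]; split; rewrite ?addr_ge0 ?(ltW h0)//.
      by rewrite lee_fin addrC -lerBrDr ltW.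
    by rewrite lte_fin addrC -ltrBrDr.
  exists 1 => // h h0 _; move: HI => [_ [[//]|->]]; split.
    by rewrite addr_ge0// ltW.
  exact: ltry.
have [n0 _ n0P] := near_infty_natSinv_lt (PosNum e0).
by exists n0 => n /n0P /= ne; apply: eP => //; rewrite invr_gt0.
Qed.

(** * The vector field at almost every time *)

Context (phi : C -> R -> C) (hphi : associated_vector_field T I w phi).

Definition real_field (xi y : R) : R := complex.Re (phi y%:C xi).

(** Time 0 is excluded to leave room for earlier starting times, and [T] so that [xi + n.+1%:R^-1]
    eventually lies in [I]. [D] will consist of the positions at time [xi] of countably many
    trajectories. *)
Definition regular_time (xi : R) : Prop :=
  [/\ 0 < xi, (xi%:E < T)%E,
      forall y, 0 < y -> phi y%:C xi = (real_field xi y)%:C &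
      exists2 D : set R,
        (forall a b, 0 < a -> a < b -> exists d, [/\ D d, a < d & d < b]) &
        forall d, D d -> 0 < d ->
          n.+1%:R * (p xi (xi + n.+1%:R^-1) d - d) @[n --> \oo] --> - real_field xi d].

(** Trajectories with rational starting data are countably many and share one null set. One that
    starts shortly before [xi] has moved little, so their positions at time [xi] are dense;
    [flow_comp] turns the time derivative at such a position [d] into that of [p xi] at [d]. *)
Lemma ae_regular_time : {ae cmu, forall xi, I xi -> regular_time xi}.
Proof.
have FF := ae_filter_ringOfSetsType cmu.
pose q n : rat * rat := odflt (0, 0) (unpickle n).
pose s n : R := ratr (q n).1; pose x n : R := ratr (q n).2.
have ae1 : {ae cmu, forall xi, forall n, 0 <= s n -> ((s n)%:E < T)%E -> 0 < x n ->
    I xi -> s n <= xi -> exists2 dw, has_time_derivative (fun r => w (s n) r (x n)%:C) xi dw &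
      dw + phi (w (s n) xi (x n)%:C) xi = 0}.
  apply/ae_foralln => n.
  have [[s0 sT x0]|nsx] := pselect [/\ 0 <= s n, ((s n)%:E < T)%E & 0 < x n].
    have [_ /(_ (x n)%:C (s n) x0 s0 sT)[_ h _]] := hphi.
    by move: h; apply: filterS => xi h _ _ _.
  by apply: nearW => xi s0 sT x0; case: nsx.
have n0 : {ae cmu, forall xi, xi <> 0 :> R}.
  apply/ae_completedP; exists [set 0]; split => //; first exact: lebesgue_measure_set1.
  by move=> y /= /contrapT.
have nT : {ae cmu, forall xi, xi%:E <> T}.
  apply/ae_completedP; exists [set fine T]; split => //; first exact: lebesgue_measure_set1.
  by move=> y /= /contrapT <-.
move: ae1 n0 nT; apply: filterS3 => xi H xi0 xiT Ixi.
have xi_gt0 : 0 < xi by rewrite lt_neqAle (time_interval_ge0 Ixi) andbT eq_sym; apply/eqP.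
have xi_T : (xi%:E < T)%E.
  rewrite lt_neqAle; apply/andP; split; first exact/eqP.
  by move: hI Ixi => [_ [[_ ->]|->]] [_]//; exact: ltW.
pose D := [set d | exists n, [/\ 0 <= s n, s n < xi, 0 < x n & d = p (s n) xi (x n)]].
have Is n : 0 <= s n -> s n < xi -> I (s n).
  by move=> s0 sxi; exact: time_interval_between Ixi s0 (ltW sxi).
have [n0 n0P] := harmonic_time (ltW xi_gt0) xi_T.
have Dd d : D d -> 0 < d -> phi d%:C xi = (real_field xi d)%:C /\
    n.+1%:R * (p xi (xi + n.+1%:R^-1) d - d) @[n --> \oo] --> - real_field xi d.
  move=> [n [s0 sxi x0 dE]] d0.
  have sT : ((s n)%:E < T)%E by apply: lt_trans xi_T; rewrite lte_fin.
  have [dw dwP dwphi] := H n s0 sT x0 Ixi (ltW sxi).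
  have xile m : xi <= xi + m.+1%:R^-1 by rewrite lerDl invr_ge0.
  have gq m : (n0 <= m)%N -> w (s n) (xi + m.+1%:R^-1) (x n)%:C = (p xi (xi + m.+1%:R^-1) d)%:C.
    move=> /n0P Iu; rewrite (hp (Is n s0 sxi) Iu (le_trans (ltW sxi) (xile m))).2//.
    by rewrite (flow_comp (Is n s0 sxi) Ixi Iu (ltW sxi) (xile m) x0) -dE.
  have wd : w (s n) xi (x n)%:C = d%:C by rewrite (hp (Is n s0 sxi) Ixi (ltW sxi)).2// dE.
  have [cR cI] := time_derivative_real gq wd dwP.
  have dwE : dw = - phi d%:C xi by apply/eqP; rewrite -addr_eq0 -wd dwphi.
  split; last by rewrite /real_field -raddfN -dwE.
  move: cI; rewrite dwE /real_field; case: (phi d%:C xi) => a b /= /eqP.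
  by rewrite oppr_eq0 => /eqP ->.
have Dp d : D d -> 0 < d.
  by move=> [n [s0 sxi x0 ->]]; exact: (flow_gt0 (Is n s0 sxi) Ixi (ltW sxi) x0).
have dense a b : 0 < a -> a < b -> exists d, [/\ D d, a < d & d < b].
  move=> a0 ab; have [y] := rat_in_itvoo ab; rewrite in_itv/= => /andP[ay yb].
  have y0 : 0 < ratr y :> R by exact: lt_trans ay.
  have [g gi gP] := flow_displacement Ixi y0.
  have m0 : 0 < Num.min (ratr y - a) (b - ratr y) by rewrite lt_min !subr_gt0 ay.
  have [e e0 eP] := primitive_uniform_continuous gi m0.
  have lxi : Num.max 0 (xi - e) < xi by rewrite gt_max xi_gt0 gtrBl.
  have [r] := rat_in_itvoo lxi; rewrite in_itv/= gt_max => /andP[/andP[r0 re] rxi].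
  have qE : q (pickle (r, y)) = (r, y) by rewrite /q pickleK.
  exists (p (ratr r) xi (ratr y)).
  have := le_lt_trans (gP _ _ (ltW r0) (ltW rxi) (lexx _)) (eP _ _ (ltW rxi) _).
  rewrite ltrBlDr -ltrBlDl => /(_ re); rewrite lt_min => /andP[h1 h2].
  split.
  - exists (pickle (r, y)); split; rewrite /s /x ?qE//=.
    exact: ltW.
  - by move: h1; rewrite ltr_distl subKr => /andP[].
  - by move: h2; rewrite ltr_distl [_ + (b - _)]addrC subrK => /andP[].
split=> //; last by exists D => // d Dd' d0; have [] := Dd d Dd' d0.
move=> y y0.
have [gen _ _] := hphi.1; have [[dphi _] _] := gen xi Ixi.
(* The field is known to be real on [D]; density and continuity in space extend this to the whole
   half-axis. *)
suff Im0 : complex.Im (phi y%:C xi) = 0.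
  by move: Im0; rewrite /real_field; case: (phi y%:C xi) => a b /= ->.
apply/eqP/negPn/negP => Imn; have Im0 : 0 < `|complex.Im (phi y%:C xi)| by rewrite normr_gt0.
have cy : {for y%:C, continuous (phi^~ xi)}.
  by apply: differentiable_continuous; apply/derivable1_diffP; exact: dphi.
have [e e0 eP] := (nbhsCP _ _).1 ((cvgCP _ _ _).1 cy _ Im0).
have a0 : 0 < Num.max (y / 2) (y - e) by rewrite lt_max divr_gt0.
have ab : Num.max (y / 2) (y - e) < y + e.
  rewrite gt_max ltrD2l gtrN// andbT.
  by rewrite ltr_pdivrMr// mulrDl ltr_wpDr ?mulr_ge0 ?(ltW e0)// ltr_pMr// ltr1n.
have [d [Dd' + db]] := dense _ _ a0 ab; rewrite gt_max => /andP[_ ad].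
have dy : N (d%:C - y%:C) < e by rewrite -rmorphB normc_real ltr_distl ad.
have := le_lt_trans (ler_Im_normc _) (eP _ dy).
by rewrite raddfB/= (Dd d Dd' (Dp d Dd')).1/= sub0r normrN ltxx.
Qed.
Lemma cvg_opp (f : nat -> R) (l : R) :
  - f n @[n --> \oo] --> - l -> f n @[n --> \oo] --> l.
Proof.
move=> /cvgrPdist_lt H; apply/cvgrPdist_lt => e /H; apply: filterS => n.
by rewrite -opprD normrN.
Qed.

Lemma field_trace xi : I xi -> regular_time xi ->
  let psi := real_field xi in
  [/\ forall x : R, 0 < x -> is_derive x 1 psi (derive1 psi x),
      forall x : R, 0 < x -> is_derive x 1 (derive1 psi) (derive1 (derive1 psi) x),
      forall x : R, 0 < x -> {for x, continuous (derive1 (derive1 psi))} &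
      forall x : R, 0 < x -> derive1n 2 (phi^~ xi) x%:C = (derive1 (derive1 psi) x)%:C].
Proof.
move=> Ixi [_ _ phiR _] psi.
have [gen _ _] := hphi.1; have [[dphi _] _] := gen xi Ixi.
by have [h1 h2 h3 _ h4] := derive2_real_trace dphi phiR.
Qed.

(** [derivative_cvg] is used twice: for the concave [g n], converging on [D], then for [- g1 n], by
    then converging everywhere. The change of sign makes the derivatives [- g2 n] decreasing, thanks
    to the monotonicity of [p2]. *)
Lemma regular_time_limits xi : I xi -> regular_time xi ->
  let psi := real_field xi in let u n := xi + n.+1%:R^-1 in
  forall y, 0 < y ->
  (n.+1%:R * (p1 xi (u n) y - 1) @[n --> \oo] --> - derive1 psi y) /\
  (n.+1%:R * p2 xi (u n) y @[n --> \oo] --> - derive1 (derive1 psi) y).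
Proof.
move=> Ixi rt psi u.
have [psi1 psi2 cpsi2 _] := field_trace Ixi rt.
have [xi0 xiT _ [D dD Dlim]] := rt.
have [n0 n0P] := harmonic_time (ltW xi0) xiT.
have xiu n : xi <= u n by rewrite lerDl invr_ge0.
have cc n (nn0 : (n0 <= n)%N) := flow_concave3 Ixi (n0P n nn0) (xiu n).
pose g n y := n.+1%:R * (p xi (u n) y - y).
pose g1 n y := n.+1%:R * (p1 xi (u n) y - 1).
pose g2 n y := n.+1%:R * p2 xi (u n) y.
have dg n (y : R) : (n0 <= n)%N -> 0 < y -> is_derive y 1 (g n) (g1 n y).
  move=> nn0 y0; have [d1 _ _ _] := cc n nn0.
  exact: (is_deriveZ n.+1%:R (is_deriveB (d1 y y0) (is_derive_id y 1))).
have dg1 n (y : R) : (n0 <= n)%N -> 0 < y -> is_derive y 1 (g1 n) (g2 n y).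
  move=> nn0 y0; have [_ d2 _ _] := cc n nn0.
  have := is_deriveZ n.+1%:R (is_deriveB (d2 y y0) (is_derive_cst (1 : R) y 1)).
  by rewrite subr0.
have dN (f : R -> R) (y l : R) : is_derive y 1 f l -> is_derive y 1 (fun z => - f z) (- l).
  exact: is_deriveN.
have n_ge0 n : 0 <= n.+1%:R :> R by [].
have mono1 n a b : (n0 <= n)%N -> 0 < a -> a <= b -> g1 n b <= g1 n a.
  move=> nn0 a0 ab; have [_ d2 p2n _] := cc n nn0.
  apply: ler_wpM2l; [exact: n_ge0|apply: lerD => //].
  exact: (nonincreasing_pos d2 p2n).
have mono2 n a b : (n0 <= n)%N -> 0 < a -> a <= b -> - g2 n b <= - g2 n a.
  move=> nn0 a0 ab; have [_ _ _ p2n] := cc n nn0.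
  by rewrite lerN2; apply: ler_wpM2l; [exact: n_ge0|exact: p2n].
have dpsi1 (z : R) : 0 < z -> is_derive z 1 (fun z => - psi z) (- derive1 psi z).
  by move=> z0; exact: dN (psi1 z z0).
have dpsi2 (z : R) : 0 < z -> is_derive z 1 (fun z => - - derive1 psi z)
    (- - derive1 (derive1 psi) z).
  by move=> z0; exact: dN (dN _ _ _ (psi2 z z0)).
have cpsi1 (z : R) : 0 < z -> {for z, continuous (fun z => - derive1 psi z)}.
  move=> z0; have d2 := psi2 z z0; apply: (@cvgN _ R^o).
  by apply: differentiable_continuous; apply/derivable1_diffP; exact: ex_derive.
have cpsi2' (z : R) : 0 < z -> {for z, continuous (fun z => - - derive1 (derive1 psi) z)}.
  by move=> z0; apply: (@cvgN _ R^o); apply: (@cvgN _ R^o); exact: cpsi2.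
have lim1 := derivative_cvg dg mono1 dpsi1 cpsi1 dD Dlim.
move=> y y0; split; first exact: lim1.
have dT a b : 0 < a -> a < b -> exists d : R, [/\ [set: R] d, a < d & d < b].
  by move=> a0 ab; exists ((a + b) / 2); have [h1 h2] := midf_lt ab; split.
have dNg1 n (z : R) : (n0 <= n)%N -> 0 < z ->
    is_derive z 1 (fun z => - g1 n z) (- g2 n z).
  by move=> nn0 z0; exact: dN (dg1 n z nn0 z0).
have limN1 z : [set: R] z -> 0 < z -> - g1 n z @[n --> \oo] --> - - derive1 psi z.
  by move=> _ z0; exact: (@cvgN _ R^o _ _ _ _ _ (lim1 z z0)).
have H := derivative_cvg dNg1 mono2 dpsi2 cpsi2' dT limN1 y0.
exact: cvg_opp H.
Qed.

(** Both inequalities are limits of those for the second derivatives of the flow, reversed because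
    the field is minus the velocity. *)
Lemma field_convex xi : I xi -> regular_time xi ->
  let psi2 := derive1 (derive1 (real_field xi)) in
  (forall y, 0 < y -> 0 <= psi2 y) /\
  (forall x y, 0 < x -> x <= y -> psi2 y <= psi2 x).
Proof.
move=> Ixi rt psi2.
have lim2 y (y0 : 0 < y) := (regular_time_limits Ixi rt y0).2.
have [xi0 xiT _ _] := rt.
have [n0 n0P] := harmonic_time (ltW xi0) xiT.
have xiu n : xi <= xi + n.+1%:R^-1 by rewrite lerDl invr_ge0.
have cc n (nn0 : (n0 <= n)%N) := flow_concave3 Ixi (n0P n nn0) (xiu n).
split=> [y y0|x y x0 xy].
  rewrite -oppr_le0; apply: (ler_cvg_to (lim2 y y0) (cvg_cst (0 : R))).
  have n0N : \forall n \near \oo, (n0 <= n)%N by exists n0.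
  move: n0N; apply: filterS => n nn0; have [_ _ p2n _] := cc n nn0.
  by apply: mulr_ge0_le0; [exact: ler0n|exact: p2n].
rewrite -lerN2; apply: (ler_cvg_to (lim2 x x0) (lim2 y (lt_le_trans x0 xy))).
have n0N : \forall n \near \oo, (n0 <= n)%N by exists n0.
move: n0N; apply: filterS => n nn0; have [_ _ _ p2n] := cc n nn0.
by apply: ler_wpM2l; [exact: ler0n|exact: p2n].
Qed.

(** After scaling, the numerator in [curvatureB] converges by [regular_time_limits]; the denominator
    tends to 1 because even its scaled deviation from 1 converges. *)
Lemma curvature_right_derivative s t x : I s -> I t -> s <= t -> 0 < x ->
  regular_time t ->
  n.+1%:R * (curvature s x (t + n.+1%:R^-1) - curvature s x t) @[n --> \oo] -->
  derive1 (derive1 (real_field t)) (p s t x) * p1 s t x.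
Proof.
move=> Is It st x0 rt; have y0 := flow_gt0 Is It st x0.
have [l1 l2] := regular_time_limits It rt y0.
have [t0 tT _ _] := rt; have [n0 n0P] := harmonic_time (ltW t0) tT.
set y := p s t x in y0 l1 l2 *.
have tu n : t <= t + n.+1%:R^-1 by rewrite lerDl invr_ge0.
have hn : (n.+1%:R^-1 : R) @[n --> \oo] --> 0 by exact: cvg_harmonic.
set u := fun n => t + n.+1%:R^-1.
have p1lim : p1 t (u n) y @[n --> \oo] --> (1 : R).
  have H : (n.+1%:R * (p1 t (u n) y - 1)) * n.+1%:R^-1 + 1 @[n --> \oo] -->
      - derive1 (real_field t) y * 0 + 1.
    by apply: cvgD; [apply: cvgM; [exact: l1|exact: hn]|exact: cvg_cst].
  rewrite mulr0 add0r in H; apply: cvg_trans H; apply: near_eq_cvg.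
  by apply: nearW => n; rewrite [LHS]/= mulrC mulKf ?pnatr_eq0// subrK.
have H : (n.+1%:R * p2 t (u n) y) * (p1 t (u n) y)^-1 * - p1 s t x @[n --> \oo] -->
    - derive1 (derive1 (real_field t)) y * 1^-1 * - p1 s t x.
  apply: cvgM; last exact: cvg_cst.
  by apply: cvgM; [exact: l2|apply: cvgV => //; exact: oner_neq0].
rewrite invr1 mulr1 mulrNN in H; apply: cvg_trans H; apply: near_eq_cvg.
have n0N : \forall n \near \oo, (n0 <= n)%N by exists n0.
move: n0N; apply: filterS => n nn0.
rewrite [RHS](congr1 _ (curvatureB Is It (n0P n nn0) st (tu n) x0)) -/y.
by rewrite mulrN !mulNr mulrN !mulrA.
Qed.

Lemma curvature_integral s t0 x : I s -> I t0 -> s <= t0 -> 0 < x ->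
  let k t := derive1 (derive1 (real_field t)) (p s t x) * p1 s t x in
  lebesgue_measurable `[s, t0] (EFin \o k) /\
  (\int[cmu]_(t in `[s, t0]) (k t)%:E = (curvature s x t0)%:E)%E.
Proof.
move=> Is It0 st0 x0 k.
have [g gi gP] := curvature_dominated Is It0 st0 x0.
(* [p s s] is the identity, so the curvature starts at 0. *)
have -> : curvature s x t0 = curvature s x t0 - curvature s x s.
  by rewrite {3}/curvature (flow_second_id Is x0).2 oppr0 mul0r subr0.
apply: (dominated_ftc st0 gi gP).
have FF := ae_filter_ringOfSetsType mu.
have := (ae_completedP _).1 ae_regular_time; apply: filterS => t H /andP[st tt0].
have It : I t by exact: time_interval_between It0 (le_trans (time_interval_ge0 Is) (ltW st)) (ltW tt0).
exact: (curvature_right_derivative Is It (ltW st) x0 (H It)).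
Qed.

(** * Passage to the boundary point 0 *)

Lemma flow_trace s t : I s -> I t -> s <= t ->
  (forall x, 0 < x -> derive1n 1 (w s t) x%:C = (p1 s t x)%:C) /\
  (forall x, 0 < x -> derive1n 2 (w s t) x%:C = (p2 s t x)%:C).
Proof.
move=> Is It st; have [hol _ _ _] := hw.
by have [_ _ _ h1 h2] := derive2_real_trace (hol s t Is It st).1 (hp Is It st).2.
Qed.

Lemma flow_deriv_lim0 s t : I s -> I t -> s <= t ->
  [/\ has_lim0 (derive1n 1 (w s t)),
    forall x, 0 < x -> ((p1 s t x)%:E <= lim0 (derive1n 1 (w s t)))%E &
    forall u : nat -> R, (forall n, 0 < u n) -> u n @[n --> \oo] --> 0 ->
      (p1 s t (u n))%:E @[n --> \oo] --> lim0 (derive1n 1 (w s t))].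
Proof.
move=> Is It st; have [_ d2 p2n _] := flow_concave3 Is It st.
exact: (lim0_nonincreasing (flow_trace Is It st).1 (nonincreasing_pos d2 p2n)).
Qed.

Lemma flow_second_lim0 s t : I s -> I t -> s <= t ->
  has_lim0 (derive1n 2 (w s t)) /\
  forall u : nat -> R, (forall n, 0 < u n) -> u n @[n --> \oo] --> 0 ->
      (p2 s t (u n))%:E @[n --> \oo] --> lim0 (derive1n 2 (w s t)).
Proof.
move=> Is It st; have [_ _ _ p2m] := flow_concave3 Is It st.
exact: (lim0_nondecreasing (flow_trace Is It st).2 p2m).
Qed.

Lemma field_second_lim0 xi : I xi -> regular_time xi ->
  let psi2 := derive1 (derive1 (real_field xi)) in
  [/\ has_lim0 (derive1n 2 (phi^~ xi)),
    forall x, 0 < x -> ((psi2 x)%:E <= lim0 (derive1n 2 (phi^~ xi)))%E &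
    forall u : nat -> R, (forall n, 0 < u n) -> u n @[n --> \oo] --> 0 ->
      (psi2 (u n))%:E @[n --> \oo] --> lim0 (derive1n 2 (phi^~ xi))].
Proof.
move=> Ixi rt psi2; have [_ _ _ tr] := field_trace Ixi rt.
exact: (lim0_nonincreasing tr (field_convex Ixi rt).2).
Qed.

Context (hw0 : forall s t, I s -> I t -> s <= t ->
  w s t x%:C @[x --> 0^'+] --> (0 : R[i])).

Lemma flow_cvg0 s t (u : nat -> R) : I s -> I t -> s <= t ->
  (forall n, 0 < u n) -> u n @[n --> \oo] --> 0 ->
  p s t (u n) @[n --> \oo] --> 0.
Proof.
move=> Is It st u0 ul.
have /cvgCP H := cvg_comp _ _ (cvg_at_right0 u0 ul) (hw0 Is It st).
apply/cvgrPdist_lt => e /H; apply: filterS => n.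
by rewrite /= subr0 (hp Is It st).2// normc_real sub0r normrN.
Qed.

(** At each [x n] the identity [p2 = - p1 * curvature] is exact and the curvature is an integral;
    the formula is its limit. *)
Lemma second_derivative_formula s t : I s -> I t -> s <= t ->
  let integrand xi :=
    (lim0 (derive1n 2 (phi^~ xi)) * lim0 (derive1n 1 (w s xi)))%E in
  integral_exists `[s, t] integrand /\
  lim0 (derive1n 2 (w s t)) =
    (- lim0 (derive1n 1 (w s t)) * \int[cmu]_(xi in `[s, t]) integrand xi)%E.
Proof.
move=> Is It st integrand.
have FF := ae_filter_ringOfSetsType cmu.
have mcD : measurable (`[s, t]%classic : set (lebesgueType R)).
  exact: sub_caratheodory.
pose x n : R := n.+1%:R^-1.
have x0 n : 0 < x n by rewrite invr_gt0.
have xl : x n @[n --> \oo] --> 0 by exact: cvg_harmonic.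
have xmono m n : (m <= n)%N -> x n <= x m by move=> mn; rewrite lef_pV2 ?posrE// ler_nat.
have Ib r : s <= r -> r <= t -> I r.
  by move=> sr rt; exact: time_interval_between It (le_trans (time_interval_ge0 Is) sr) rt.
(* Setting [K] and [KK] to 0 at the remaining times, a null part of [[s, t]], makes positivity,
   monotonicity and convergence hold at every [xi]. *)
pose good xi := `[< s <= xi <= t /\ regular_time xi >].
pose k n xi := derive1 (derive1 (real_field xi)) (p s xi (x n)) * p1 s xi (x n).
pose K n xi : \bar R := if good xi then (k n xi)%:E else 0%E.
pose KK xi : \bar R := if good xi then integrand xi else 0%E.
have goodP xi : good xi -> [/\ s <= xi, xi <= t, I xi & regular_time xi].
  by move=> /asboolP[/andP[h1 h2] h3]; split => //; exact: Ib.
have factors xi : good xi -> forall n,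
    [/\ 0 <= derive1 (derive1 (real_field xi)) (p s xi (x n)), 0 <= p1 s xi (x n),
     ((derive1 (derive1 (real_field xi)) (p s xi (x n)))%:E <= lim0 (derive1n 2 (phi^~ xi)))%E &
     ((p1 s xi (x n))%:E <= lim0 (derive1n 1 (w s xi)))%E].
  move=> /goodP[sxi xit Ixi rt] n; have y0 := flow_gt0 Is Ixi sxi (x0 n).
  split.
  - exact: (field_convex Ixi rt).1.
  - exact: flow_deriv_ge0.
  - by have [_ h _] := field_second_lim0 Ixi rt; exact: h.
  - by have [_ h _] := flow_deriv_lim0 Is Ixi sxi; exact: h.
have K0 n xi : (0 <= K n xi)%E.
  rewrite /K; case: ifP => // /factors /(_ n)[h1 h2 _ _].
  by rewrite lee_fin mulr_ge0.
(* As [x n] decreases, so does [p s xi (x n)], and both factors, being nonincreasing in space,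
   grow. *)
have Kmono xi : nondecreasing_seq (K^~ xi).
  move=> m n mn; rewrite /K; case: ifP => // gxi.
  have [h1 h2 _ _] := factors xi gxi m.
  have [sxi xit Ixi rt] := goodP xi gxi.
  have [d1 d2 p2n _] := flow_concave3 Is Ixi sxi.
  rewrite lee_fin; apply: ler_pM; [exact: h1|exact: h2| |].
    apply: (field_convex Ixi rt).2; first exact: flow_gt0.
    apply: (nondecreasing_pos d1 _ (x0 n) (xmono m n mn)) => z z0.
    exact: flow_deriv_ge0.
  exact: (nonincreasing_pos d2 p2n (x0 n) (xmono m n mn)).
have KKlim xi : K n xi @[n --> \oo] --> KK xi.
  rewrite /K /KK; case: ifP => gxi; last exact: cvg_cst.
  have [sxi xit Ixi rt] := goodP xi gxi.
  have f1 n : 0 <= derive1 (derive1 (real_field xi)) (p s xi (x n)).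
    by have [h _ _ _] := factors xi gxi n; exact: h.
  have f2 n : 0 <= p1 s xi (x n) by have [_ h _ _] := factors xi gxi n; exact: h.
  have f3 n : ((derive1 (derive1 (real_field xi)) (p s xi (x n)))%:E <=
      lim0 (derive1n 2 (phi^~ xi)))%E.
    by have [_ _ h _] := factors xi gxi n; exact: h.
  have f4 n : ((p1 s xi (x n))%:E <= lim0 (derive1n 1 (w s xi)))%E.
    by have [_ _ _ h] := factors xi gxi n; exact: h.
  have y0 n : 0 < p s xi (x n) := flow_gt0 Is Ixi sxi (x0 n).
  have [_ _ l1] := field_second_lim0 Ixi rt.
  have [_ _ l2] := flow_deriv_lim0 Is Ixi sxi.
  exact: (cvge_mul_bounded f1 f2 f3 f4 (l1 _ y0 (flow_cvg0 Is Ixi sxi x0 xl)) (l2 x x0 xl)).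
have KKE xi : KK xi = limn (K^~ xi) by exact: (esym (cvg_lim _ (KKlim xi))).
have KK0 xi : (0 <= KK xi)%E.
  by rewrite KKE; apply: lime_ge; [apply/cvg_ex; eexists; exact: KKlim|exact: nearW].
have ae_good : {ae cmu, forall xi, s <= xi <= t -> good xi}.
  have := ae_regular_time; apply: filterS => xi H /[dup] sxt /andP[sxi xit].
  by apply/asboolP; split => //; exact: H (Ib _ sxi xit).
have complete := @completed_lebesgue_measure_is_complete R.
have KP n : lebesgue_measurable `[s, t] (K n) /\
    (\int[cmu]_(xi in `[s, t]) K n xi = (curvature s (x n) t)%:E)%E.
  have [mk Ik] := curvature_integral Is It st (x0 n).
  have kK : ae_eq cmu `[s, t]%classic (EFin \o k n) (K n).
    by move: ae_good; apply: filterS => xi H; rewrite /= in_itv/= => /H gxi; rewrite /K gxi.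
  have mK : lebesgue_measurable `[s, t] (K n) := ae_measurable_fun complete kK mk.
  split; first exact: mK.
  rewrite -Ik; apply: esym; exact: (ae_eq_integral _ _ mcD mk mK kK).
have Ilim : (curvature s (x n) t)%:E @[n --> \oo] --> (\int[cmu]_(xi in `[s, t]) KK xi)%E.
  have -> : (\int[cmu]_(xi in `[s, t]) KK xi = \int[cmu]_(xi in `[s, t]) limn (K^~ xi))%E.
    by apply: eq_integral => xi _; exact: KKE.
  have -> : (fun n => (curvature s (x n) t)%:E) = (fun n => \int[cmu]_(xi in `[s, t]) K n xi)%E.
    by apply/funext => n; rewrite (KP n).2.
  exact: (cvg_monotone_convergence mcD (fun n => (KP n).1) (fun n xi _ => K0 n xi)
    (fun xi _ => Kmono xi)).
have mKK : lebesgue_measurable `[s, t] KK.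
  apply: (@emeasurable_fun_cvg _ (lebesgueType R) R `[s, t]%classic K KK).
    by move=> n; exact: (KP n).1.
  by move=> xi _; exact: KKlim.
have KKint : ae_eq cmu `[s, t]%classic KK integrand.
  by move: ae_good; apply: filterS => xi H; rewrite /= in_itv/= => /H gxi; rewrite /KK gxi.
have mint : lebesgue_measurable `[s, t] integrand := ae_measurable_fun complete KKint mKK.
have Iint : (\int[cmu]_(xi in `[s, t]) integrand xi = \int[cmu]_(xi in `[s, t]) KK xi)%E.
  by apply: esym; exact: (ae_eq_integral _ _ mcD mKK mint KKint).
(* This bound by the limit lets [cvge_mul_bounded] cover a product [0 * +oo] as well. *)
have curv_le n : ((curvature s (x n) t)%:E <= \int[cmu]_(xi in `[s, t]) KK xi)%E.
  rewrite -(KP n).2; apply: ge0_le_integral;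
    [exact: mcD|by move=> xi _; exact: K0|exact: (KP n).1|exact: mKK|].
  move=> xi _; rewrite KKE.
  have cK : cvgn (K^~ xi) by apply/cvg_ex; eexists; exact: KKlim.
  by apply: lime_ge => //; exists n => // m nm; exact: Kmono.
split.
  split; first exact: mint.
  right.
  have -> : (\int[cmu]_(xi in `[s, t]) integrand^\- xi =
             \int[cmu]_(xi in `[s, t]) (cst 0%E : R -> \bar R) xi)%E.
    apply: (ae_eq_integral _ _ mcD (measurable_funeneg mint) (measurable_cst _)).
    move: KKint; apply: filterS => xi H sxt.
    by rewrite funenegE -H// max_r// oppe_le0.
  by rewrite integral0.
rewrite Iint.
have [_ p1le p1lim] := flow_deriv_lim0 Is It st.
have [_ p2lim] := flow_second_lim0 Is It st.
have prod := cvge_mul_bounded (fun n => flow_deriv_ge0 Is It st (x0 n))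
  (fun n => _ : 0 <= curvature s (x n) t) (fun n => p1le _ (x0 n)) curv_le
  (p1lim x x0 xl) Ilim.
have curv0 n : 0 <= curvature s (x n) t.
  by rewrite -lee_fin -(KP n).2; apply: integral_ge0 => xi _; exact: K0.
have := cvgeN (prod curv0).
have -> : (fun n => - (p1 s t (x n) * curvature s (x n) t)%:E)%E =
    (fun n => (p2 s t (x n))%:E).
  apply/funext => n; rewrite -EFinN; congr (_%:E).
  by rewrite /curvature mulrCA divff ?gt_eqF ?flow_deriv_gt0// mulr1 opprK.
move=> H; rewrite mulNe; have L2 := p2lim x x0 xl.
exact: (cvg_unique (@ereal_hausdorff R) L2 (H _)).
Qed.
End Flow.

(** [lim0] and the integral are total operators; the clauses with [has_lim0] and [integral_exists]
    certify that they denote genuine limits and a meaningful integral. For the field this is claimed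
    at almost every time, as the field is determined only up to a null set of times. *)
Theorem proposition3p18 (R : realType) (T : \bar R) (I : set R)
    (w : R -> R -> R[i] -> R[i]) (phi : R[i] -> R -> R[i])
    (hI : time_interval T I)
    (hw : ac_evolution_family I w)
    (hBF : forall s t, I s -> I t -> s <= t -> BF (w s t))
    (hphi : associated_vector_field T I w phi)
    (hw0 : forall s t, I s -> I t -> s <= t ->
      w s t x%:C @[x --> 0^'+] --> (0 : R[i])) :
  [/\ forall s t, I s -> I t -> s <= t ->
        has_lim0 (derive1n 1 (w s t)) /\ has_lim0 (derive1n 2 (w s t)),
      {ae completed_lebesgue_measure, forall xi, I xi ->
        has_lim0 (derive1n 2 (phi^~ xi))} &
      forall s t, I s -> I t -> s <= t ->
        let integrand xi :=
          (lim0 (derive1n 2 (phi^~ xi)) * lim0 (derive1n 1 (w s xi)))%E in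
        integral_exists `[s, t] integrand /\
        lim0 (derive1n 2 (w s t)) =
          (- lim0 (derive1n 1 (w s t)) *
            \int[completed_lebesgue_measure]_(xi in `[s, t]) integrand xi)%E].
Proof.
have real_trace (st : R * R) : exists f : R -> R,
    I st.1 -> I st.2 -> st.1 <= st.2 ->
    bernstein f /\ forall x, 0 < x -> w st.1 st.2 x%:C = (f x)%:C.
  case: st => s t /=.
  have [[Is It st]|nst] := pselect [/\ I s, I t & s <= t]; last first.
    (* A dummy value outside the admissible pairs, so that choice yields one function of all
       pairs. *)
    by exists id => Is It st; case: nst.
  by have [_ [f [bf wf _]]] := hBF s t Is It st; exists f.
have [P hP] := choice real_trace.
pose p s t := P (s, t).
have hp s t : I s -> I t -> s <= t ->
    bernstein (p s t) /\ forall x, 0 < x -> w s t x%:C = (p s t x)%:C := hP (s, t).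
split.
- move=> s t Is It st; split.
    by have [h _ _] := flow_deriv_lim0 hw hp Is It st; exact: h.
  exact: (flow_second_lim0 hw hp Is It st).1.
- have FF := ae_filter_ringOfSetsType (@completed_lebesgue_measure R).
  have := ae_regular_time hI hw hp hphi; apply: filterS => xi H Ixi.
  by have [h _ _] := field_second_lim0 hI hp hphi Ixi (H Ixi); exact: h.
- move=> s t Is It st.
  exact: (second_derivative_formula hI hw hp hphi hw0 Is It st).
Qed.
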